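(* Let $\mathcal E=\mathfrak a\bowtie\mathfrak b$ be a twilled Lie conformal algebra. Then the structure controlling left deformation maps is a differential graded Lie algebra $\bigl(\bigoplus_{n\ge1}\mathscr C^n(\mathfrak b,\mathfrak a),\mathbf d,\langle\cdot,\cdot\rangle\bigr)$, with $\mathscr C^n(\mathfrak b,\mathfrak a)$ in degree $n$, where for $f\in\mathscr C^p(\mathfrak b,\mathfrak a)$ $$\begin{aligned}(\mathbf df)_{\lambda_1,\dots,\lambda_p}(u_1,\dots,u_{p+1})=&\sum_{i=1}^{p+1}(-1)^{p+i}\varrho_{\mathfrak b}(u_i)_{\lambda_i}f(u_1,\dots,\widehat{u_i},\dots,u_{p+1})\big|_{\lambda_{p+1}\mapsto\lambda_{p+1}^\ddagger}\\&+\sum_{i<j}(-1)^{p+i+j-1}f(\{u_{i\,\lambda_i}u_j\}_{\mathfrak b},u_1,\dots,\widehat{u_i},\dots,\widehat{u_j},\dots,u_{p+1})\big|_{\lambda_{p+1}\mapsto\lambda_{p+1}^\ddagger},\end{aligned}$$ and for $f_1\in\mathscr C^p(\mathfrak b,\mathfrak a)$, $f_2\in\mathscr C^q(\mathfrak b,\mathfrak a)$ $$\begin{aligned}\langle f_1,f_2\rangle_{\lambda_1,\dots,\lambda_{p+q-1}}(u_1,\dots,u_{p+q})=&-\sum_{\sigma\in\mathbb S_{(q,1,p-1)}}(-1)^\sigma f_1\bigl(\varrho_{\mathfrak a}(f_2(u_{\sigma(1)},\dots,u_{\sigma(q)}))_{\lambda_{\sigma(1)}+\cdots+\lambda_{\sigma(q)}}u_{\sigma(q+1)},u_{\sigma(q+2)},\dots,u_{\sigma(p+q)}\bigr)\big|_{\lambda_{p+q}\mapsto\lambda_{p+q}^\ddagger}\\&+(-1)^{pq}\sum_{\sigma\in\mathbb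 S_{(p,1,q-1)}}(-1)^\sigma f_2\bigl(\varrho_{\mathfrak a}(f_1(u_{\sigma(1)},\dots,u_{\sigma(p)}))_{\lambda_{\sigma(1)}+\cdots+\lambda_{\sigma(p)}}u_{\sigma(p+1)},u_{\sigma(p+2)},\dots,u_{\sigma(p+q)}\bigr)\big|_{\lambda_{p+q}\mapsto\lambda_{p+q}^\ddagger}\\&-(-1)^{pq}\sum_{\sigma\in\mathbb S_{(p,q)}}(-1)^\sigma\bigl\{f_1(u_{\sigma(1)},\dots,u_{\sigma(p)})_{\lambda_{\sigma(1)}+\cdots+\lambda_{\sigma(p)}}f_2(u_{\sigma(p+1)},\dots,u_{\sigma(p+q)})\bigr\}_{\mathfrak a}\big|_{\lambda_{p+q}\mapsto\lambda_{p+q}^\ddagger}.\end{aligned}$$ Its Maurer-Cartan elements (the $B\in\mathscr C^1(\mathfrak b,\mathfrak a)$ with $\mathbf dB+\frac12\langle B,B\rangle=0$) are exactly the deformation maps of the matched pair of Lie conformal algebras, i.e. the $\mathbb C[\partial]$-module homomorphisms $B:\mathfrak b\to\mathfrak a$ such that for all $u,v\in\mathfrak b$ $$\{B(u)_\lambda B(v)\}_{\mathfrak a}+\varrho_{\mathfrak b}(u)_\lambda B(v)-\varrho_{\mathfrak b}(v)_{-\lambda-\partial}B(u)=B\bigl(\{u_\lambda v\}_{\mathfrak b}+\varrho_{\mathfrak a}(B(u))_\lambda v-\varrho_{\mathfrak a}(B(v))_{-\lambda-\partial}u\bigr).$$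
   Context: All vector spaces and linear maps are over $\mathbb C$, and all $\mathbb C[\partial]$-modules are finitely generated. A Lie conformal algebra is a $\mathbb C[\partial]$-module $\mathcal E$ with a $\mathbb C$-linear map $\mathcal E\otimes\mathcal E\to\mathcal E[\lambda]$, $x\otimes y\mapsto\{x_\lambda y\}$, such that $\{\partial x_\lambda y\}=-\lambda\{x_\lambda y\}$, $\{x_\lambda\partial y\}=(\partial+\lambda)\{x_\lambda y\}$, $\{x_\lambda y\}=-\{y_{-\lambda-\partial}x\}$ and $\{x_\lambda\{y_\mu z\}\}=\{\{x_\lambda y\}_{\lambda+\mu}z\}+\{y_\mu\{x_\lambda z\}\}$ ($\partial$ in a subscript acts from the left on the coefficients). A twilled Lie conformal algebra $\mathcal E=\mathfrak a\bowtie\mathfrak b$ is a Lie conformal algebra with a $\mathbb C[\partial]$-module decomposition $\mathcal E=\mathfrak a\oplus\mathfrak b$ such that both $\mathfrak a$ and $\mathfrak b$ are Lie conformal subalgebras. For $a,b\in\mathfrak a$, $u,v\in\mathfrak b$: $\{a_\lambda b\}_{\mathfrak a}=\{a_\lambda b\}$, $\{u_\lambda v\}_{\mathfrak b}=\{u_\lambda v\}$, $\varrho_{\mathfrak b}(u)_\lambda a=\mathrm{pr}_{\mathfrak a}\{u_\lambda a\}$, $\varrho_{\mathfrak a}(a)_\lambda v=\mathrm{pr}_{\mathfrak b}\{a_\lambda v\}$. A left deformation map is a $\mathbb C[\partial]$-module homomorphism $B:\mathfrak b\to\mathfrak a$ whose graph $\{(B(u),u)\}$ is a subalgebra of $\mathcal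 E$. Cochains: $\mathscr C^k(M,N)$, $k\ge1$, is the space of $\mathbb C$-linear maps $\varphi:M^{\otimes k}\to\mathbb C[\lambda_1,\dots,\lambda_{k-1}]\otimes N$ such that, with $\lambda_k^\ddagger:=-\sum_{j=1}^{k-1}\lambda_j-\partial$ ($\partial$ acting on $N$ from the left), (i) $\varphi(\dots,\partial a_i,\dots)=-\lambda_i\varphi(\dots,a_i,\dots)$ for $1\le i\le k-1$ and $\varphi(\dots,\partial a_k)=-\lambda_k^\ddagger\varphi(\dots,a_k)$; (ii) for every permutation $\sigma$, $\varphi_{\lambda_1,\dots,\lambda_{k-1}}(a_1,\dots,a_k)=(-1)^\sigma\varphi_{\lambda_{\sigma(1)},\dots,\lambda_{\sigma(k-1)}}(a_{\sigma(1)},\dots,a_{\sigma(k)})|_{\lambda_k\mapsto\lambda_k^\ddagger}$. In particular $\mathscr C^1(M,N)=\mathrm{Hom}_{\mathbb C[\partial]}(M,N)$. Parameter convention: the variable $\lambda_i$ is attached to $u_i$, and to any expression built from $u_{i_1},\dots,u_{i_r}$ the sum $\lambda_{i_1}+\cdots+\lambda_{i_r}$; the (suppressed) subscripts of a cochain are the variables attached to all its arguments except the last, in order. Hats denote omission. $\mathbb S_{(i_1,\dots,i_r)}$ denotes the unshuffles (permutations increasing on each of the consecutive blocks of sizes $i_1,\dots,i_r$). The structure controlling left deformation maps is, in general, the $L_\infty$-algebra on $\bigoplus_{n\ge1}\mathscr C^n(\mathfrak b,\mathfrak a)$ with $l_1(f)=[\widehat\nu_2,\widehat f\,]_{NR}$,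 $l_2(f_1,f_2)=[[\widehat\nu_1,\widehat f_1]_{NR},\widehat f_2]_{NR}$ and a ternary operation $l_3$ built from $\mathrm{pr}_{\mathfrak b}\{a_\lambda b\}$, which vanishes in the twilled case. Here $\widehat f((a_1,u_1),\dots,(a_k,u_k))=(f(u_1,\dots,u_k),0)$, $\widehat\nu_{1,\lambda}((a,u),(b,v))=(\{a_\lambda b\}_{\mathfrak a},\varrho_{\mathfrak a}(a)_\lambda v-\varrho_{\mathfrak a}(b)_{-\lambda-\partial}u)$, $\widehat\nu_{2,\lambda}((a,u),(b,v))=(\varrho_{\mathfrak b}(u)_\lambda b-\varrho_{\mathfrak b}(v)_{-\lambda-\partial}a,\{u_\lambda v\}_{\mathfrak b})$, and for $f\in\mathscr C^m(\mathcal E,\mathcal E)$, $g\in\mathscr C^n(\mathcal E,\mathcal E)$, $[f,g]_{NR}=f\star g-(-1)^{(m-1)(n-1)}g\star f$ with $(f\star g)(x_1,\dots,x_{m+n-1})=\sum_{\sigma\in\mathbb S_{(n,m-1)}}(-1)^\sigma f(g(x_{\sigma(1)},\dots,x_{\sigma(n)}),x_{\sigma(n+1)},\dots,x_{\sigma(m+n-1)})|_{\lambda_{m+n-1}\mapsto\lambda_{m+n-1}^\ddagger}$ (same parameter convention). After the degree shift placing $\mathscr C^n$ in degree $n$, it corresponds to $\mathbf d=l_1$, $\langle f_1,f_2\rangle=(-1)^{p-1}l_2(f_1,f_2)$ for $f_1\in\mathscr C^p$. *)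

(* Defs.v *)
From HB Require Import structures.
From mathcomp Require Import all_boot all_order all_algebra all_fingroup.
From mathcomp Require Import boolp classical_sets functions.
From mathcomp Require Import mpoly.

Set Implicit Arguments.
Unset Strict Implicit.
Unset Printing Implicit Defensive.

Import GRing.Theory.

Local Open Scope ring_scope.

(** * Polynomials with coefficients in a module *)

(* [lpoly V n] is V[lambda_0, .., lambda_(n-1)] for an R-module V, a polynomial
   being the family of its coefficients. It is a module over
   R[lambda_0, .., lambda_(n-1)]; for R = K[d] it is
   K[lambda_0, .., lambda_(n-1)] (x) V, with d acting on the coefficients. *)
Record lpoly (R : comNzRingType) (V : lmodType R) (n : nat) : Type := LPoly {
  lcoef :> 'X_{1..n} -> V;
  lcoef_fin : exists d, forall m, (d <= mdeg m)%N -> lcoef m = 0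
}.

HB.instance Definition _ (R : comNzRingType) (V : lmodType R) (n : nat) :=
  gen_eqMixin (lpoly V n).
HB.instance Definition _ (R : comNzRingType) (V : lmodType R) (n : nat) :=
  gen_choiceMixin (lpoly V n).

Section LPolyModule.
Context (R : comNzRingType) (V : lmodType R) (n : nat).
Implicit Types (p q : {mpoly R[n]}) (g h : lpoly V n) (k m : 'X_{1..n}).

Lemma lpolyP g h : g =1 h -> g = h.
Proof.
case: g h => [g gf] [h hf] /= /funext egh; rewrite egh in gf *.
by congr LPoly; exact: Prop_irrelevance.
Qed.

Fact lzero_fin : exists d, forall m, (d <= mdeg m)%N -> (0 : V) = 0.
Proof. by exists 0%N. Qed.
Definition lzero : lpoly V n := LPoly lzero_fin.

Fact lopp_fin g : exists d, forall m, (d <= mdeg m)%N -> - g m = 0.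
Proof. by case: (lcoef_fin g) => d gd; exists d => m /gd ->; rewrite oppr0. Qed.
Definition lopp g : lpoly V n := LPoly (lopp_fin g).

Fact ladd_fin g h : exists d, forall m, (d <= mdeg m)%N -> g m + h m = 0.
Proof.
case: (lcoef_fin g) (lcoef_fin h) => d gd [e he]; exists (maxn d e) => m.
by rewrite geq_max => /andP[/gd -> /he ->]; rewrite addr0.
Qed.
Definition ladd g h : lpoly V n := LPoly (ladd_fin g h).

Fact lscale_fin p g : exists d, forall k, (d <= mdeg k)%N ->
  \sum_(m : 'X_{1..n < (mdeg k).+1} | (m <= k)%MM) p@_m *: g (k - m)%MM = 0.
Proof.
case: (lcoef_fin g) => d gd; exists (msize p + d)%N => k le_k.
rewrite big1 // => m lemk; have [le_pm|lt_mp] := leqP (msize p) (mdeg m).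
  by rewrite memN_msupp_eq0 ?scale0r // msize_mdeg_ge.
rewrite gd ?scaler0 // -(leq_add2l (mdeg m)) -mdegD addmC submK //.
by apply: leq_trans le_k; rewrite leq_add2r ltnW.
Qed.
Definition lscale p g : lpoly V n := LPoly (lscale_fin p g).

Fact laddA : associative ladd.
Proof. by move=> f g h; apply: lpolyP => m /=; rewrite addrA. Qed.
Fact laddC : commutative ladd.
Proof. by move=> f g; apply: lpolyP => m /=; rewrite addrC. Qed.
Fact ladd0 : left_id lzero ladd.
Proof. by move=> f; apply: lpolyP => m /=; rewrite add0r. Qed.
Fact laddN : left_inverse lzero lopp ladd.
Proof. by move=> f; apply: lpolyP => m /=; rewrite addNr. Qed.

HB.instance Definition _ := GRing.isZmodule.Build (lpoly V n)
  laddA laddC ladd0 laddN.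

Fact lscaleDl g : {morph lscale^~ g : p q / p + q}.
Proof.
move=> p q; apply: lpolyP => k /=; rewrite -big_split /=.
by apply: eq_bigr => m _; rewrite mcoeffD scalerDl.
Qed.

Fact lscaleDr : right_distributive lscale +%R.
Proof.
move=> p g h; apply: lpolyP => k /=; rewrite -big_split /=.
by apply: eq_bigr => m _; rewrite scalerDr.
Qed.

Lemma lscaleX c m g k :
  lscale (c *: 'X_[m]) g k = if (m <= k)%MM then c *: g (k - m)%MM else 0.
Proof.
rewrite /=; case: ifPn => [lemk|Nlemk]; last first.
  rewrite big1 // => x lexk; rewrite mcoeffZ mcoeffX.
  by case: eqP Nlemk => [->|]; rewrite ?lexk // mulr0 scale0r.
have lt_m : (mdeg m < (mdeg k).+1)%N.
  by rewrite ltnS -(submK lemk) mdegD leq_addl.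
rewrite (bigD1 (BMultinom lt_m)) //= mcoeffZ mcoeffX eqxx mulr1 big1 ?addr0 //.
move=> x /andP[_ /eqP xNm]; rewrite mcoeffZ mcoeffX; case: eqP => [exm|_].
  by case: xNm; apply: val_inj; rewrite /= exm.
by rewrite mulr0 scale0r.
Qed.

Fact lscale0 g : lscale 0 g = 0.
Proof. by apply: lpolyP => k /=; rewrite big1 // => m _; rewrite mcoeff0 scale0r. Qed.

Fact lscaleA p q g : lscale p (lscale q g) = lscale (p * q) g.
Proof.
elim/mpolyind: p => [|c m p _ _ IHp]; first by rewrite mul0r !lscale0.
rewrite mulrDl !lscaleDl {}IHp; congr (_ + _).
elim/mpolyind: q => [|d l q _ _ IHq].
  rewrite mulr0 !lscale0; apply: lpolyP => k /=.
  by rewrite big1 // => x _; rewrite scaler0.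
rewrite mulrDr !lscaleDl lscaleDr {}IHq; congr (_ + _).
rewrite -scalerAl -scalerAr scalerA -mpolyXD; apply: lpolyP => k.
rewrite !lscaleX -submDA.
have -> : (m + l <= k)%MM = (m <= k)%MM && (l <= k - m)%MM.
  apply/mnm_lepP/andP => [le_ml|[/mnm_lepP le_m /mnm_lepP le_l] i].
    split; apply/mnm_lepP => i; have := le_ml i; rewrite mnmDE ?mnmBE.
      exact/leq_trans/leq_addr.
    by move=> le_i; rewrite -(leq_add2l (m i)) subnKC // (leq_trans _ le_i) ?leq_addr.
  by have := le_l i; rewrite mnmDE mnmBE -(leq_add2l (m i)) subnKC.
case: ifP => //= _; case: ifP => _; rewrite ?scalerA ?scaler0 //.
Qed.

Fact lscale1 : left_id 1 lscale.
Proof.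
move=> g; apply: lpolyP => k; rewrite -mpolyX0 -[X in lscale X]scale1r lscaleX.
have -> : (0 <= k)%MM by apply/mnm_lepP => i; rewrite mnm0E.
by rewrite subm0 scale1r.
Qed.

HB.instance Definition _ := GRing.Zmodule_isLmodule.Build {mpoly R[n]}
  (lpoly V n) lscaleA lscale1 lscaleDr lscaleDl.

Fact lconst_fin (v : V) :
  exists d, forall m, (d <= mdeg m)%N -> (if m == 0%MM then v else 0) = 0.
Proof.
by exists 1%N => m; rewrite lt0n mdeg_eq0; case: eqP.
Qed.
Definition lconst (v : V) : lpoly V n := LPoly (lconst_fin v).

(* The sum of the [F m (g m)] over the monomials m occurring in g. *)
Definition lpoly_bound g : nat := projT1 (cid (lcoef_fin g)).
Definition lsum (W : zmodType) (F : 'X_{1..n} -> V -> W) g : W :=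
  \sum_(m : 'X_{1..n < lpoly_bound g} | g m != 0) F m (g m).

End LPolyModule.

Arguments lconst {R V} n v.

Section LambdaCalculus.
Context {K : fieldType}.
Implicit Types (n : nat) (U V W : lmodType {poly K}).

Definition lam n (i : 'I_n) : {mpoly {poly K}[n]} := 'X_i.

Definition partial n : {mpoly {poly K}[n]} := ('X : {poly K})%:MP.

(* The parameters attached to n arguments once the last one has been replaced
   by lambda_n^ddagger = - (lambda_1 + .. + lambda_(n-1)) - d. *)
Definition lamdag n (i : 'I_n) : {mpoly {poly K}[n.-1]} :=
  if insub (i : nat) is Some j then lam j else - \sum_j lam j - partial n.-1.

(* Extension of [f] to V[lambda], linearly over K[lambda] (not over d). *)
Definition lext V W n (f : V -> lpoly W n) (g : lpoly V n) : lpoly W n :=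
  lsum (fun m v => 'X_[m] *: f v) g.

Definition lmap V W n (f : V -> W) : lpoly V n -> lpoly W n :=
  lext (fun v => lconst n (f v)).

(* Substitution lambda_i |-> c i; the c i may involve d, which then acts from
   the left on the coefficients of the polynomial. *)
Definition lsubst V m n (c : 'I_m -> {mpoly {poly K}[n]}) (g : lpoly V m) :
    lpoly V n :=
  lsum (fun k v => (\prod_i c i ^+ k i) *: lconst n v) g.

(* The substitution lambda_n |-> lambda_n^ddagger. *)
Definition ldag V n : lpoly V n -> lpoly V n.-1 := lsubst (@lamdag n).

(* lambda |-> - lambda - d *)
Definition lswap V : lpoly V 1 -> lpoly V 1 :=
  lsubst (fun=> - lam ord0 - partial 1).

(* {x_s y} for x, y with coefficients in K[lambda] and s in place of lambda. *)
Definition lbr U V W n (br : U -> V -> lpoly W 1) (s : {mpoly {poly K}[n]})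
    (x : lpoly U n) (y : lpoly V n) : lpoly W n :=
  lext (fun x0 => lext (fun y0 => lsubst (fun=> s) (br x0 y0)) y) x.

End LambdaCalculus.

Arguments ldag {K V n} g.

(** * Lie conformal algebras *)

Definition finitely_generated (R : nzRingType) (M : lmodType R) : Prop :=
  exists s : seq M, forall x : M, exists c : nat -> R,
    x = \sum_(i < size s) c i *: s`_i.

Record lie_conformal (K : fieldType) (M : lmodType {poly K})
    (br : M -> M -> lpoly M 1) : Prop := {
  lie_linl : forall (c : K) x x' y,
    br (c%:P *: x + x') y = c%:P%:MP *: br x y + br x' y;
  lie_linr : forall (c : K) x y y',
    br x (c%:P *: y + y') = c%:P%:MP *: br x y + br x y';
  lie_sesql : forall x y, br ('X *: x) y = - lam ord0 *: br x y;
  lie_sesqr : forall x y, br x ('X *: y) = (partial 1 + lam ord0) *: br x y;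
  lie_skew : forall x y, br x y = - lswap (br y x);
  lie_jacobi : forall x y z,
    let l0 : {mpoly {poly K}[2]} := lam ord0 in
    let l1 : {mpoly {poly K}[2]} := lam ord_max in
    lbr br l0 (lconst 2 x) (lsubst (fun=> l1) (br y z)) =
      lbr br (l0 + l1) (lsubst (fun=> l0) (br x y)) (lconst 2 z) +
      lbr br l1 (lconst 2 y) (lsubst (fun=> l0) (br x z))
}.

Record lie_subalgebra (K : fieldType) (M : lmodType {poly K})
    (br : M -> M -> lpoly M 1) (S : set M) : Prop := {
  liesub0 : S 0;
  liesubZD : forall (p : {poly K}) x y, S x -> S y -> S (p *: x + y);
  liesub_br : forall x y k, S x -> S y -> S (br x y k)
}.

(* E = a (+) b is taken to be the direct sum a * b of K[d]-modules. *)
Record twilled (K : fieldType) (a b : lmodType {poly K})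
    (br : (a * b)%type -> (a * b)%type -> lpoly (a * b)%type 1) : Prop := {
  twilled_lie : lie_conformal br;
  twilled_subl : lie_subalgebra br [set z : (a * b)%type | z.2 = 0];
  twilled_subr : lie_subalgebra br [set z : (a * b)%type | z.1 = 0]
}.

Section TwilledOperations.
Context {K : fieldType} {a b : lmodType {poly K}}.
Variable br : (a * b)%type -> (a * b)%type -> lpoly (a * b)%type 1.

Definition inja (x : a) : (a * b)%type := (x, 0).
Definition injb (u : b) : (a * b)%type := (0, u).
Definition pra (z : (a * b)%type) : a := z.1.
Definition prb (z : (a * b)%type) : b := z.2.

Definition bra (x y : a) : lpoly a 1 := lmap pra (br (inja x) (inja y)).
Definition brb (u v : b) : lpoly b 1 := lmap prb (br (injb u) (injb v)).
Definition rhob (u : b) (x : a) : lpoly a 1 := lmap pra (br (injb u) (inja x)).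
Definition rhoa (x : a) (v : b) : lpoly b 1 := lmap prb (br (inja x) (injb v)).
Definition theta (x y : a) : lpoly b 1 := lmap prb (br (inja x) (inja y)).

Definition left_deformation_map (B : {linear b -> a}) : Prop :=
  lie_subalgebra br [set z | exists u, z = (B u, u)].

Definition deformation_map (B : {linear b -> a}) : Prop :=
  forall u v : b,
    bra (B u) (B v) + rhob u (B v) - lswap (rhob v (B u)) =
    lmap B (brb u v + rhoa (B u) v - lswap (rhoa (B v) u)).

End TwilledOperations.

(** * Cochains *)

Definition cochain (K : fieldType) (M N : lmodType {poly K}) (k : nat) : Type :=
  ('I_k -> M) -> lpoly N k.-1.

HB.instance Definition _ (K : fieldType) (M N : lmodType {poly K}) (k : nat) :=
  GRing.Zmodule.on (cochain M N k).

Section CochainModule.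
Context (K : fieldType) (M N : lmodType {poly K}) (k : nat).
Implicit Types (c : K) (f g : cochain M N k).

Definition cochain_scale c f : cochain M N k := fun x => c%:P%:MP *: f x.

Lemma cochain_scaleA c d f :
  cochain_scale c (cochain_scale d f) = cochain_scale (c * d) f.
Proof.
by apply/funext => x; rewrite /cochain_scale scalerA -rmorphM -polyCM.
Qed.

Lemma cochain_scale1 : left_id 1 cochain_scale.
Proof. by move=> f; apply/funext => x; rewrite /cochain_scale scale1r. Qed.

Lemma cochain_scaleDr : right_distributive cochain_scale +%R.
Proof. by move=> c f g; apply/funext => x; exact: scalerDr. Qed.

Lemma cochain_scaleDl f : {morph cochain_scale^~ f : c d / c + d}.
Proof.
by move=> c d; apply/funext => x; rewrite /cochain_scale !raddfD scalerDl.
Qed.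

HB.instance Definition _ := GRing.Zmodule_isLmodule.Build K (cochain M N k)
  cochain_scaleA cochain_scale1 cochain_scaleDr cochain_scaleDl.

End CochainModule.

(* The subspace C^k(M, N); the value k = 0, which does not occur among
   cochains, gives the zero space. *)
Record is_cochain (K : fieldType) (M N : lmodType {poly K}) (k : nat)
    (f : cochain M N k) : Prop := {
  cochain_pos : k = 0 -> f = 0;
  cochain_lin : forall (i : 'I_k) (c : K) (y y' : M) (x : 'I_k -> M),
    f [eta x with i |-> c%:P *: y + y'] =
    c%:P%:MP *: f [eta x with i |-> y] + f [eta x with i |-> y'];
  cochain_sesq : forall (i : 'I_k) (x : 'I_k -> M),
    f [eta x with i |-> 'X *: x i] = - lamdag i *: f x;
  cochain_skew : forall (s : 'S_k) (x : 'I_k -> M),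
    f x = (-1) ^+ s *:
      lsubst (fun j => lamdag (s (widen_ord (leq_pred k) j))) (f (x \o s))
}.

(* C^1(M, N) = Hom_(K[d])(M, N) *)
Definition hom_cochain (K : fieldType) (M N : lmodType {poly K})
    (B : {linear M -> N}) : cochain M N 1 := fun x => lconst 0 (B (x ord0)).

Lemma hom_cochain_inj (K : fieldType) (M N : lmodType {poly K})
    (B C : {linear M -> N}) : hom_cochain B = hom_cochain C -> B =1 C.
Proof.
move=> eqBC x; have := congr1 (fun f : cochain M N 1 => f (fun=> x) 0%MM) eqBC.
by rewrite /= eqxx.
Qed.

Section CochainOperations.
Context {K : fieldType}.
Implicit Types (M N : lmodType {poly K}) (k m n : nat).

(* f(x_1, .., x_k), the list [s] giving the parameters attached to the
   arguments; the parameter attached to the last one is not used. *)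
Definition capp M N k n (f : cochain M N k) (s : seq {mpoly {poly K}[n]})
    (x : seq M) : lpoly N n :=
  lsubst (fun j : 'I_k.-1 => s`_j) (f (fun j : 'I_k => x`_j)).

(* The same when the first argument [g] has coefficients in K[lambda]. *)
Definition capp1 M N k n (f : cochain M N k) (s : seq {mpoly {poly K}[n]})
    (g : lpoly M n) (x : seq M) : lpoly N n :=
  lext (fun y => capp f s (y :: x)) g.

(* S_(i_1, .., i_r), for [bs] the list of the i_j *)
Definition unshuffle k (bs : seq nat) (s : 'S_k) : bool :=
  all (sorted ltn) (reshape bs [seq (s i : nat) | i <- enum 'I_k]).

Definition pargs M k (s : 'S_k) (x : 'I_k -> M) : seq M :=
  [seq x (s i) | i <- enum 'I_k].

Definition plams k (s : 'S_k) : seq {mpoly {poly K}[k]} :=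
  [seq lam (s i) | i <- enum 'I_k].

(* f * g, for k = m + n - 1 *)
Definition nr_star M m n k (f : cochain M M m) (g : cochain M M n) :
    cochain M M k := fun x =>
  ldag (\sum_(s : 'S_k | unshuffle [:: n; m.-1] s)
    let l := plams s in let w := pargs s x in
    (-1) ^+ s *:
      capp1 f (\sum_(t <- take n l) t :: drop n l)
        (capp g (take n l) (take n w)) (drop n w)).

Definition nr_bracket M m n (f : cochain M M m) (g : cochain M M n) :
    cochain M M (m + n).-1 :=
  nr_star f g - (-1) ^+ (m.-1 * n.-1) *: nr_star g f.

End CochainOperations.

(** * The structure controlling left deformation maps *)

Section Control.
Context {K : fieldType} {a b : lmodType {poly K}}.
Variable br : (a * b)%type -> (a * b)%type -> lpoly (a * b)%type 1.
Notation E := (a * b)%type.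

Definition lpair n (p : lpoly a n) (q : lpoly b n) : lpoly E n :=
  lmap inja p + lmap injb q.

Definition hat k (f : cochain b a k) : cochain E E k :=
  fun z => lmap inja (f (fun i => prb (z i))).

Definition nu1 : cochain E E 2 := fun z =>
  let: (x, u) := z ord0 in let: (y, v) := z ord_max in
  lpair (bra br x y) (rhoa br x v - lswap (rhoa br y u)).

Definition nu2 : cochain E E 2 := fun z =>
  let: (x, u) := z ord0 in let: (y, v) := z ord_max in
  lpair (rhob br u y - lswap (rhob br v x)) (brb br u v).

Definition thetahat : cochain E E 2 := fun z =>
  lmap injb (theta br (pra (z ord0)) (pra (z ord_max))).

Definition l1 p (f : cochain b a p) : cochain E E p.+1 :=
  nr_bracket nu2 (hat f).

Definition l2 p q (f1 : cochain b a p) (f2 : cochain b a q) :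
    cochain E E (p + q) :=
  nr_bracket (nr_bracket nu1 (hat f1)) (hat f2).

Definition l3 p q r (f1 : cochain b a p) (f2 : cochain b a q)
    (f3 : cochain b a r) : cochain E E (p + q + r).-1 :=
  nr_bracket (nr_bracket (nr_bracket thetahat (hat f1)) (hat f2)) (hat f3).

(* The positions are counted from 0, hence the [i.+1] and [j.+1]. *)
Definition cochain_d p (f : cochain b a p) : cochain b a p.+1 := fun u =>
  ldag (
    \sum_(i < p.+1) (-1) ^+ (p + i.+1) *:
      lbr (rhob br) (lam i) (lconst _ (u i))
        (capp f [seq lam k | k <- enum 'I_p.+1 & k != i]
                [seq u k | k <- enum 'I_p.+1 & k != i])
    + \sum_(i < p.+1) \sum_(j < p.+1 | (i < j)%N) (-1) ^+ (p + i.+1 + j.+1).-1 *: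
      capp1 f
        (lam i + lam j
           :: [seq lam k | k <- enum 'I_p.+1 & (k != i) && (k != j)])
        (lbr (brb br) (lam i) (lconst _ (u i)) (lconst _ (u j)))
        [seq u k | k <- enum 'I_p.+1 & (k != i) && (k != j)]).

(* The sum over S_(q, 1, p - 1) of (-1)^s f1(rho_a(f2(u, ..)) u, u, ..). *)
Definition comp_sum p q k (f1 : cochain b a p) (f2 : cochain b a q)
    (u : 'I_k -> b) : lpoly a k :=
  \sum_(s : 'S_k | unshuffle [:: q; 1; p.-1] s)
    let l := plams s in let w := pargs s u in
    (-1) ^+ s *:
      capp1 f1 (\sum_(t <- take q.+1 l) t :: drop q.+1 l)
        (lbr (rhoa br) (\sum_(t <- take q l) t)
          (capp f2 (take q l) (take q w)) (lconst k w`_q))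
        (drop q.+1 w).

(* The sum over S_(p, q) of (-1)^s {f1(u, ..) f2(u, ..)}_a. *)
Definition cup_sum p q k (f1 : cochain b a p) (f2 : cochain b a q)
    (u : 'I_k -> b) : lpoly a k :=
  \sum_(s : 'S_k | unshuffle [:: p; q] s)
    let l := plams s in let w := pargs s u in
    (-1) ^+ s *:
      lbr (bra br) (\sum_(t <- take p l) t)
        (capp f1 (take p l) (take p w)) (capp f2 (drop p l) (drop p w)).

Definition cochain_br p q (f1 : cochain b a p) (f2 : cochain b a q) :
    cochain b a (p + q) := fun u =>
  ldag (- comp_sum f1 f2 u + (-1) ^+ (p * q) *: comp_sum f2 f1 u
        - (-1) ^+ (p * q) *: cup_sum f1 f2 u).

End Control.

(** * Differential graded Lie algebras *)

Section DGLie.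
Context {K : fieldType} {F : nat -> lmodType K}.
Variables (V : forall n, set (F n)) (d : forall n, F n -> F n.+1).
Variable br : forall p q, F p -> F q -> F (p + q)%N.

Definition degcast m n (e : m = n) (x : F m) : F n :=
  ecast i (F i) e x.

(* (+)_n V n, with V n a subspace of F n placed in degree n *)
Record dg_lie : Prop := {
  dg_sub0 : forall n, V (0 : F n);
  dg_subZD : forall n c (x y : F n), V x -> V y -> V (c *: x + y);
  dg_d_in : forall n (x : F n), V x -> V (d x);
  dg_br_in : forall p q (x : F p) (y : F q), V x -> V y -> V (br x y);
  dg_d_lin : forall n c (x y : F n), V x -> V y ->
    d (c *: x + y) = c *: d x + d y;
  dg_br_linl : forall p q c (x x' : F p) (y : F q), V x -> V x' -> V y ->
    br (c *: x + x') y = c *: br x y + br x' y;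
  dg_br_linr : forall p q c (x : F p) (y y' : F q), V x -> V y -> V y' ->
    br x (c *: y + y') = c *: br x y + br x y';
  dg_anti : forall p q (x : F p) (y : F q), V x -> V y ->
    br x y = - ((-1) ^+ (p * q) *: degcast (addnC q p) (br y x));
  dg_jacobi : forall p q r (x : F p) (y : F q) (z : F r), V x -> V y -> V z ->
    br x (br y z) = degcast (esym (addnA p q r)) (br (br x y) z)
      + (-1) ^+ (p * q) *: degcast (addnCA q p r) (br y (br x z));
  dg_d2 : forall n (x : F n), V x -> d (d x) = 0;
  dg_leibniz : forall p q (x : F p) (y : F q), V x -> V y ->
    d (br x y) = br (d x) y
      + (-1) ^+ p *: degcast (addnS p q) (br x (d y))
}.

Definition maurer_cartan (x : F 1) : Prop :=
  V x /\ d x + 2%:R^-1 *: br x x = 0.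

End DGLie.

(* Main.v *)
Require Import Defs.
From HB Require Import structures.
From mathcomp Require Import all_boot all_order all_algebra all_fingroup.
From mathcomp Require Import boolp classical_sets functions reals complex.
From mathcomp Require Import mpoly ring zify.

Set Implicit Arguments.
Unset Strict Implicit.
Unset Printing Implicit Defensive.

Import GRing.Theory.
Local Open Scope ring_scope.

(** The cochains of the module E = a (+) b form a graded Lie algebra under the
    Nijenhuis-Richardson bracket, and a skew bracket on E satisfies the
    Jacobi identity exactly when its square [mu, mu] vanishes. For a twilled
    algebra the bracket is mu = nu1 + nu2. Multiplying a by a scalar t <> 0
    turns mu into the isomorphic bracket t nu1 + nu2, so that three values of t
    suffice to separate [nu1, nu1] = [nu2, nu1] = [nu2, nu2] = 0 ([nu_sq]). The
    cochains on b with values in a are embedded by [hat] as an abelian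
    subalgebra ([nrb_hat0]): their values lie in a, and they vanish on a. The
    derived bracket [[nu1, F], G] is then a graded Lie bracket up to signs
    ([dbr_sym], [dbr_jacobi]), while F |-> [nu2, F] squares to zero ([nrb_sq0])
    and is a derivation of the derived bracket, nu2 and nu1 having bracket zero
    ([dbr_der]). It remains to see that these two operations are given by the
    explicit formulas ([hat_d], [hat_br]): half of the insertions in the double
    bracket vanish, for the reason that makes the subalgebra abelian.

    The axioms of cochains single out the last argument, which has no parameter
    of its own. The symmetry is restored by giving every argument a weight, by
    allowing arguments with polynomial coefficients, and by computing modulo
    the multiples of d + the sum of the weights. A cochain f becomes an
    operation [ev f] on lists of weighted arguments, additive in each argument
    and skew symmetric modulo such multiples. Conversely an operation F is
    evaluated at generic arguments, the i-th having weight lambda_i, and the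
    last parameter is eliminated, which sends d + the sum of the weights to
    zero; this defines a cochain [reify F]. Both constructions are inverse to
    each other ([reify_ev], [ev_reify]). Insertion of operations is then a
    signed sum over the splittings of a list in two sublists ([star]), for which
    coassociativity and cocommutativity are proved by induction on the list; the
    pre-Lie identity and the graded Jacobi identity follow ([pre_lie],
    [nrb_jacobi]). The sums over unshuffles in the definitions are such sums
    over splittings ([sum_unshuffle]).

    In degree one, the Maurer-Cartan equation is evaluated at two arguments:
    the skew symmetry of the bracket of a makes the quadratic terms appear
    twice, which 1/2 compensates ([mc_hom]). The equation says that the
    component in a of the bracket of two elements of the graph of B is the
    image by B of its component in b ([deformation_graph]). *)

(** * Polynomials with coefficients in a module *)

Section LPolyTheory.
Context {R : comNzRingType}.
Implicit Types (V W : lmodType R) (n : nat).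

Lemma lcoefD V n (g h : lpoly V n) m : (g + h) m = g m + h m.
Proof. by []. Qed.

Lemma lcoefZ V n p (g : lpoly V n) k : (p *: g) k =
  \sum_(m : 'X_{1..n < (mdeg k).+1} | (m <= k)%MM) p@_m *: g (k - m)%MM.
Proof. by []. Qed.

Lemma lcoef_sum V n I (r : seq I) (P : pred I) (F : I -> lpoly V n) m :
  (\sum_(i <- r | P i) F i) m = \sum_(i <- r | P i) F i m.
Proof.
exact: (big_morph (fun g : lpoly V n => g m) (fun _ _ => erefl) erefl).
Qed.

Lemma lcoefN V n (g : lpoly V n) m : (- g) m = - g m.
Proof. by []. Qed.

Lemma lcoefC V n p (g : lpoly V n) m : (p%:MP *: g) m = p *: g m.
Proof.
rewrite -[p%:MP]mulr1 -mpolyX0 mul_mpolyC lscaleX.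
have -> : (0 <= m)%MM by apply/mnm_lepP => i; rewrite mnm0E.
by rewrite subm0.
Qed.

Definition lmono V n (m : 'X_{1..n}) (v : V) : lpoly V n := 'X_[m] *: lconst n v.

Lemma lmonoE V n (m k : 'X_{1..n}) (v : V) :
  lmono m v k = if k == m then v else 0.
Proof.
rewrite /lmono -[X in X *: _]scale1r [_ k]lscaleX.
case: ifPn => [lemk|Nlemk] /=; last first.
  by case: eqP Nlemk => // ->; case/negP; apply/mnm_lepP.
rewrite scale1r; congr (if _ then _ else _); apply/eqP/eqP => [e|->].
  by rewrite -[LHS](submK lemk) e add0m.
by apply/mnmP => i; rewrite mnmBE subnn mnm0E.
Qed.

(** The bound in the definition of lsum is obtained by choice; any other
    bound on the degree gives the same sum. *)
Lemma lsumE V n (W : zmodType) (F : 'X_{1..n} -> V -> W) (g : lpoly V n) d :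
  (forall m, F m 0 = 0) -> (forall m, (d <= mdeg m)%N -> g m = 0) ->
  lsum F g = \sum_(m : 'X_{1..n < d}) F m (g m).
Proof.
move=> F0 gd; rewrite /lsum; set b := lpoly_bound g.
have gb m : (b <= mdeg m)%N -> g m = 0.
  by rewrite /b /lpoly_bound; case: cid => /= e; apply.
pose s k := [seq bmnm m | m : 'X_{1..n < k}].
have us k : uniq (s k) by rewrite map_inj_uniq ?enum_uniq //; exact: val_inj.
have ins k m : (m \in s k) = (mdeg m < k)%N.
  apply/mapP/idP => [[x _ ->]|lt_mk]; first exact: bmdeg.
  by exists (BMultinom lt_mk); rewrite ?mem_enum.
have sumE k : \sum_(m : 'X_{1..n < k} | g m != 0) F m (g m) =
    \sum_(m <- [seq m <- s k | g m != 0]) F m (g m).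
  by rewrite big_filter big_map big_enum_cond.
have -> : \sum_(m : 'X_{1..n < d}) F m (g m) =
    \sum_(m : 'X_{1..n < d} | g m != 0) F m (g m).
  by rewrite [RHS]big_mkcond; apply: eq_bigr => m _; case: eqP => //= ->.
rewrite !sumE; apply/perm_big/uniq_perm; rewrite ?filter_uniq // => m.
rewrite !mem_filter !ins; case: eqP => //= /eqP gm0; rewrite !ltnNge.
by congr negb; apply/idP/idP => [/gb|/gd] /eqP; rewrite (negPf gm0).
Qed.

Lemma lcoef_fin2 V W n (g : lpoly V n) (h : lpoly W n) : exists d,
  (forall m, (d <= mdeg m)%N -> g m = 0) /\ (forall m, (d <= mdeg m)%N -> h m = 0).
Proof.
case: (lcoef_fin g) (lcoef_fin h) => d gd [e he]; exists (maxn d e).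
by split=> m; rewrite geq_max => /andP[]; [move/gd | move=> _ /he].
Qed.

Lemma lsumD V n (W : zmodType) (F : 'X_{1..n} -> V -> W) (g h : lpoly V n) :
  (forall m, {morph F m : x y / x + y}) -> lsum F (g + h) = lsum F g + lsum F h.
Proof.
move=> FD; have F0 m : F m 0 = 0.
  by apply: (addrI (F m 0)); rewrite -FD !addr0.
have [d [gd hd]] := lcoef_fin2 g h.
rewrite !(@lsumE _ _ _ _ _ d) // => [|m le_d]; last by rewrite lcoefD gd ?hd ?addr0.
by rewrite -big_split; apply: eq_bigr => m _; rewrite lcoefD FD.
Qed.

Lemma lsum_mono V n (W : zmodType) (F : 'X_{1..n} -> V -> W) m v :
  (forall m, F m 0 = 0) -> lsum F (lmono m v) = F m v.
Proof.
move=> F0; rewrite (@lsumE _ _ _ _ _ (mdeg m).+1) // => [|k]; last first.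
  by rewrite lmonoE; case: eqP => // ->; rewrite ltnn.
rewrite (bigD1 (BMultinom (ltnSn _))) // lmonoE eqxx big1; first exact: addr0.
move=> k /andP[_ /eqP kNm]; rewrite lmonoE; case: eqP => // e; case: kNm.
by apply: val_inj.
Qed.

Lemma lpoly_sum V n (g : lpoly V n) : exists d,
  g = \sum_(m : 'X_{1..n < d}) lmono m (g m).
Proof.
case: (lcoef_fin g) => d gd; exists d; apply: lpolyP => k; rewrite lcoef_sum.
have [le_dk|lt_kd] := leqP d (mdeg k).
  rewrite gd // big1 // => m _; rewrite lmonoE; case: eqP => // e.
  by have := bmdeg m; rewrite -e ltnNge le_dk.
rewrite (bigD1 (BMultinom lt_kd)) // lmonoE eqxx big1; first exact/esym/addr0.
move=> m /andP[_ /eqP mNk]; rewrite lmonoE; case: eqP => // e; case: mNk.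
by apply: val_inj.
Qed.

Lemma lpoly_ind V n (P : lpoly V n -> Prop) :
  (forall g h, P g -> P h -> P (g + h)) -> (forall m v, P (lmono m v)) ->
  forall g, P g.
Proof.
move=> PD Pm g; have P0 : P 0.
  by have := Pm 0%MM 0; congr P; apply: lpolyP => k; rewrite lmonoE if_same.
by have [d ->] := lpoly_sum g; apply: big_ind.
Qed.

(** Additive maps are compared on monomials. *)
Lemma lpoly_eq V n (W : zmodType) (f g : lpoly V n -> W) :
  {morph f : x y / x + y} -> {morph g : x y / x + y} ->
  (forall m v, f (lmono m v) = g (lmono m v)) -> f =1 g.
Proof.
by move=> fD gD fg x; elim/lpoly_ind: x => [x y ex ey|//]; rewrite fD gD ex ey.
Qed.

Lemma lconstD V n : {morph @lconst _ V n : x y / x + y}.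
Proof. by move=> x y; apply: lpolyP => k /=; case: eqP => //; rewrite addr0. Qed.

Lemma lconstZ V n p (x : V) : lconst n (p *: x) = p%:MP *: lconst n x.
Proof.
apply: lpolyP => k; rewrite -[p%:MP]mulr1 -mpolyX0 mul_mpolyC [RHS]lscaleX /=.
have -> : (0 <= k)%MM by apply/mnm_lepP => i; rewrite mnm0E.
by rewrite subm0; case: eqP; rewrite ?scaler0.
Qed.

Lemma lmonoZ V n (m : 'X_{1..n}) p (x : V) : lmono m (p *: x) = p%:MP *: lmono m x.
Proof. by rewrite /lmono lconstZ !scalerA mulrC. Qed.

Lemma lmonoX V n (m k : 'X_{1..n}) (x : V) : 'X_[k] *: lmono m x = lmono (k + m) x.
Proof. by rewrite /lmono scalerA -mpolyXD. Qed.

End LPolyTheory.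

(** * Extension, substitution and elimination of a parameter *)

Section LambdaTheory.
Context {K : fieldType}.
Implicit Types (U V W : lmodType {poly K}) (n : nat).

Notation A n := {mpoly {poly K}[n]}.

(** Weights of arguments are polynomials over K: d does not occur in them,
    and extensions of K-linear maps commute with their action. *)
Definition emb n : {mpoly K[n]} -> A n := map_mpoly polyC.
Arguments emb {n}.
HB.instance Definition _ n := GRing.RMorphism.on (@emb n).

Lemma embX n (i : 'I_n) : emb 'X_i = lam i.
Proof. exact: map_mpolyX. Qed.

Lemma embXm n (m : 'X_{1..n}) : emb 'X_[m] = 'X_[m].
Proof. exact: map_mpolyX. Qed.

Lemma embZ n (c : K) (m : 'X_{1..n}) : emb (c *: 'X_[m]) = c%:P%:MP * 'X_[m].
Proof. by rewrite -mul_mpolyC rmorphM /= embXm /emb map_mpolyC. Qed.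

Definition msub m n (c : 'I_m -> A n) : A m -> A n := mmap (@mpolyC n _) c.
HB.instance Definition _ m n c := GRing.RMorphism.on (@msub m n c).

Lemma msubX m n (c : 'I_m -> A n) (k : 'X_{1..m}) : msub c 'X_[k] = mmap1 c k.
Proof. exact: mmapX. Qed.

Lemma msub_lam m n (c : 'I_m -> A n) i : msub c (lam i) = c i.
Proof. by rewrite msubX mmap1U. Qed.

Lemma msubC m n (c : 'I_m -> A n) p : msub c p%:MP = p%:MP.
Proof. exact: mmapC. Qed.

Definition wsub m n (c : 'I_m -> {mpoly K[n]}) : {mpoly K[m]} -> {mpoly K[n]} :=
  mmap (@mpolyC n _) c.
HB.instance Definition _ m n c := GRing.RMorphism.on (@wsub m n c).

Lemma wsubX m n (c : 'I_m -> {mpoly K[n]}) i : wsub c 'X_i = c i.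
Proof. by rewrite /wsub mmapX mmap1U. Qed.

Lemma emb_wsub m n (c : 'I_m -> {mpoly K[n]}) s :
  emb (wsub c s) = msub (emb \o c) (emb s).
Proof.
elim/mpolyind: s => [|a k s _ _ IHs]; first by rewrite !rmorph0.
rewrite !rmorphD /= {}IHs; congr (_ + _).
rewrite embZ rmorphM /= msubC msubX -mul_mpolyC !rmorphM /=.
rewrite /wsub mmapC mmapX /emb map_mpolyC rmorph_prod /=; congr (_ * _).
by apply: eq_bigr => i _; rewrite rmorphXn.
Qed.

(** The operations are linear over K only; d does not commute with them. *)
Definition klin V W n (f : V -> lpoly W n) : Prop := forall (c : K) x y,
  f (c%:P *: x + y) = c%:P%:MP *: f x + f y.

Lemma klinD V W n (f : V -> lpoly W n) : klin f -> {morph f : x y / x + y}.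
Proof.
by move=> fl x y; rewrite -[x in LHS]scale1r -[1]polyC1 fl polyC1 mpolyC1 scale1r.
Qed.

Lemma morphD0 (V W : zmodType) (f : V -> W) : {morph f : x y / x + y} -> f 0 = 0.
Proof. by move=> fD; apply: (addrI (f 0)); rewrite -fD !addr0. Qed.

Lemma klin0 V W n (f : V -> lpoly W n) : klin f -> f 0 = 0.
Proof. by move/klinD/morphD0. Qed.

Lemma klinZ V W n (f : V -> lpoly W n) : klin f ->
  forall c x, f (c%:P *: x) = c%:P%:MP *: f x.
Proof. by move=> fl c x; have := fl c x 0; rewrite !addr0 klin0 // addr0. Qed.

Lemma klin_const V n : klin (@lconst _ V n).
Proof. by move=> c x y; rewrite lconstD lconstZ. Qed.

Lemma eq_lext V W n (f g : V -> lpoly W n) x : f =1 g -> lext f x = lext g x.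
Proof. by move=> fg; apply: eq_bigr => m _; rewrite fg. Qed.

Lemma lext_linf V W n (f g : V -> lpoly W n) p x :
  lext (fun v => p *: f v + g v) x = p *: lext f x + lext g x.
Proof.
rewrite /lext /lsum scaler_sumr -big_split; apply: eq_bigr => m _ /=.
by rewrite scalerDr !scalerA mulrC.
Qed.

Lemma lext_scalef V W n (f : V -> lpoly W n) p x :
  lext (fun v => p *: f v) x = p *: lext f x.
Proof.
rewrite /lext /lsum scaler_sumr; apply: eq_bigr => m _ /=.
by rewrite !scalerA mulrC.
Qed.

Lemma lext0f V W n (x : lpoly V n) : lext (fun=> 0 : lpoly W n) x = 0.
Proof. by rewrite /lext /lsum big1 // => m _; rewrite scaler0. Qed.

Lemma lextf0 V W n (f : V -> lpoly W n) : lext f 0 = 0.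
Proof. by rewrite /lext /lsum big1 // => m /eqP[]. Qed.

Lemma lextD V W n (f : V -> lpoly W n) : {morph f : x y / x + y} ->
  {morph lext f : x y / x + y}.
Proof. by move=> fD x y; apply: lsumD => m u v; rewrite fD scalerDr. Qed.

Lemma lext_mono V W n (f : V -> lpoly W n) m v : f 0 = 0 ->
  lext f (lmono m v) = 'X_[m] *: f v.
Proof. by move=> f0; rewrite /lext lsum_mono // => k; rewrite f0 scaler0. Qed.

Lemma lmono0 V n (v : V) : lmono 0 v = lconst n v.
Proof. by rewrite /lmono mpolyX0 scale1r. Qed.

Lemma lext_const V W n (f : V -> lpoly W n) v : f 0 = 0 ->
  lext f (lconst n v) = f v.
Proof. by move=> f0; rewrite -lmono0 lext_mono // mpolyX0 scale1r. Qed.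

Lemma lext_hom V W n (f : V -> lpoly W n) c x : klin f ->
  lext f (emb c *: x) = emb c *: lext f x.
Proof.
move=> fl; have fD := lextD (klinD fl); have f0 := klin0 fl.
elim/mpolyind: c => [|a k c _ _ IHc]; first by rewrite rmorph0 !scale0r lextf0.
rewrite rmorphD /= !scalerDl fD {}IHc; congr (_ + _).
move: x; apply: lpoly_eq => [x y|x y|m v]; rewrite ?scalerDr ?fD ?scalerDr //.
rewrite embZ -[in LHS]scalerA lmonoX -lmonoZ !lext_mono // klinZ //.
by rewrite !scalerA mpolyXD mulrC mulrA.
Qed.

Lemma klin_lext V W U n (f : V -> W -> lpoly U n) y :
  (forall w, klin (f^~ w)) -> klin (fun v => lext (f v) y).
Proof.
by move=> fl c u v; rewrite -lext_linf; apply: eq_lext => w; rewrite fl.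
Qed.

Lemma lext_exch V W U n (f : V -> W -> lpoly U n) x y :
  lext (fun v => lext (f v) y) x = lext (fun w => lext (f^~ w) x) y.
Proof.
rewrite /lext /lsum; under eq_bigr do rewrite scaler_sumr.
rewrite exchange_big; apply: eq_bigr => k _ /=; rewrite scaler_sumr.
by apply: eq_bigr => m _; rewrite !scalerA mulrC.
Qed.

Lemma lsubstD V m n (c : 'I_m -> A n) : {morph @lsubst _ V m n c : x y / x + y}.
Proof. by move=> x y; apply: lsumD => k u v; rewrite lconstD scalerDr. Qed.

Lemma lsubst0 V m n (c : 'I_m -> A n) : lsubst c (0 : lpoly V m) = 0.
Proof. exact/morphD0/lsubstD. Qed.

Lemma lsubst_mono V m n (c : 'I_m -> A n) k (v : V) :
  lsubst c (lmono k v) = mmap1 c k *: lconst n v.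
Proof.
by rewrite /lsubst lsum_mono // => l; rewrite (morphD0 (@lconstD _ _ _)) scaler0.
Qed.

Lemma lsubst_const V m n (c : 'I_m -> A n) (v : V) :
  lsubst c (lconst m v) = lconst n v.
Proof. by rewrite -lmono0 lsubst_mono mmap11 scale1r. Qed.

Lemma lsubstZ V m n (c : 'I_m -> A n) p (x : lpoly V m) :
  lsubst c (p *: x) = msub c p *: lsubst c x.
Proof.
elim/mpolyind: p => [|a k p _ _ IHp]; first by rewrite rmorph0 !scale0r lsubst0.
rewrite rmorphD /= !scalerDl lsubstD {}IHp; congr (_ + _).
rewrite -mul_mpolyC rmorphM /= msubC msubX.
move: x; apply: lpoly_eq => [x y|x y|m' v]; rewrite ?scalerDr ?lsubstD ?scalerDr //.
rewrite -[in LHS]scalerA lmonoX -lmonoZ !lsubst_mono lconstZ !scalerA.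
rewrite (_ : mmap1 c (k + m') = mmap1 c k * mmap1 c m'); last first.
  by apply: commr_mmap1_M => i x; apply: mulrC.
by rewrite mulrC mulrA.
Qed.

Lemma klin_lsubst V W m n (c : 'I_m -> A n) (f : V -> lpoly W m) :
  klin f -> klin (fun v => lsubst c (f v)).
Proof. by move=> fl a x y; rewrite fl lsubstD lsubstZ msubC. Qed.

Lemma lsubst_comp V m n p (c : 'I_m -> A n) (c' : 'I_n -> A p) (x : lpoly V m) :
  lsubst c' (lsubst c x) = lsubst (fun i => msub c' (c i)) x.
Proof.
move: x; apply: lpoly_eq => [x y|x y|k v]; rewrite ?lsubstD ?lsubst_mono //.
rewrite lsubstZ lsubst_const; congr (_ *: _).
by rewrite /mmap1 rmorph_prod; apply: eq_bigr => i _; rewrite rmorphXn.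
Qed.

Lemma eq_lsubst V m n (c c' : 'I_m -> A n) (x : lpoly V m) :
  c =1 c' -> lsubst c x = lsubst c' x.
Proof.
move=> cc'; rewrite /lsubst /lsum; apply: eq_bigr => k _; congr (_ *: _).
by apply: eq_bigr => i _; rewrite cc'.
Qed.

Lemma lsubst_lam V n (x : lpoly V n) : lsubst (@lam K n) x = x.
Proof.
move: x; apply: lpoly_eq => [x y|x y|k v]; rewrite ?lsubstD //.
by rewrite lsubst_mono mmap1_id.
Qed.

(** Congruence modulo e is compatible with the products and powers that make
    up a substitution. *)
Lemma lsubst_cong V m n (c c' : 'I_m -> A n) e (x : lpoly V m) :
  (forall i, exists q, c i = c' i + e * q) ->
  exists z, lsubst c x = lsubst c' x + e *: z.
Proof.
move=> cc'; move: x; apply: lpoly_ind => [x y [z ez] [t et]|k v].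
  exists (z + t); rewrite !lsubstD ez et scalerDr !addrA; congr (_ + _).
  by rewrite -!addrA; congr (_ + _); exact: addrC.
suff [q eq] : exists q, mmap1 c k = mmap1 c' k + e * q.
  by exists (q *: lconst n v); rewrite !lsubst_mono eq scalerDl scalerA.
rewrite /mmap1; apply: (big_rec2 (fun x y => exists q, x = y + e * q)).
  by exists 0; rewrite mulr0 addr0.
move=> i x y _ [q ->]; have [r ->] : exists r, c i ^+ k i = c' i ^+ k i + e * r.
  elim: (k i) => [|j [r er]]; first by exists 0; rewrite mulr0 addr0.
  have [r' er'] := cc' i.
  exists (c' i * r + r' * c' i ^+ j + r' * (e * r)); rewrite !exprS er er'.
  by rewrite !mulrDl !mulrDr !addrA !mulrA (mulrC e (c' i)).
exists (c' i ^+ k i * q + r * y + r * (e * q)).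
by rewrite !mulrDl !mulrDr !addrA !mulrA (mulrC e (c' i ^+ _)).
Qed.

Lemma lmapD V W n (f : V -> W) : {morph f : x y / x + y} ->
  {morph @lmap _ V W n f : x y / x + y}.
Proof. by move=> fD; apply: lextD => x y; rewrite fD lconstD. Qed.

Lemma lmap_mono V W n (f : V -> W) (m : 'X_{1..n}) v : f 0 = 0 ->
  lmap f (lmono m v) = lmono m (f v).
Proof.
move=> f0; rewrite /lmap lext_mono // f0; exact/morphD0/lconstD.
Qed.

Lemma lmap_const V W n (f : V -> W) v : f 0 = 0 ->
  lmap f (lconst n v) = lconst n (f v).
Proof. by move=> f0; rewrite -!lmono0 lmap_mono. Qed.

Lemma lmapE V W n (f : V -> W) (x : lpoly V n) m : {morph f : x y / x + y} ->
  lmap f x m = f (x m).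
Proof.
move=> fD; have f0 := morphD0 fD.
move: x; apply: lpoly_ind => [x y ex ey|k v]; first by rewrite lmapD // !lcoefD ex ey fD.
by rewrite lmap_mono // !lmonoE; case: eqP.
Qed.

Lemma lmapZ V W n (f : {linear V -> W}) p (x : lpoly V n) :
  lmap f (p *: x) = p *: lmap f x.
Proof.
apply: lpolyP => m; rewrite lmapE; last exact: raddfD.
rewrite !lcoefZ linear_sum; apply: eq_bigr => k _.
by rewrite linearZ lmapE //; exact: raddfD.
Qed.

Lemma lmapN V W n (f : {linear V -> W}) (g : lpoly V n) :
  lmap f (- g) = - lmap f g.
Proof. by rewrite -scaleN1r lmapZ scaleN1r. Qed.

Lemma lmap_id V n (x : lpoly V n) : lmap id x = x.
Proof. by apply: lpolyP => m; rewrite lmapE. Qed.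

Lemma lmap_comp V W U n (f : {linear V -> W}) (g : {linear W -> U}) (x : lpoly V n) :
  lmap g (lmap f x) = lmap (g \o f) x.
Proof.
by apply: lpolyP => m; rewrite !lmapE //; try exact: raddfD; move=> u v /=; rewrite !raddfD.
Qed.

Lemma lmap_lsubst V W m n (f : {linear V -> W}) (c : 'I_m -> A n) (x : lpoly V m) :
  lmap f (lsubst c x) = lsubst c (lmap f x).
Proof.
have f0 : f 0 = 0 by rewrite raddf0.
have fD : {morph f : x y / x + y} by exact: raddfD.
move: x; apply: lpoly_eq => [x y|x y|k v]; rewrite ?lsubstD ?lmapD // ?lsubstD //.
by rewrite lmap_mono // !lsubst_mono lmapZ lmap_const.
Qed.

Lemma lswap_lmap V W (f : {linear V -> W}) (g : lpoly V 1) :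
  lswap (lmap f g) = lmap f (lswap g).
Proof. exact/esym/lmap_lsubst. Qed.

Lemma lmap_lext V W U n (f : {linear W -> U}) (g : V -> lpoly W n) (x : lpoly V n) :
  lmap f (lext g x) = lext (fun v => lmap f (g v)) x.
Proof.
rewrite /lext /lsum (big_morph _ (lmapD (raddfD f)) (lextf0 _)).
by apply: eq_bigr => m _; rewrite lmapZ.
Qed.

Lemma lext_lmap V W U n (f : V -> W) (g : W -> lpoly U n) (x : lpoly V n) :
  {morph f : x y / x + y} -> {morph g : x y / x + y} ->
  lext g (lmap f x) = lext (g \o f) x.
Proof.
move=> fD gD; have [f0 g0] := (morphD0 fD, morphD0 gD).
have gfD : {morph g \o f : x y / x + y} by move=> a b /=; rewrite fD gD.
move: x; apply: lpoly_eq => [x y|x y|k v]; rewrite ?lmapD ?lextD //.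
by rewrite lmap_mono // !lext_mono //= f0.
Qed.

Lemma lsubst_lext V W m n (c : 'I_m -> {mpoly K[n]}) (f : V -> lpoly W m) x :
  klin f ->
  lsubst (emb \o c) (lext f x) = lext (fun v => lsubst (emb \o c) (f v))
                                       (lsubst (emb \o c) x).
Proof.
move=> fl; have fl' := klin_lsubst (emb \o c) fl.
have [f0 f0'] := (klin0 fl, klin0 fl'); have [fD fD'] := (klinD fl, klinD fl').
move: x; apply: lpoly_eq => [x y|x y|k v]; rewrite ?lsubstD ?lextD ?lsubstD ?lextD //.
rewrite lext_mono // lsubstZ msubX lsubst_mono.
have -> : mmap1 (emb \o c) k = emb (mmap1 c k).
  by rewrite /mmap1 rmorph_prod; apply: eq_bigr => i _; rewrite rmorphXn.
by rewrite lext_hom // lext_const.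
Qed.

(** Modulo (d + s), with s the total weight of the arguments, the choice of
    the argument whose parameter is eliminated does not matter. *)
Definition Z V n (s : {mpoly K[n]}) (x : lpoly V n) : Prop :=
  exists z, x = (partial n + emb s) *: z.

Lemma Z0 V n s : Z s (0 : lpoly V n).
Proof. by exists 0; rewrite scaler0. Qed.

Lemma ZD V n s (x y : lpoly V n) : Z s x -> Z s y -> Z s (x + y).
Proof. by case=> z -> [t ->]; exists (z + t); rewrite scalerDr. Qed.

Lemma ZZ V n s p (x : lpoly V n) : Z s x -> Z s (p *: x).
Proof. by case=> z ->; exists (p *: z); rewrite !scalerA mulrC. Qed.

Lemma ZN V n s (x : lpoly V n) : Z s x -> Z s (- x).
Proof. by rewrite -scaleN1r; exact: ZZ. Qed.

Lemma ZB V n s (x y : lpoly V n) : Z s x -> Z s y -> Z s (x - y).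
Proof. by move=> sx sy; apply: ZD => //; apply: ZN. Qed.

Lemma Zw V n s s' (x : lpoly V n) : s = s' -> Z s x -> Z s' x.
Proof. by move=> ->. Qed.

Lemma Z_trans V n s (x y z : lpoly V n) :
  Z s (x - y) -> Z s (y - z) -> Z s (x - z).
Proof. by move=> h1 h2; have := ZD h1 h2; rewrite addrA subrK. Qed.

Lemma Z_eq V n s (x y : lpoly V n) : Z s x -> x = y -> Z s y.
Proof. by move=> h <-. Qed.

Lemma ZZB V n s k (x y : lpoly V n) :
  Z s (x - y) -> Z s ((-1) ^+ k *: x - (-1) ^+ k *: y).
Proof. by rewrite -scalerBr; exact: ZZ. Qed.

Lemma ZZBc V n s c (x y : lpoly V n) :
  Z s (x - y) -> Z s (c%:P%:MP *: x - c%:P%:MP *: y).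
Proof. by rewrite -scalerBr; exact: ZZ. Qed.

Lemma Z_sum V n s I (r : seq I) (P : pred I) (F : I -> lpoly V n) :
  (forall i, P i -> Z s (F i)) -> Z s (\sum_(i <- r | P i) F i).
Proof. by move=> FZ; apply: big_ind => //; [exact: Z0 | move=> ? ?; exact: ZD]. Qed.

Lemma Z_lext V W n s (f : V -> lpoly W n) x : (forall v, Z s (f v)) -> Z s (lext f x).
Proof. by move=> fZ; apply: Z_sum => m _; apply: ZZ. Qed.

Lemma Z_lmap V W n s (f : {linear V -> W}) (x : lpoly V n) : Z s x -> Z s (lmap f x).
Proof. by case=> z ->; exists (lmap f z); rewrite lmapZ. Qed.

Lemma msub_partial m n (c : 'I_m -> A n) : msub c (partial m) = partial n.
Proof. exact: msubC. Qed.

Lemma lamdag_lt n (i : 'I_n) (j : 'I_n.-1) : i = j :> nat -> lamdag i = lam j :> A n.-1.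
Proof. by move=> e; rewrite /lamdag e valK. Qed.

Lemma lamdag_max n (i : 'I_n) : i = n.-1 :> nat ->
  lamdag i = - \sum_j lam j - partial n.-1 :> A n.-1.
Proof. by move=> e; rewrite /lamdag insubF // e ltnn. Qed.

(** The last parameter is chosen so that all of them add up to - d. *)
Lemma sum_lamdag n : (0 < n)%N -> \sum_(i < n) lamdag i = - partial n.-1 :> A n.-1.
Proof.
case: n => // n _; rewrite big_ord_recr /= (@lamdag_max n.+1) //=.
under eq_bigr => i _ do rewrite (@lamdag_lt n.+1 _ i) //.
by rewrite addrA subrr add0r.
Qed.

Lemma ldagD V n : {morph @ldag K V n : g h / g + h}.
Proof. exact: lsubstD. Qed.

Lemma ldagN V n (g : lpoly V n) : ldag (- g) = - ldag g.
Proof. by rewrite -scaleN1r /ldag lsubstZ rmorphN1 scaleN1r. Qed.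

Lemma ldag_lmap V W n (f : {linear V -> W}) (g : lpoly V n) :
  ldag (lmap f g) = lmap f (ldag g).
Proof. exact/esym/lmap_lsubst. Qed.

Lemma ldag_Z V n (x : lpoly V n) : (0 < n)%N -> Z (\sum_i 'X_i) x -> ldag x = 0.
Proof.
move=> n0 [z ->]; rewrite /ldag lsubstZ rmorphD /= msub_partial.
have -> : emb (\sum_i 'X_i) = \sum_i lam i :> A n.
  by rewrite rmorph_sum; apply: eq_bigr => i _; exact: embX.
have -> : msub (@lamdag K n) (\sum_i lam i) = \sum_i lamdag i.
  by rewrite rmorph_sum; apply: eq_bigr => i _; exact: msub_lam.
by rewrite sum_lamdag // subrr scale0r.
Qed.

End LambdaTheory.

Arguments emb {K n}.

(** * Operations on weighted arguments *)

Section Multilinear.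
Context {K : fieldType}.
Implicit Types (L M N : lmodType {poly K}) (n k : nat).
Notation A n := {mpoly {poly K}[n]}.

(** The extension of a multilinear map to arguments with polynomial
    coefficients. *)
Fixpoint mext M N n (F : seq M -> lpoly N n) (ys : seq (lpoly M n)) : lpoly N n :=
  if ys is y :: ys' then lext (fun x => mext (fun xs => F (x :: xs)) ys') y
  else F [::].

Definition mlin M N n k (F : seq M -> lpoly N n) : Prop :=
  forall u v, (size u + size v).+1 = k -> klin (fun x => F (u ++ x :: v)).

Lemma mlin_cons M N n k (F : seq M -> lpoly N n) x :
  mlin k.+1 F -> mlin k (fun xs => F (x :: xs)).
Proof. by move=> Fl u v uv; apply: (Fl (x :: u) v); rewrite /= addSn uv. Qed.

Lemma mext_eq M N n (F G : seq M -> lpoly N n) ys :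
  (forall xs, size xs = size ys -> F xs = G xs) -> mext F ys = mext G ys.
Proof.
elim: ys F G => [|y ys IHys] F G FG /=; first exact: FG.
by apply: eq_lext => x; apply: IHys => xs sxs; apply: FG; rewrite /= sxs.
Qed.

Lemma mext_lin M N n (F G : seq M -> lpoly N n) p ys :
  mext (fun xs => p *: F xs + G xs) ys = p *: mext F ys + mext G ys.
Proof.
elim: ys F G => [|y ys IHys] F G //=.
by rewrite -lext_linf; apply: eq_lext => x; rewrite IHys.
Qed.

Lemma mext_scale M N n (F : seq M -> lpoly N n) p ys :
  mext (fun xs => p *: F xs) ys = p *: mext F ys.
Proof.
elim: ys F => [|y ys IHys] F //=.
by rewrite -lext_scalef; apply: eq_lext => x; rewrite IHys.
Qed.

Lemma mext_Z M N n s (F : seq M -> lpoly N n) ys :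
  (forall xs, size xs = size ys -> Z s (F xs)) -> Z s (mext F ys).
Proof.
elim: ys F => [|y ys IHys] F FZ /=; first exact: FZ.
by apply: Z_lext => x; apply: IHys => xs sxs; apply: FZ; rewrite /= sxs.
Qed.

Lemma klin_mext M N n (F : seq M -> lpoly N n) ys :
  mlin (size ys).+1 F -> klin (fun x => mext (fun xs => F (x :: xs)) ys).
Proof.
move=> Fl c x y; rewrite -mext_lin; apply: mext_eq => xs sxs.
by apply: (Fl [::] xs); rewrite /= sxs.
Qed.

Lemma mext_slot M N n k (F : seq M -> lpoly N n) u v c x y :
  mlin k F -> (size u + size v).+1 = k ->
  mext F (u ++ (emb c *: x + y) :: v) =
  emb c *: mext F (u ++ x :: v) + mext F (u ++ y :: v).
Proof.
move=> Fl uv; move: Fl; rewrite -{}uv; elim: u F => [|z u IHu] F Fl /=.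
  have Fl' := klin_mext Fl.
  by rewrite lextD ?lext_hom //; exact: klinD.
by rewrite -lext_linf; apply: eq_lext => t; apply: IHu; apply: mlin_cons.
Qed.

Lemma mext_swap M N n (F G : seq M -> lpoly N n) u x y v :
  (forall u' a b v', size u' = size u -> size v' = size v ->
     G (u' ++ b :: a :: v') = F (u' ++ a :: b :: v')) ->
  mext G (u ++ y :: x :: v) = mext F (u ++ x :: y :: v).
Proof.
elim: u F G => [|z u IHu] F G FG /=.
  rewrite lext_exch; apply: eq_lext => a; apply: eq_lext => b.
  by apply: mext_eq => xs sxs; apply: (FG [::]).
apply: eq_lext => t; apply: IHu => u' a b v' su sv.
by apply: (FG (t :: u')) => //=; rewrite su.
Qed.

Lemma mext_sesq M N n k (F : seq M -> lpoly N n) p u x v :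
  mlin k F -> (size u + size v).+1 = k ->
  (forall u' a v', size u' = size u -> size v' = size v ->
     F (u' ++ ('X *: a) :: v') = p *: F (u' ++ a :: v')) ->
  mext F (u ++ (partial n *: x) :: v) = p *: mext F (u ++ x :: v).
Proof.
move=> Fl uv; move: Fl; rewrite -{}uv; elim: u F => [|z u IHu] F Fl FX /=.
  set f := fun a : M => _.
  have fl : klin f by apply: klin_mext.
  have fX a : f ('X *: a) = p *: f a.
    rewrite -mext_scale; apply: mext_eq => xs sxs.
    exact: (FX [::] a xs).
  have fD := klinD fl; have f0 := klin0 fl.
  move: x; apply: lpoly_eq => [x y|x y|m a]; rewrite ?scalerDr ?lextD ?scalerDr //.
  by rewrite -lmonoZ !lext_mono // fX !scalerA mulrC.
rewrite -lext_scalef; apply: eq_lext => t; apply: IHu => [|u' a v' su sv].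
  exact: mlin_cons.
by apply: (FX (t :: u')) => //=; rewrite su.
Qed.

Lemma lsubst_mext M N m n (c : 'I_m -> {mpoly K[n]}) (F : seq M -> lpoly N m) ys :
  mlin (size ys) F ->
  lsubst (emb \o c) (mext F ys) =
  mext (fun xs => lsubst (emb \o c) (F xs)) [seq lsubst (emb \o c) y | y <- ys].
Proof.
elim: ys F => [|y ys IHys] F Fl //=.
rewrite lsubst_lext; last exact: klin_mext.
by apply: eq_lext => x; rewrite IHys //; apply: mlin_cons.
Qed.

Lemma mext_const M N n (F : seq M -> lpoly N n) xs :
  mlin (size xs) F -> mext F [seq lconst n x | x <- xs] = F xs.
Proof.
elim: xs F => [|x xs IHxs] F Fl //=.
have Fl' : mlin (size [seq lconst n x | x <- xs]).+1 F by rewrite size_map.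
by rewrite lext_const ?(klin0 (klin_mext Fl')) // IHxs //; exact: mlin_cons.
Qed.

Lemma lmap_mext L M N n (f : {linear M -> N}) (F : seq L -> lpoly M n) ys :
  lmap f (mext F ys) = mext (fun xs => lmap f (F xs)) ys.
Proof.
elim: ys F => [|y ys IHys] F //=.
by rewrite lmap_lext; apply: eq_lext => x; rewrite IHys.
Qed.

Lemma mext_lmap L M N n (f : {linear L -> M}) (F : seq M -> lpoly N n) ys :
  mlin (size ys) F ->
  mext F [seq lmap f y | y <- ys] = mext (fun xs => F [seq f x | x <- xs]) ys.
Proof.
elim: ys F => [|y ys IHys] F Fl //=.
have Fl' : mlin (size [seq lmap f y | y <- ys]).+1 F by rewrite size_map.
rewrite lext_lmap; [|exact: raddfD|exact: klinD (klin_mext Fl')].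
by apply: eq_lext => x /=; rewrite IHys //; exact: mlin_cons.
Qed.

(** The weight of an argument and its value are arbitrary polynomials, so
    that the value of an operation, with the sum of the weights, is again an
    argument. *)
Definition wel M n : Type := ({mpoly K[n]} * lpoly M n)%type.
Definition wt M n (w : seq (wel M n)) : {mpoly K[n]} := \sum_(t <- w) t.1.
Definition wts M n (w : seq (wel M n)) : seq (A n) := [seq emb t.1 | t <- w].

Lemma wt_cons M n (t : wel M n) w : wt (t :: w) = t.1 + wt w.
Proof. exact: big_cons. Qed.

Lemma wt_cat M n (u v : seq (wel M n)) : wt (u ++ v) = wt u + wt v.
Proof. exact: big_cat. Qed.

Lemma wt_mid M n (u v : seq (wel M n)) s x y :
  wt (u ++ (s, x) :: v) = wt (u ++ (s, y) :: v).
Proof. by rewrite !wt_cat !wt_cons. Qed.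

Lemma wt_swap M n (u v : seq (wel M n)) p q :
  wt (u ++ p :: q :: v) = wt (u ++ q :: p :: v).
Proof. by rewrite !wt_cat !wt_cons [p.1 + _]addrCA. Qed.

Lemma sum_wts M n (w : seq (wel M n)) : \sum_(t <- wts w) t = emb (wt w).
Proof. by rewrite big_map rmorph_sum. Qed.

Definition tsub M m n (c : 'I_m -> {mpoly K[n]}) (t : wel M m) : wel M n :=
  (wsub c t.1, lsubst (emb \o c) t.2).
Definition tmap M N n (f : M -> N) (t : wel M n) : wel N n := (t.1, lmap f t.2).

Lemma wt_tsub M m n (c : 'I_m -> {mpoly K[n]}) (w : seq (wel M m)) :
  wt (map (tsub c) w) = wsub c (wt w).
Proof. by rewrite /wt big_map rmorph_sum. Qed.

Lemma wt_tmap M N n (f : M -> N) (w : seq (wel M n)) : wt (map (tmap f) w) = wt w.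
Proof. by rewrite /wt big_map. Qed.

Definition ev M N k (f : cochain M N k) n (w : seq (wel M n)) : lpoly N n :=
  mext (capp f (wts w)) [seq t.2 | t <- w].

(** The number n of ambient variables is not fixed: an operation is
    determined by its values at generic arguments through substitutions. *)
Definition fam M N : Type := forall n, seq (wel M n) -> lpoly N n.

(** What remains of the axioms of a cochain with k arguments once all
    arguments have a weight: the last one is no longer special, but the
    conditions that involve its parameter hold only modulo (d + the total
    weight). *)
Record oper M N k (F : fam M N) : Prop := {
  g_lin : forall n (u v : seq (wel M n)) s c (x y : lpoly M n), (size u + size v).+1 = k ->
    F n (u ++ (s, emb c *: x + y) :: v) =
    emb c *: F n (u ++ (s, x) :: v) + F n (u ++ (s, y) :: v);
  g_ses : forall n (u v : seq (wel M n)) s (x : lpoly M n), (size u + size v).+1 = k ->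
    Z (wt (u ++ (s, x) :: v)) (F n (u ++ (s, (partial n + emb s) *: x) :: v));
  g_skew : forall n (u v : seq (wel M n)) p q, (size u + size v).+2 = k ->
    Z (wt (u ++ p :: q :: v)) (F n (u ++ p :: q :: v) + F n (u ++ q :: p :: v));
  g_nat : forall m n (c : 'I_m -> {mpoly K[n]}) (w : seq (wel M m)), size w = k ->
    lsubst (emb \o c) (F m w) = F n (map (tsub c) w)
}.

Lemma nth_mid M (x : M) (u v : seq M) x0 k (i : 'I_k) :
  size u = i -> (fun j : 'I_k => nth x0 (u ++ x :: v) j) =
  [eta (fun j : 'I_k => nth x0 (u ++ x0 :: v) j) with i |-> x].
Proof.
move=> su; apply/funext => j /=; rewrite !nth_cat su.
case: eqP => [->|/eqP jNi]; first by rewrite ltnn subnn.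
case: ltnP => // le_ij; have : (i < j)%N by rewrite ltn_neqAle eq_sym jNi.
by rewrite -subn_gt0; case: (j - i)%N.
Qed.

Lemma mlin_capp M N k (f : cochain M N k) n (s : seq (A n)) :
  is_cochain f -> mlin k (capp f s).
Proof.
move=> fc u v uv c x y; rewrite /capp.
have lt_uk : (size u < k)%N by rewrite -uv ltnS leq_addr.
have E z := @nth_mid M z u v 0 k (Ordinal lt_uk) erefl.
rewrite (E (c%:P *: x + y)) (E x) (E y) (cochain_lin fc).
by rewrite lsubstD lsubstZ msubC.
Qed.

(** The eliminated parameter is minus the sum of the others minus d, hence
    congruent to the missing weight. *)
Lemma msub_lamdag n k (s : 'I_k -> {mpoly K[n]}) (t : seq (A n)) (i : 'I_k) :
  (forall j : 'I_k, t`_j = emb (s j)) ->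
  exists q, msub (fun j : 'I_k.-1 => t`_j) (lamdag i) =
            emb (s i) + (partial n + emb (\sum_j s j)) * q.
Proof.
move=> ts; have [lt_i|le_i] := ltnP i k.-1.
  exists 0; rewrite mulr0 addr0 (@lamdag_lt _ _ _ (Ordinal lt_i)) //.
  by rewrite msub_lam /= ts.
have ei : i = k.-1 :> nat.
  by apply/eqP; rewrite eqn_leq le_i andbT -ltnS (ltn_predK (ltn_ord i)).
exists (-1); rewrite lamdag_max // rmorphB rmorphN /= msub_partial rmorph_sum /=.
under eq_bigr => j _ do rewrite msub_lam.
case: k s i ts {le_i} ei => [|k] s i ts ei; first by case: (i).
rewrite rmorph_sum big_ord_recr /= (_ : ord_max = i); last exact/val_inj.
have -> : \sum_(j < k) t`_j = \sum_(j < k) emb (s (widen_ord (leqnSn k) j)) :> A n.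
  by apply: eq_bigr => j _; rewrite -ts.
by ring.
Qed.

End Multilinear.

(** * From cochains to operations and back *)

Section Reification.
Context {K : fieldType}.
Implicit Types (L M N : lmodType {poly K}) (n k : nat).
Notation A n := {mpoly {poly K}[n]}.

Lemma nth_swap T (x0 a b : T) (u v : seq T) k (i i' j : 'I_k) :
  i = size u :> nat -> i' = (size u).+1 :> nat ->
  nth x0 (u ++ b :: a :: v) j = nth x0 (u ++ a :: b :: v) (tperm i i' j).
Proof.
move=> ei ei'; rewrite !nth_cat; case: tpermP => [->|->|/eqP jNi /eqP jNi'].
- by rewrite ei ei' ltnn ltnNge leqnSn /= subnn subSnn.
- by rewrite ei ei' ltnn ltnNge leqnSn /= subnn subSnn.
- case: ltnP => // le_j; have lt_j : (size u < j)%N.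
    by rewrite ltn_neqAle le_j andbT eq_sym -ei jNi.
  have lt_j' : ((size u).+1 < j)%N by rewrite ltn_neqAle lt_j andbT eq_sym -ei' jNi'.
  by rewrite -(subnSK lt_j) -(subnSK lt_j').
Qed.

(** The symmetry of a cochain rearranges the parameters, up to the eliminated
    one, which by [msub_lamdag] is congruent to the weight of the last
    argument. *)
Lemma capp_skew M N k (f : cochain M N k) n (s0 s1 : seq {mpoly K[n]}) p q u v a b :
  is_cochain f -> (size u + size v).+2 = k -> size s0 = size u -> size s1 = size v ->
  Z (\sum_(t <- s0 ++ p :: q :: s1) t)
    (capp f (map emb (s0 ++ p :: q :: s1)) (u ++ a :: b :: v) +
     capp f (map emb (s0 ++ q :: p :: s1)) (u ++ b :: a :: v)).
Proof.
move=> fc uv ss0 ss1; set w := s0 ++ p :: q :: s1; set w' := s0 ++ q :: p :: s1.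
have sw : size w = k by rewrite /w size_cat /= ss0 ss1 !addnS.
have lt_i' : ((size u).+1 < k)%N by rewrite -uv !ltnS leq_addr.
pose i' := Ordinal lt_i'; pose i := Ordinal (ltnW lt_i').
have iNi' : i != i' by rewrite -val_eqE /= neq_ltn ltnSn.
set t := map emb w; pose s (j : 'I_k) := w`_j.
have ts (j : 'I_k) : t`_j = emb (s j).
  by rewrite (nth_map 0) ?sw.
have es : \sum_(t <- w) t = \sum_j s j.
  by rewrite (big_nth 0) sw big_mkord.
rewrite /capp (cochain_skew fc (tperm i i')) odd_tperm iNi' expr1.
have -> : (fun j : 'I_k => (u ++ a :: b :: v)`_j) \o tperm i i' =
          (fun j : 'I_k => (u ++ b :: a :: v)`_j).
  by apply/funext => j /=; rewrite -(@nth_swap _ 0 a b u v k i i' j).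
set g := f _; rewrite scaleN1r -scaleN1r lsubstZ rmorphN1 scaleN1r lsubst_comp.
set c := fun j : 'I_k.-1 => msub _ (lamdag _).
have cE j : exists q', c j = (map emb w')`_j + (partial n + emb (\sum_(t <- w) t)) * q'.
  rewrite /c; set j' := widen_ord _ j; have [q' ->] := msub_lamdag (tperm i i' j') ts.
  exists q'; rewrite es; congr (_ + _).
  have sw' : size w' = k by rewrite /w' size_cat /= ss0 ss1 !addnS.
  rewrite (nth_map 0) ?sw' ?(leq_trans (ltn_ord j)) ?leq_pred //; congr emb.
  by rewrite /w' (@nth_swap _ 0 p q s0 s1 k i i' j') ?ss0.
have [z ->] := lsubst_cong g cE.
by exists (- z); rewrite opprD addrAC addNr add0r scalerN.
Qed.

(** All conditions pass from constant arguments to polynomial ones by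
    multilinearity. *)
Lemma oper_ev M N k (f : cochain M N k) : is_cochain f -> oper k (ev f).
Proof.
move=> fc; split.
- move=> n u v s c x y uv; rewrite /ev !map_cat /=.
  have E (z : lpoly M n) : wts (u ++ (s, z) :: v) = wts (u ++ (s, x) :: v).
    by rewrite /wts !map_cat.
  rewrite (E (emb c *: x + y)) (E y); apply: mext_slot; first exact: mlin_capp.
  by rewrite !size_map.
- move=> n u v s x uv; rewrite /ev !map_cat /=.
  have -> (z : lpoly M n) : wts (u ++ (s, z) :: v) = wts (u ++ (s, x) :: v).
    by rewrite /wts !map_cat.
  set w := u ++ (s, x) :: v; set t := wts w.
  have lt_i : (size u < k)%N by rewrite -uv ltnS leq_addr.
  pose i := Ordinal lt_i; pose sw (j : 'I_k) := (map fst w)`_j.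
  have sizew : size w = k by rewrite size_cat /= addnS.
  have ts (j : 'I_k) : t`_j = emb (sw j).
    by rewrite (nth_map (0, 0)) ?sizew // /sw (nth_map (0,0)) ?sizew.
  have [q eq] := msub_lamdag i ts.
  have si : sw i = s by rewrite /sw map_cat nth_cat size_map ltnn subnn.
  have wtw : wt w = \sum_j sw j.
    have -> : wt w = \sum_(z <- map fst w) z by rewrite /wt big_map.
    by rewrite (big_nth 0) size_map sizew big_mkord.
  rewrite scalerDl addrC.
  have ml := @mlin_capp _ _ _ _ f n t fc.
  rewrite (mext_slot _ _ _ ml); last by rewrite !size_map.
  rewrite (@mext_sesq _ _ _ _ k _ (- msub (fun j : 'I_k.-1 => t`_j) (lamdag i)) _ _ _ ml);
    last 2 first.
  + by rewrite !size_map.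
  + move=> u' a v'; rewrite !size_map => su sv; rewrite /capp.
    have E z := @nth_mid _ M z u' v' 0 k i su.
    rewrite (_ : (fun j : 'I_k => (u' ++ 'X *: a :: v')`_j) =
      [eta (fun j : 'I_k => (u' ++ a :: v')`_j) with i |->
         'X *: (fun j : 'I_k => (u' ++ a :: v')`_j) i]).
      by rewrite (cochain_sesq fc) lsubstZ rmorphN.
    rewrite (E ('X *: a)) (E a); apply/funext => j /=; case: eqP => // _.
    by rewrite -su nth_cat ltnn subnn.
  rewrite -scalerDl eq si -wtw opprD addrA subrr sub0r.
  by eexists; rewrite scaleNr -scalerA -scalerN.
- move=> n u v [p x] [q y] uv; rewrite /ev !map_cat /=.
  set w := wts (u ++ (p, x) :: _); set w' := wts _.
  pose G := capp f w'; pose i := size u.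
  pose F' xs := if drop i xs is a :: b :: v' then G (take i xs ++ b :: a :: v') else 0.
  rewrite (@mext_swap _ _ _ _ F' G); last first.
    move=> u' b a v'; rewrite !size_map => su sv.
    by rewrite /F' /i -su drop_size_cat // take_size_cat.
  rewrite -[mext _ _]scale1r -mext_lin; apply: mext_Z => xs.
  rewrite size_cat /= !size_map => sxs; rewrite scale1r /F'.
  have := cat_take_drop i xs; have sd : size (drop i xs) = (size v).+2.
    by rewrite size_drop sxs addKn.
  have st : size (take i xs) = size u.
    by rewrite size_takel // sxs leq_addr.
  case: (drop i xs) sd => [|a [|b v']] //= [sv] => <-.
  have := @capp_skew M N k f n (map fst u) (map fst v) p q (take i xs) v' a b fc.
  rewrite st sv !size_map => /(_ uv erefl erefl).
  have -> : wt (u ++ (p, x) :: (q, y) :: v) =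
      \sum_(t <- map fst u ++ p :: q :: map fst v) t.
    by rewrite /wt !big_cat /= !big_cons !big_map.
  rewrite /G /w /w' /wts !map_cat /= -!map_comp [take i (_ ++ _)]take_size_cat ?st //; exact.
- move=> m n c w sw; rewrite /ev lsubst_mext; last first.
    by rewrite size_map sw; apply: mlin_capp.
  rewrite -!map_comp; apply: mext_eq => xs; rewrite size_map sw => sxs.
  rewrite /capp lsubst_comp; apply: eq_lsubst => j /=.
  have lt_j : (j < size w)%N by rewrite sw (leq_trans (ltn_ord j)) ?leq_pred.
  by rewrite /wts -map_comp !(nth_map (0, 0)) //= emb_wsub.
Qed.

(** Generic arguments: the i-th weight is the i-th variable. *)
Definition gen M k (x : 'I_k -> M) : seq (wel M k) :=
  [seq ('X_i, lconst k (x i)) | i <- enum 'I_k].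

Definition reify M N k (F : fam M N) : cochain M N k := fun x => ldag (F k (gen x)).

Lemma size_gen M k (x : 'I_k -> M) : size (gen x) = k.
Proof. by rewrite size_map size_enum_ord. Qed.

Lemma wt_gen M k (x : 'I_k -> M) : wt (gen x) = \sum_i 'X_i.
Proof. by rewrite /wt big_map big_enum. Qed.

(** Equality up to the indeterminacy of the eliminated parameter, which
    [reify] does not see. *)
Definition eqf M N k (F G : fam M N) : Prop := forall n (w : seq (wel M n)),
  size w = k -> Z (wt w) (F n w - G n w).

Lemma eqf_trans M N k (F G H : fam M N) : eqf k F G -> eqf k G H -> eqf k F H.
Proof.
move=> FG GH n w sw; have -> : F n w - H n w = (F n w - G n w) + (G n w - H n w).
  by rewrite addrA subrK.
by apply: ZD; [exact: FG | exact: GH].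
Qed.

Lemma reify_eq M N k (F G : fam M N) : (0 < k)%N -> eqf k F G ->
  reify F = reify G :> cochain M N k.
Proof.
move=> k0 FG; apply/funext => x; have := FG _ _ (size_gen x).
rewrite wt_gen => /(ldag_Z k0) /eqP; rewrite /reify.
rewrite [ldag _](lsubstD (@lamdag K k)) -scaleN1r lsubstZ rmorphN1 scaleN1r.
by rewrite subr_eq0 => /eqP.
Qed.

Lemma capp_id M N k (f : cochain M N k) (x : 'I_k -> M) (s : seq (A k.-1)) :
  (forall j : 'I_k.-1, s`_j = lam j) ->
  capp f s [seq x i | i <- enum 'I_k] = f x.
Proof.
move=> sE; rewrite /capp (_ : (fun j : 'I_k => _) = x); last first.
  apply/funext => j; rewrite (nth_map j) ?size_enum_ord //.
  by rewrite nth_ord_enum.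
by rewrite (eq_lsubst _ sE) lsubst_lam.
Qed.

Lemma reify_ev M N k (f : cochain M N k) : is_cochain f -> reify (ev f) = f.
Proof.
move=> fc; apply/funext => x; rewrite /reify /ldag /ev.
have -> : [seq t.2 | t <- gen x] = [seq lconst k y | y <- [seq x i | i <- enum 'I_k]].
  by rewrite -!map_comp.
rewrite mext_const; last by rewrite size_map size_enum_ord; exact: mlin_capp.
rewrite -[RHS](@capp_id M N k f x [seq lam j | j <- enum 'I_k.-1]); last first.
  by move=> j; rewrite (nth_map j) ?size_enum_ord // nth_ord_enum.
rewrite /capp lsubst_comp; apply: eq_lsubst => j /=.
have lt_j : (j < k)%N by rewrite (leq_trans (ltn_ord j)) ?leq_pred.
rewrite (nth_map j) ?size_enum_ord // nth_ord_enum /wts.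
rewrite (nth_map (0, 0)) ?size_gen // (nth_map (Ordinal lt_j)) ?size_enum_ord //=.
have -> : nth (Ordinal lt_j) (enum 'I_k) j = Ordinal lt_j.
  by apply: val_inj; rewrite /= nth_enum_ord.
by rewrite embX msub_lam (@lamdag_lt _ _ _ j).
Qed.

Lemma enum_split k (i : 'I_k) : enum 'I_k = take i (enum 'I_k) ++ i :: drop i.+1 (enum 'I_k).
Proof.
rewrite -[LHS](cat_take_drop i) (drop_nth i) ?size_enum_ord //.
by rewrite nth_ord_enum.
Qed.

Lemma gen_split M k (x : 'I_k -> M) (i : 'I_k) : exists u v : seq (wel M k),
  (size u + size v).+1 = k /\
  forall z, gen [eta x with i |-> z] = u ++ ('X_i, lconst k z) :: v.
Proof.
pose e := enum 'I_k; pose g (j : 'I_k) : wel M k := ('X_j, lconst k (x j)).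
exists (map g (take i e)), (map g (drop i.+1 e)); split.
  rewrite !size_map -[RHS](size_enum_ord k) [in RHS](enum_split i).
  by rewrite size_cat addnS.
have ue : uniq (take i e ++ i :: drop i.+1 e) by rewrite -enum_split enum_uniq.
move=> z; rewrite /gen [in LHS](enum_split i) map_cat /= eqxx.
move: ue; rewrite cat_uniq /= negb_or => /and4P[_ /andP[Nit _] Nid _].
congr (_ ++ _ :: _); apply/eq_in_map => j jin; case: eqP => // ji.
  by case/negP: Nit; move: jin; rewrite ji.
by case/negP: Nid; move: jin; rewrite ji.
Qed.

Lemma emb_mpolyC n (c : K) : emb c%:MP = c%:P%:MP :> A n.
Proof. exact: map_mpolyC. Qed.

Lemma eta_id T k (x : 'I_k -> T) i : [eta x with i |-> x i] = x :> ('I_k -> T).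
Proof. by apply/funext => j /=; case: eqP => [->|]. Qed.

Section Permutation.
Context {M N : lmodType {poly K}} {k : nat} {F : fam M N} (Fg : oper k F).

(** Arguments at a distance are exchanged by conjugating an exchange over a
    shorter distance with an exchange of neighbours; the three signs multiply
    to - 1. *)
Lemma oper_swap n (u m v : seq (wel M n)) p q :
  (size u + size m + size v).+2 = k ->
  Z (wt (u ++ p :: m ++ q :: v)) (F (u ++ p :: m ++ q :: v) + F (u ++ q :: m ++ p :: v)).
Proof.
elim: m u => [|a m IHm] u /=; first by rewrite addn0; exact: (g_skew Fg).
move=> sk; set w := u ++ _; set w' := u ++ _.
have sk1 : (size u + size (m ++ q :: v)).+2 = k.
  by rewrite size_cat /= -sk !addnS !addSn addnA.
have sk2 : (size u + size (m ++ p :: v)).+2 = k by rewrite -sk1 !size_cat.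
have sk3 : (size (rcons u a) + size m + size v).+2 = k.
  by rewrite size_rcons -sk !addSn addnS.
have := g_skew Fg p a sk1; have := IHm (rcons u a) sk3; have := g_skew Fg a q sk2.
rewrite !cat_rcons !(wt_cat, wt_cons) => h3 h2 h1.
have -> : F (u ++ p :: a :: m ++ q :: v) + F (u ++ q :: a :: m ++ p :: v) =
  F (u ++ p :: a :: m ++ q :: v) + F (u ++ a :: p :: m ++ q :: v)
  - (F (u ++ a :: p :: m ++ q :: v) + F (u ++ a :: q :: m ++ p :: v))
  + (F (u ++ a :: q :: m ++ p :: v) + F (u ++ q :: a :: m ++ p :: v)).
  by rewrite addrKA subrKA.
apply: ZD; first apply: ZB.
- exact: h1.
- by apply: (Zw _ h2); congr (_ + _); exact: addrCA.
- apply: (Zw _ h3); congr (_ + _); rewrite [in RHS]addrCA; congr (_ + _).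
  by rewrite addrCA [RHS]addrCA; congr (_ + _); exact: addrCA.
Qed.

Definition lst n (y : 'I_k -> wel M n) := [seq y i | i <- enum 'I_k].

Lemma wt_lst n (y : 'I_k -> wel M n) : wt (lst y) = \sum_i (y i).1.
Proof. by rewrite /wt big_map big_enum. Qed.

(** A permutation is a product of transpositions. *)
Lemma oper_perm n (s : 'S_k) (y : 'I_k -> wel M n) :
  Z (\sum_i (y i).1) (F (lst y) - (-1) ^+ s *: F (lst (y \o s))).
Proof.
have [ts -> _] := prod_tpermP s; elim: ts y => [|[i j] ts IHts] y.
  rewrite big_nil odd_perm1 expr0 scale1r (_ : y \o _ = y) ?subrr; first exact: Z0.
  by apply/funext => i /=; rewrite perm1.
rewrite big_cons /=; set t := (\prod_(z <- ts) _)%g.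
have [->|iNj] := eqVneq i j.
  by rewrite tperm1 mul1g; exact: IHts.
have swp (i' j' : 'I_k) (y' : 'I_k -> wel M n) : (i' < j')%N ->
  Z (\sum_i (y' i).1) (F (lst y') + F (lst (y' \o tperm i' j'))).
  move=> lt_ij; rewrite -wt_lst /lst.
  have in_j : j' \in drop i'.+1 (enum 'I_k).
    have : j' \in take i' (enum 'I_k) ++ i' :: drop i'.+1 (enum 'I_k).
      by rewrite -enum_split mem_enum.
    rewrite mem_cat inE.
    rewrite -[j' == i']val_eqE /= eqn_leq leqNgt lt_ij /= .
    case/orP => // /(nthP i')[l]; rewrite size_take size_enum_ord ltn_ord => lt_l.
    rewrite nth_take // => e; move: lt_ij; rewrite -e nth_enum_ord ?(ltn_trans lt_l) //.
    by rewrite ltnNge ltnW.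
  have ue := enum_uniq 'I_k; have e := enum_split i'.
  case/splitPr ed: _ / in_j => [m v]; rewrite ed in e; rewrite e in ue *.
  rewrite !map_cat /= !map_cat /= tpermL tpermR.
  have ue' : uniq (i' :: j' :: take i' (enum 'I_k) ++ m ++ v).
    rewrite -(perm_uniq (s1 := take i' (enum 'I_k) ++ i' :: m ++ j' :: v)) //.
    by apply/seq.permP => c; rewrite !count_cat /= !count_cat /=; ring.
  have mapE w : {subset w <= take i' (enum 'I_k) ++ m ++ v} ->
      [seq (y' \o tperm i' j') x | x <- w] = [seq y' x | x <- w].
    have /and3P[i'N j'N _] := ue'.
    move=> sw; apply/eq_in_map => x /sw xin /=; rewrite tpermD //.
      by apply: contraNneq i'N => ix; rewrite -ix in xin; rewrite in_cons xin orbT.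
    by apply: contraNneq j'N => jx; rewrite -jx in xin.
  rewrite !mapE.
  - apply: oper_swap; rewrite !size_map; have := size_enum_ord k; rewrite {1}e => sk.
    rewrite -[RHS]sk; by rewrite !size_cat /= !size_cat /=; ring.
  - by move=> x xin; rewrite !mem_cat xin !orbT.
  - by move=> x xin; rewrite !mem_cat xin !orbT.
  - by move=> x xin; rewrite !mem_cat xin.
have signF b (x : lpoly N n) : (-1) ^+ (~~ b) *: x = - ((-1) ^+ b *: x) :> lpoly N n.
  by case: b; rewrite ?expr0 ?expr1 ?scaleN1r ?scale1r ?opprK.
have swap1 (y' : 'I_k -> wel M n) :
    Z (\sum_i (y' i).1) (F (lst y') + F (lst (y' \o tperm i j))).
  have [lt_ij|lt_ji|/val_inj eij] := ltngtP i j; first exact: swp.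
    by rewrite tpermC; exact: swp.
  by rewrite eij eqxx in iNj.
have wE : \sum_i ((y \o t) i).1 = \sum_i (y i).1.
  by rewrite [RHS](reindex_inj (@perm_inj _ t)).
have := ZD (IHts y) (Zw wE (ZZ ((-1) ^+ t) (swap1 (y \o t)))).
rewrite scalerDr addrA subrK odd_permM odd_tperm iNj addTb signF opprK -/t.
rewrite (_ : (y \o t) \o _ = y \o (tperm i j * t)%g) //.
by apply/funext => x; rewrite /= permM.
Qed.
End Permutation.

(** For the symmetry under s: permuted generic arguments are the image of
    generic arguments by the renaming of variables given by s, and operations
    commute with substitutions. *)
Lemma oper_reify M N k (F : fam M N) : (0 < k)%N -> oper k F ->
  is_cochain (reify F : cochain M N k).
Proof.
move=> k0 Fg; split.
- by move=> e; rewrite e in k0.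
- move=> i c y y' x; have [u [v [uv gE]]] := gen_split x i.
  rewrite /reify !gE (_ : lconst k (c%:P *: y + y') = emb c%:MP *: lconst k y + lconst k y').
    by rewrite (g_lin Fg) // /ldag lsubstD lsubstZ emb_mpolyC msubC.
  by rewrite klin_const emb_mpolyC.
- move=> i x; have [u [v [uv gE]]] := gen_split x i.
  have gx := gE (x i); rewrite eta_id in gx.
  rewrite /reify gE gx (_ : lconst k ('X *: x i) =
    emb (- 'X_i) *: lconst k (x i) + (partial k + emb 'X_i) *: lconst k (x i)).
    rewrite (g_lin Fg) // /ldag lsubstD lsubstZ rmorphN rmorphN /= embX msub_lam -gx.
    rewrite [X in _ + X](ldag_Z k0) ?addr0 // -(wt_gen x) gx.
    by rewrite -embX; apply: (g_ses Fg).
  by rewrite rmorphN -scalerDl /= addrC addrK lconstZ.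
- move=> s x; rewrite /reify; set y := fun i : 'I_k => ('X_i : {mpoly K[k]}, lconst k (x i)).
  have := oper_perm Fg s y; rewrite -[lst y]/(gen x).
  move=> /(ldag_Z k0) /eqP; rewrite /ldag lsubstD -scaleN1r !lsubstZ rmorphN1 scaleN1r.
  rewrite subr_eq0 => /eqP ->; rewrite rmorph_sign; congr (_ *: _).
  have -> : lst (y \o s) = map (tsub (fun i => 'X_(s i))) (gen (x \o s)).
    rewrite /lst /gen -[RHS]map_comp; apply: eq_map => i /=.
    by rewrite /tsub /= wsubX lsubst_const.
  rewrite -(g_nat Fg) ?size_gen // !lsubst_comp; apply: eq_lsubst => i /=.
  rewrite embX msub_lam; have [lt_i|le_i] := ltnP i k.-1.
    rewrite (@lamdag_lt _ _ i (Ordinal lt_i)) // msub_lam; congr (lamdag (s _)).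
    exact: val_inj.
  have ei : i = k.-1 :> nat.
    by apply/eqP; rewrite eqn_leq le_i andbT -ltnS (ltn_predK (ltn_ord i)).
  rewrite [X in msub _ X]lamdag_max // rmorphB rmorphN /= msub_partial rmorph_sum /=.
  rewrite -(@sum_lamdag K k k0) (reindex_inj (@perm_inj _ s)) /=.
  case: k s i ei {F Fg x y le_i k0} => [|k] s i ei; first by case: (i).
  rewrite (eq_bigr _ (fun j _ => msub_lam _ j)) big_ord_recr /=.
  rewrite (_ : ord_max = i); last exact/val_inj.
  rewrite addrA -[LHS]add0r; congr (_ + _).
  rewrite -[LHS](addNr (\sum_(j < k) lamdag (s (widen_ord (leqnSn k) j)))).
  congr (- _ + _); apply: eq_bigr => j _; congr (lamdag (s _)); exact: val_inj.
Qed.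

Definition wconst M n (t : {mpoly K[n]} * M) : wel M n := (t.1, lconst n t.2).

(** Polynomials are sums of multiples of constants, and operations are
    additive and commute with the multiplication by parameters. *)
Lemma eqf_const M N k (F G : fam M N) : oper k F -> oper k G ->
  (forall n (w : seq ({mpoly K[n]} * M)), size w = k ->
     Z (wt (map (@wconst M n) w)) (F n (map (@wconst M n) w) - G n (map (@wconst M n) w))) ->
  eqf k F G.
Proof.
move=> Fg Gg FG n w; rewrite -[w]cats0 -[X in _ ++ X]/(map (@wconst M n) [::]).
elim/last_ind: w [::] => [|w [s x] IHw] c sk.
  by apply: FG; rewrite size_map in sk.
rewrite cat_rcons in sk *; move: sk; rewrite size_cat /= addnS => sk.
pose s0 := wt (w ++ (s, 0) :: map (@wconst M n) c).
suff {x} h x : Z s0 (F n (w ++ (s, x) :: map (@wconst M n) c) -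
                 G n (w ++ (s, x) :: map (@wconst M n) c)).
  by apply: (Zw (wt_mid _ _ _ _ _) (h x)).
move: x; apply: lpoly_ind => [x y hx hy|m v].
  have -> : x + y = emb 1 *: x + y by rewrite rmorph1 scale1r.
  rewrite (g_lin Fg) ?(g_lin Gg) // rmorph1 !scale1r opprD addrACA.
  exact: ZD.
have := IHw ((s, v) :: c); rewrite size_cat /= addnS => /(_ sk).
move=> /(ZZ 'X_[m]) /(Zw (wt_mid _ _ _ _ 0)); rewrite scalerBr -embXm.
have -> : lmono m v = emb 'X_[m] *: lconst n v + 0 by rewrite addr0 embXm.
have z0 (H : fam M N) : oper k H -> H n (w ++ (s, 0) :: map (@wconst M n) c) = 0.
  move=> Hg; have := g_lin Hg s 1 0 0 sk; rewrite rmorph1 !scale1r addr0.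
  by move/eqP; rewrite -[X in X == _]addr0 (inj_eq (addrI _)) => /eqP/esym.
by rewrite (g_lin Fg) // (g_lin Gg) // (z0 F) // (z0 G) // !addr0.
Qed.

Lemma nth_lst T (x0 : T) k (y : 'I_k -> T) (j : 'I_k) :
  nth x0 [seq y i | i <- enum 'I_k] j = y j.
Proof. by rewrite (nth_map j) ?size_enum_ord // nth_ord_enum. Qed.

Lemma lst_nth T (x0 : T) (w : seq T) k : size w = k ->
  w = [seq nth x0 w i | i : 'I_k <- enum 'I_k].
Proof.
move=> sw; apply: (@eq_from_nth _ x0) => [|i]; first by rewrite size_map size_enum_ord.
by rewrite sw => lt_i; rewrite (nth_lst x0 (fun j : 'I_k => nth x0 w j) (Ordinal lt_i)).
Qed.

Lemma ev_const M N k (f : cochain M N k) n (w : seq ({mpoly K[n]} * M)) :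
  is_cochain f -> size w = k ->
  ev f (map (@wconst M n) w) = capp f [seq emb t.1 | t <- w] [seq t.2 | t <- w].
Proof.
move=> fc sw; rewrite /ev /wts -!map_comp.
have -> : [seq (snd \o @wconst M n) i | i <- w] = [seq lconst n y | y <- [seq t.2 | t <- w]].
  by rewrite -map_comp.
by rewrite mext_const // size_map sw; exact: mlin_capp.
Qed.

(** Constant arguments of weights s_i are obtained from generic ones by the
    substitution lambda_i |-> s_i. *)
Lemma ev_reify M N k (F : fam M N) : (0 < k)%N -> oper k F ->
  eqf k (ev (reify F : cochain M N k)) F.
Proof.
move=> k0 Fg; have fc := oper_reify k0 Fg.
apply: eqf_const => //; first exact: oper_ev.
move=> n w sw; rewrite ev_const //; set t := [seq emb _ | _ <- w].
pose s (i : 'I_k) := (nth (0, 0) w i).1; pose x (i : 'I_k) := (nth (0, 0) w i).2.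
have ts (j : 'I_k) : t`_j = emb (s j) by rewrite (nth_map (0, 0)) ?sw.
have wE : map (@wconst M n) w = map (tsub s) (gen x).
  rewrite [in LHS](lst_nth (0, 0) sw) -!map_comp; apply: eq_map => i /=.
  by rewrite /tsub /wconst /= wsubX lsubst_const.
have -> : wt (map (@wconst M n) w) = \sum_j s j.
  rewrite wE wt_tsub wt_gen rmorph_sum; apply: eq_bigr => i _; exact: wsubX.
rewrite wE -(g_nat Fg) ?size_gen // /capp /reify /ldag lsubst_comp.
have -> : (fun j : 'I_k => [seq t0.2 | t0 <- w]`_j) = x.
  by apply/funext => j; rewrite (nth_map (0, 0)) ?sw.
have [z ->] := lsubst_cong (F k (gen x)) (fun i => msub_lamdag i ts).
by exists z; rewrite addrC addKr.
Qed.

Definition lconj (L M N U : lmodType {poly K}) k (f : {linear L -> M})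
    (g : {linear N -> U}) (h : cochain M N k) : cochain L U k :=
  fun z => lmap g (h (f \o z)).

Lemma eta_comp (T1 T2 : Type) k (f : T1 -> T2) (x : 'I_k -> T1) i z :
  f \o [eta x with i |-> z] = [eta f \o x with i |-> f z] :> ('I_k -> T2).
Proof. by apply/funext => j /=; case: eqP. Qed.

Lemma lconj_cochain (L M N U : lmodType {poly K}) k (f : {linear L -> M})
    (g : {linear N -> U}) (h : cochain M N k) :
  is_cochain h -> is_cochain (lconj f g h).
Proof.
have gD := @lmapD _ _ _ k.-1 g (raddfD g).
move=> hc; split.
- move=> k0; rewrite (cochain_pos hc k0); apply/funext => z.
  exact: (lextf0 (fun v => lconst k.-1 (g v))).
- move=> i c y y' x; rewrite /lconj !eta_comp linearP (cochain_lin hc).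
  by rewrite gD lmapZ.
- by move=> i x; rewrite /lconj eta_comp linearZ /= (cochain_sesq hc) lmapZ.
- move=> s x; rewrite /lconj (cochain_skew hc s) lmapZ; congr (_ *: _).
  exact: lmap_lsubst.
Qed.

Lemma ev_lconj (L M N U : lmodType {poly K}) k (f : {linear L -> M})
    (g : {linear N -> U}) (h : cochain M N k) n (w : seq (wel L n)) :
  is_cochain h -> size w = k ->
  ev (lconj f g h) w = lmap g (ev h (map (tmap f) w)).
Proof.
move=> hc sw; rewrite /ev lmap_mext /wts -!map_comp.
have -> : [seq (snd \o tmap f) i | i <- w] = [seq lmap f y | y <- [seq t.2 | t <- w]].
  by rewrite -map_comp.
set t := [seq emb _ | t <- w].
have ml : mlin k (fun xs => lmap g (capp h t xs)).
  move=> u v uv c x y; rewrite (mlin_capp _ hc uv) lmapD ?lmapZ //; exact: raddfD.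
rewrite mext_lmap; last by rewrite size_map sw.
apply: mext_eq => xs sxs; rewrite /capp /lconj -lmap_lsubst; congr (lmap _ (lsubst _ _)).
congr h; apply/funext => j /=; rewrite (nth_map 0) // sxs size_map sw.
exact: ltn_ord.
Qed.

End Reification.

(** * Identities in abelian groups *)

Section ZmodSolver.
Context {V : zmodType}.

(** Reflexive decision of identities in abelian groups, by comparison of the
    integer coefficients of the atoms. *)
Inductive zexp := ZVar of nat | ZAdd of zexp & zexp | ZOpp of zexp | ZNul.

Fixpoint zeval (s : seq V) (e : zexp) : V :=
  match e with
  | ZVar i => s`_i
  | ZAdd e1 e2 => zeval s e1 + zeval s e2
  | ZOpp e1 => - zeval s e1
  | ZNul => 0
  end.

Fixpoint zcoef (e : zexp) (i : nat) : int :=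
  match e with
  | ZVar j => Posz (i == j)
  | ZAdd e1 e2 => zcoef e1 i + zcoef e2 i
  | ZOpp e1 => - zcoef e1 i
  | ZNul => 0
  end.

Lemma zevalE s e : zeval s e = \sum_(i < size s) s`_i *~ zcoef e i.
Proof.
elim: e => [j|e1 IH1 e2 IH2|e IH|] /=.
- have [lt_j|le_j] := ltnP j (size s); last first.
    rewrite nth_default // big1 // => i _; case: eqP => // e.
    by move: le_j; rewrite leqNgt -e ltn_ord.
  rewrite (bigD1 (Ordinal lt_j)) //= eqxx big1 ?addr0 // => i.
  by rewrite -val_eqE /= => /negPf ->.
- by rewrite IH1 IH2 -big_split; apply: eq_bigr => i _; rewrite mulrzDr.
- by rewrite IH -sumrN; apply: eq_bigr => i _; rewrite mulrNz.
- by rewrite big1.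
Qed.

Lemma zsolve s e1 e2 :
  all (fun i => zcoef e1 i == zcoef e2 i) (seq.iota 0 (size s)) -> zeval s e1 = zeval s e2.
Proof.
move/allP => e12; rewrite !zevalE; apply: eq_bigr => i _; congr (_ *~ _).
by apply/eqP/e12; rewrite mem_iota ltn_ord.
Qed.

End ZmodSolver.

Ltac zmem a l :=
  lazymatch l with
  | nil => constr:(false)
  | a :: _ => constr:(true)
  | _ :: ?l' => zmem a l'
  end.

Ltac zatoms e l :=
  lazymatch e with
  | (?x + ?y)%R => let l' := zatoms x l in zatoms y l'
  | (- ?x)%R => zatoms x l
  | (0)%R => l
  | _ => let b := zmem e l in
         lazymatch b with true => l | false => constr:(e :: l) end
  end.

Ltac zindex a l :=
  lazymatch l with
  | a :: _ => constr:(0%N)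
  | _ :: ?l' => let i := zindex a l' in constr:(S i)
  end.

Ltac zreify e l :=
  lazymatch e with
  | (?x + ?y)%R => let a := zreify x l in let b := zreify y l in constr:(ZAdd a b)
  | (- ?x)%R => let a := zreify x l in constr:(ZOpp a)
  | (0)%R => constr:(ZNul)
  | _ => let i := zindex e l in constr:(ZVar i)
  end.

Ltac abelian :=
  lazymatch goal with
  | |- ?a = ?b :> ?V =>
    let l := zatoms a (@nil V) in let l := zatoms b l in
    let ra := zreify a l in let rb := zreify b l in
    exact (@zsolve _ l ra rb (erefl true))
  end.

(** * Signed sums over splittings of a list *)

Section SplitSums.
Context {R : comNzRingType} {T : Type}.
Implicit Types (V : lmodType R) (u v w : seq T).

(** The signed sum over all pairs of complementary sublists, the sign being
    that of the unshuffle: the coproduct of the exterior algebra on the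
    entries. *)
Fixpoint ssum V (w : seq T) (H : seq T -> seq T -> V) : V :=
  if w is x :: w' then
    ssum w' (fun u v => H (x :: u) v) +
    ssum w' (fun u v => (-1) ^+ size u *: H u (x :: v))
  else H [::] [::].

Lemma sg2 k : (-1) ^+ k.*2 = 1 :> R.
Proof. by rewrite -signr_odd odd_double. Qed.

Lemma sgK V k (x : V) : (-1) ^+ k *: ((-1) ^+ k *: x) = x.
Proof. by rewrite scalerA -exprD addnn sg2 scale1r. Qed.

(** Being a permutation, for lists over types without decidable equality. *)
Definition reordering u v : Prop := forall (W : nmodType) (f : T -> W),
  \sum_(x <- u) f x = \sum_(x <- v) f x.

Lemma reordering_size u v : reordering u v -> size u = size v.
Proof. by move=> /(_ nat (fun=> 1%N)); rewrite -!sum1_size. Qed.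

Lemma reordering_cons x u w : reordering u w -> reordering (x :: u) (x :: w).
Proof. by move=> uw W f; rewrite !big_cons uw. Qed.

Lemma reordering_consr x u v w : reordering (u ++ v) w -> reordering (u ++ x :: v) (x :: w).
Proof. by move=> uvw W f; rewrite big_cat !big_cons /= addrCA -big_cat uvw. Qed.

Lemma eq_ssum V w (H H' : seq T -> seq T -> V) :
  (forall u v, reordering (u ++ v) w -> H u v = H' u v) -> ssum w H = ssum w H'.
Proof.
elim: w H H' => [|x w IHw] H H' HH' /=; first exact: HH'.
congr (_ + _); apply: IHw => u v uvw; first by apply: HH'; exact: reordering_cons.
by rewrite HH' //; exact: reordering_consr.
Qed.

Lemma ssum_lin V w p (H H' : seq T -> seq T -> V) :
  ssum w (fun u v => p *: H u v + H' u v) = p *: ssum w H + ssum w H'.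
Proof.
elim: w H H' => [|x w IHw] H H' //=; rewrite IHw scalerDr addrACA; congr (_ + _).
by rewrite -IHw; apply: eq_ssum => u v _; rewrite scalerDr !scalerA mulrC.
Qed.

Lemma ssum0 V w : ssum w (fun _ _ => 0 : V) = 0.
Proof.
elim: w => [|x w IHw] //=; rewrite IHw add0r -[RHS]IHw.
by apply: eq_ssum => u v _; rewrite scaler0.
Qed.

Lemma ssumD V w (H H' : seq T -> seq T -> V) :
  ssum w (fun u v => H u v + H' u v) = ssum w H + ssum w H'.
Proof.
rewrite -[ssum w H]scale1r -ssum_lin; apply: eq_ssum => u v _.
by rewrite scale1r.
Qed.

Lemma ssumZ V w p (H : seq T -> seq T -> V) :
  ssum w (fun u v => p *: H u v) = p *: ssum w H.
Proof.
by rewrite -[RHS]addr0 -(ssum0 V w) -ssum_lin; apply: eq_ssum => u v _; rewrite addr0.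
Qed.

Lemma ssum_coassoc V w (H : seq T -> seq T -> seq T -> V) :
  ssum w (fun u v => ssum v (fun v1 v2 => H u v1 v2)) =
  ssum w (fun t v2 => ssum t (fun u v1 => H u v1 v2)).
Proof.
elim: w H => [|x w IHw] H //=.
rewrite (IHw (fun u => H (x :: u))) [in RHS]ssumD -addrA; congr (_ + _).
under eq_ssum => u v _ do rewrite scalerDr -!ssumZ.
rewrite ssumD; congr (_ + _).
  by rewrite (IHw (fun u v1 v2 => (-1) ^+ size u *: H u (x :: v1) v2)).
rewrite (IHw (fun u v1 v2 => (-1) ^+ size u *: ((-1) ^+ size v1 *: H u v1 (x :: v2)))).
apply: eq_ssum => t v2 _; rewrite -ssumZ; apply: eq_ssum => u v1 /reordering_size <-.
by rewrite scalerA -exprD size_cat.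
Qed.

Lemma ssum_cocomm V w (H : seq T -> seq T -> V) :
  ssum w H = ssum w (fun u v => (-1) ^+ (size u * size v) *: H v u).
Proof.
elim: w H => [|x w IHw] H /=; first by rewrite expr0 scale1r.
rewrite addrC; congr (_ + _); rewrite IHw; apply: eq_ssum => u v _ /=.
  by rewrite scalerA -exprD mulSn addnC.
by rewrite scalerA -exprD mulnS addnA addnn exprD sg2 mul1r.
Qed.

Section Relation.
Context {V : lmodType R} (P : V -> V -> V -> Prop).
Hypothesis PD : forall a b c a' b' c',
  P a b c -> P a' b' c' -> P (a + a') (b + b') (c + c').
Hypothesis PS : forall k a b c, P a b c ->
  P ((-1) ^+ k *: a) ((-1) ^+ k *: b) ((-1) ^+ k *: c).

Lemma ssum_rel w (H0 H1 H2 : seq T -> seq T -> V) :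
  (forall u v, reordering (u ++ v) w -> P (H0 u v) (H1 u v) (H2 u v)) ->
  P (ssum w H0) (ssum w H1) (ssum w H2).
Proof.
elim: w H0 H1 H2 => [|x w IHw] H0 H1 H2 PH /=; first exact: PH.
apply: PD; apply: IHw => u v uvw; first by apply: PH; exact: reordering_cons.
by apply/PS/PH; exact: reordering_consr.
Qed.

(** For P a b c of the form a = p b + c or Z a: additivity and
    sesquilinearity in one entry pass from the terms to the sum, whichever
    sublist the entry falls in. *)
Lemma ssum_slot X0 X1 X2 w1 w2 (H : seq T -> seq T -> V) :
  (forall u1 u2 v, reordering (u1 ++ u2 ++ v) (w1 ++ w2) ->
     P (H (u1 ++ X0 :: u2) v) (H (u1 ++ X1 :: u2) v) (H (u1 ++ X2 :: u2) v)) ->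
  (forall u v1 v2, reordering (u ++ v1 ++ v2) (w1 ++ w2) ->
     P (H u (v1 ++ X0 :: v2)) (H u (v1 ++ X1 :: v2)) (H u (v1 ++ X2 :: v2))) ->
  P (ssum (w1 ++ X0 :: w2) H) (ssum (w1 ++ X1 :: w2) H) (ssum (w1 ++ X2 :: w2) H).
Proof.
elim: w1 H => [|x w1 IHw] H Pu Pv /=.
  apply: PD; apply: ssum_rel => u v uvw; first exact: (Pu [::] u v).
  by apply/PS/(Pv u [::] v).
apply: PD; apply: IHw.
- by move=> u1 u2 v uvw; apply: (Pu (x :: u1)); exact: reordering_cons.
- by move=> u v1 v2 uvw; apply: (Pv (x :: u)); exact: reordering_cons.
- move=> u1 u2 v uvw; rewrite !size_cat /=; apply/PS/Pu.
  by rewrite catA; apply: reordering_consr; rewrite -catA.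
- by move=> u v1 v2 uvw; apply/PS/(Pv u (x :: v1)); exact: reordering_consr.
Qed.

End Relation.

(** Splittings that separate p from q cancel in pairs, by the sign of their
    exchange; in the others p and q remain neighbours. *)
Lemma ssum_alt V (S : V -> Prop) p q w1 w2 (H : seq T -> seq T -> V) :
  (forall a b, S a -> S b -> S (a + b)) ->
  (forall k a, S a -> S ((-1) ^+ k *: a)) ->
  (forall u1 u2 v, reordering (u1 ++ u2 ++ v) (w1 ++ w2) ->
     S (H (u1 ++ p :: q :: u2) v + H (u1 ++ q :: p :: u2) v)) ->
  (forall u v1 v2, reordering (u ++ v1 ++ v2) (w1 ++ w2) ->
     S (H u (v1 ++ p :: q :: v2) + H u (v1 ++ q :: p :: v2))) ->
  S (ssum (w1 ++ p :: q :: w2) H + ssum (w1 ++ q :: p :: w2) H).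
Proof.
move=> SD SS; have Srel w H0 : (forall u v, reordering (u ++ v) w -> S (H0 u v)) -> S (ssum w H0).
  by move=> hS; apply: (ssum_rel (P := fun a _ _ => S a) _ _ (H1 := H0) (H2 := H0)) => //;
    move=> *; auto.
elim: w1 H => [|x w1 IHw] H Su Sv /=.
  rewrite -!ssumD; apply: Srel => u v uvw.
  have h1 := Su [::] u v uvw; have h2 := Sv u [::] v uvw.
  rewrite /= !sgK !exprS !mulN1r !scaleNr.
  set A := H (p :: _) _; set B := _ *: H (p :: u) _; set C := _ *: H (q :: u) _.
  rewrite (_ : _ + _ = (A + H (q :: p :: u) v) + (H u (p :: q :: v) + H u (q :: p :: v))).
    exact: SD.
  by abelian.
rewrite addrACA; apply: SD; first apply: IHw.
- by move=> u1 u2 v uvw; apply: (Su (x :: u1)); exact: reordering_cons.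
- by move=> u v1 v2 uvw; apply: (Sv (x :: u)); exact: reordering_cons.
apply: (IHw (fun u v => (-1) ^+ size u *: H u (x :: v))).
- move=> u1 u2 v uvw; rewrite !size_cat /= -scalerDr; apply/SS/Su.
  by rewrite catA; apply: reordering_consr; rewrite -catA.
- by move=> u v1 v2 uvw; rewrite -scalerDr; apply/SS/(Sv u (x :: v1)); exact: reordering_consr.
Qed.

Lemma ssum_size0 V w (H : seq T -> seq T -> V) :
  ssum w (fun u v => if size u == 0%N then H u v else 0) = H [::] w.
Proof.
elim: w H => [|x w IHw] H //=; rewrite ssum0 add0r -[RHS](IHw (fun u v => H u (x :: v))).
apply: eq_ssum => u v _; case: eqP => [/size0nil ->|]; rewrite ?scaler0 //.
by rewrite scale1r.
Qed.

End SplitSums.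

Lemma ssum_map (R : comNzRingType) (V : lmodType R) (T T' : Type) (f : T -> T') w
    (H : seq T' -> seq T' -> V) :
  ssum (map f w) H = ssum w (fun u v => H (map f u) (map f v)).
Proof.
elim: w H => [|x w IHw] H //=; rewrite !IHw; congr (_ + _).
by apply: eq_ssum => u v _; rewrite size_map.
Qed.

Lemma ssum_morph (R R' : comNzRingType) (T : Type) (V : lmodType R) (W : lmodType R')
    (g : V -> W) w (H : seq T -> seq T -> V) :
  {morph g : x y / x + y} -> g (ssum w H) = ssum w (fun u v => g (H u v)).
Proof.
move=> gD; have g0 : g 0 = 0 by apply: (addrI (g 0)); rewrite -gD !addr0.
have gN x : g (- x) = - g x.
  by apply: (addrI (g x)); rewrite -gD !addrN.
have gS n x : g ((-1) ^+ n *: x) = (-1) ^+ n *: g x.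
  by rewrite -signr_odd -[in RHS]signr_odd; case: odd; rewrite ?expr0 ?expr1 ?scaleN1r ?scale1r.
elim: w H => [|x w IHw] H //=; rewrite gD !IHw; congr (_ + _).
by apply: eq_ssum => u v _.
Qed.

(** * The Nijenhuis-Richardson bracket *)

Section OperationTheory.
Context {K : fieldType} {M N : lmodType {poly K}} {k : nat} {F : fam M N}.
Hypothesis Fg : oper k F.

Lemma g_add n (u v : seq (wel M n)) s x y : (size u + size v).+1 = k ->
  F (u ++ (s, x + y) :: v) = F (u ++ (s, x) :: v) + F (u ++ (s, y) :: v).
Proof. by move=> uv; have := g_lin Fg s 1 x y uv; rewrite rmorph1 !scale1r. Qed.

Lemma g_zero n (u v : seq (wel M n)) s : (size u + size v).+1 = k ->
  F (u ++ (s, 0) :: v) = 0.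
Proof. by move=> uv; apply: (addrI (F (u ++ (s, 0) :: v))); rewrite -g_add // !addr0. Qed.

Lemma g_opp n (u v : seq (wel M n)) s x : (size u + size v).+1 = k ->
  F (u ++ (s, - x) :: v) = - F (u ++ (s, x) :: v).
Proof.
by move=> uv; apply: (addrI (F (u ++ (s, x) :: v))); rewrite -g_add // !addrN g_zero.
Qed.

Lemma g_scale n (u v : seq (wel M n)) s c x : (size u + size v).+1 = k ->
  F (u ++ (s, emb c *: x) :: v) = emb c *: F (u ++ (s, x) :: v).
Proof. by move=> uv; rewrite -[emb c *: x]addr0 (g_lin Fg) // g_zero // addr0. Qed.

Lemma g_sign n (u v : seq (wel M n)) s l x : (size u + size v).+1 = k ->
  F (u ++ (s, (-1) ^+ l *: x) :: v) = (-1) ^+ l *: F (u ++ (s, x) :: v).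
Proof.
by move=> uv; have := g_scale s ((-1) ^+ l) x uv; rewrite rmorphXn rmorphN1.
Qed.

Lemma g_Z n (u v : seq (wel M n)) s t x : (size u + size v).+1 = k -> Z t x -> t = s ->
  Z (wt (u ++ (s, x) :: v)) (F (u ++ (s, x) :: v)).
Proof.
move=> uv [z ->] ->; apply: Zw (g_ses Fg s z uv); exact: wt_mid.
Qed.

End OperationTheory.

Section Star.
Context {K : fieldType} {M : lmodType {poly K}}.
Implicit Types (F G H : fam M M) (n k : nat).

(** The product of which the Nijenhuis-Richardson bracket is the commutator,
    without elimination of a parameter. *)
Definition star k F G : fam M M := fun n w =>
  ssum w (fun u v => if size u == k then F n ((wt u, G n u) :: v) else 0).

Lemma wt_reordering n (u v : seq (wel M n)) : reordering u v -> wt u = wt v.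
Proof. exact. Qed.

Lemma sgE n l (x : lpoly M n) : (-1) ^+ l *: x = if odd l then - x else x.
Proof. by rewrite -signr_odd; case: odd; rewrite ?expr1 ?expr0 ?scaleN1r ?scale1r. Qed.

Lemma Z_ssum T n s (w : seq T) (H : seq T -> seq T -> lpoly M n) :
  (forall u v, reordering (u ++ v) w -> Z s (H u v)) -> Z s (ssum w H).
Proof.
move=> HZ; apply: (ssum_rel (P := fun a _ _ => Z s a) _ _ (H1 := H) (H2 := H)) => //.
  by move=> *; exact: ZD.
by move=> *; exact: ZZ.
Qed.

(** The symmetry comes from [ssum_alt]: neighbours in the same sublist are
    exchanged by the symmetry of F or of G. *)
Lemma oper_star m k F G : oper m.+1 F -> oper k G -> oper (m + k) (star k F G).
Proof.
move=> Fg Gg; split.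
- move=> n u0 v0 s c x y sz.
  apply: (ssum_slot (P := fun a b c' => a = emb c *: b + c')).
  + by move=> a b d a' b' d' -> ->; rewrite scalerDr addrACA.
  + by move=> l a b d ->; rewrite scalerDr !scalerA mulrC.
  + move=> u1 u2 v /reordering_size; rewrite !size_cat => szu /=.
    case: eqP => [su|]; last by rewrite scaler0 addr0.
    rewrite (g_lin Gg); last by lia.
    rewrite (wt_mid _ _ _ _ x) (wt_mid u1 u2 s y x).
    by rewrite (g_lin Fg (u := [::])) //=; lia.
  + move=> u v1 v2 /reordering_size; rewrite !size_cat => szu /=.
    case: eqP => [su|]; last by rewrite scaler0 addr0.
    by apply: (g_lin Fg (u := _ :: _)) => /=; lia.
- move=> n u0 v0 s x sz; set X : wel M n := (s, _ *: _); set e := wt _.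
  apply: (@ssum_slot _ _ _ (fun a _ _ => Z e a) _ _ X X X).
  + by move=> *; exact: ZD.
  + by move=> *; exact: ZZ.
  + move=> u1 u2 v uv; have := reordering_size uv; rewrite !size_cat => szu /=.
    case: eqP => [su|_]; last exact: Z0.
    rewrite ?size_cat /= in su.
    have -> : e = wt ((wt (u1 ++ X :: u2), G n (u1 ++ X :: u2)) :: v).
      rewrite /e wt_cons /= !wt_cat !wt_cons; have := wt_reordering uv; rewrite !wt_cat => w_eq.
      by rewrite /= addrCA -w_eq; ring.
    have GZ := g_ses Gg s x (u := u1) (v := u2).
    apply: (g_Z (u := [::]) Fg _ (GZ _) (wt_mid _ _ _ _ _)) => /=; by lia.
  + move=> u v1 v2 uv; have := reordering_size uv; rewrite !size_cat => szu /=.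
    case: eqP => [su|_]; last exact: Z0.
    have -> : e = wt ((wt u, G n u) :: v1 ++ (s, x) :: v2).
      rewrite /e wt_cons /= !wt_cat !wt_cons; have := wt_reordering uv; rewrite !wt_cat => w_eq.
      by rewrite /= addrCA -w_eq; ring.
    by apply: (g_ses Fg s x (u := _ :: _)) => /=; lia.
- move=> n u0 v0 p q sz; set e := wt _.
  apply: (ssum_alt (S := fun a => Z e a)).
  + by move=> *; exact: ZD.
  + by move=> *; exact: ZZ.
  + move=> u1 u2 v uv; have := reordering_size uv; rewrite !size_cat => szu /=.
    case: eqP => [su|_]; last by rewrite addr0; exact: Z0.
    rewrite ?size_cat /= in su.
    rewrite (wt_swap _ _ q p); set f := wt _.
    rewrite -(g_add Fg (u := [::])) /=; last by lia.
    set y := G n _ + _; have -> : e = wt ((f, y) :: v).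
      rewrite /e wt_cons /= !wt_cat !wt_cons; have := wt_reordering uv; rewrite !wt_cat => w_eq.
      by rewrite /= /f !wt_cat !wt_cons; transitivity (wt u0 + wt v0 + (p.1 + q.1)); 
        [ring | rewrite -w_eq; ring].
    have yZ : Z f y by apply: (g_skew Gg); lia.
    by apply: (g_Z (u := [::]) Fg _ yZ) => //=; lia.
  + move=> u v1 v2 uv; have := reordering_size uv; rewrite !size_cat => szu /=.
    case: eqP => [su|_]; last by rewrite addr0; exact: Z0.
    have -> : e = wt ((wt u, G n u) :: v1 ++ [:: p, q & v2]).
      rewrite /e wt_cons /= !wt_cat !wt_cons; have := wt_reordering uv; rewrite !wt_cat => w_eq.
      by rewrite /=; transitivity (wt u0 + wt v0 + (p.1 + q.1)); [ring | rewrite -w_eq; ring].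
    by apply: (g_skew Fg p q (u := _ :: _)) => /=; lia.
- move=> l n c w sw; rewrite /star ssum_map ssum_morph; last exact: lsubstD.
  apply: eq_ssum => u v /reordering_size; rewrite size_cat sw size_map => suv.
  case: eqP => [su|_]; last exact: lsubst0.
  rewrite (g_nat Fg) /=; last by lia.
  by rewrite /tsub /= (g_nat Gg) // wt_tsub.
Qed.

(** The terms by which insertion fails to be associative: G and H enter F
    side by side. *)
Definition nested n r F G H : fam M M := fun N w =>
  ssum w (fun u v => if size u == r then
    ssum v (fun v1 v2 => if size v1 == n then
      (-1) ^+ n *: F N ((wt v1, G N v1) :: (wt u, H N u) :: v2) else 0) else 0).

(** H is inserted either in an argument of G or in another argument of F. *)
Lemma star_assoc m n r F G H N (w : seq (wel M N)) : oper m.+1 F ->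
  size w = (m + n + r)%N ->
  star r (star n.+1 F G) H w =
    star (n + r) F (star r G H) w + nested n.+1 r F G H w.
Proof.
move=> Fg sw; transitivity
  (ssum w (fun u v => ssum v (fun v1 v2 => if (size u == r) && (size v1 == n) then
       F N ((wt u + wt v1, G N ((wt u, H N u) :: v1)) :: v2) else 0))
   + nested n.+1 r F G H w).
  rewrite /nested -ssumD; apply: eq_ssum => u v _.
  case: eqP => [su|_]; last by rewrite ssum0 addr0.
  rewrite /star /=; congr (_ + _); apply: eq_ssum => v1 v2 _.
    by rewrite eqSS wt_cons.
  by case: eqP => [->|_]; rewrite ?scaler0.
congr (_ + _); rewrite ssum_coassoc /star; apply: eq_ssum => t v tv.
have st := reordering_size tv; rewrite size_cat sw in st.
case: eqP => [stn|stn]; last first.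
  rewrite -[RHS](ssum0 _ t); apply: eq_ssum => u v1 /reordering_size.
  by rewrite size_cat; case: eqP => //=; case: eqP => //= *; lia.
rewrite (@ssum_morph _ _ _ _ _ (fun z => F N ((wt t, z) :: v))); last first.
  by move=> x y; apply: (g_add Fg (u := [::])) => /=; lia.
apply: eq_ssum => u v1 uv1; have := reordering_size uv1; rewrite size_cat => suv.
rewrite -(wt_reordering uv1) wt_cat; case: eqP => su /=; last first.
  by rewrite (g_zero Fg (u := [::])) //=; lia.
by case: eqP => //; lia.
Qed.

Lemma nestedE n r F G H N (w : seq (wel M N)) :
  nested n r F G H w = ssum w (fun t v2 => ssum t (fun u v1 =>
    if (size u == r) && (size v1 == n) then
      (-1) ^+ n *: F N ((wt v1, G N v1) :: (wt u, H N u) :: v2) else 0)).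
Proof.
rewrite -ssum_coassoc; apply: eq_ssum => u v _; case: eqP => //= _.
by rewrite ssum0.
Qed.

(** G and H enter by neighbouring arguments of F. *)
Lemma nested_sym m n r F G H N (w : seq (wel M N)) : oper m.+1 F ->
  size w = (m + n + r).+1 ->
  Z (wt w) (nested n.+1 r.+1 F G H w - (-1) ^+ (n * r) *: nested r.+1 n.+1 F H G w).
Proof.
move=> Fg sw; rewrite !nestedE -[X in _ - X]ssumZ -[X in _ + X]scaleN1r -ssumZ -ssumD.
apply: Z_ssum => t v2 tv2; have := reordering_size tv2; rewrite size_cat => stv.
rewrite [X in X + _]ssum_cocomm -ssumZ -ssumZ -ssumD.
apply: Z_ssum => u v1 uv1; have := reordering_size uv1; rewrite size_cat => suv.
rewrite [X in if X then _ else _]andbC.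
case: eqP => su /=; last by rewrite !scaler0 addr0; exact: Z0.
case: eqP => sv1 /=; last by rewrite !scaler0 addr0; exact: Z0.
rewrite su sv1 !scalerA -mulrA -!exprD -exprS.
rewrite -signr_odd -[X in _ + X *: _]signr_odd.
have -> : odd (n.+1 * r.+1 + n.+1) = odd (n * r + r).
  by rewrite !(oddD, oddM) /=; case: (odd n); case: (odd r).
have -> : odd (n * r + r.+1).+1 = odd (n * r + r).
  by rewrite !(oddS, oddD) /=; case: (odd (n * r)); case: (odd r).
rewrite signr_odd -scalerDr; apply: ZZ.
have wE : wt w = wt u + (wt v1 + wt v2).
  by rewrite -(wt_reordering tv2) wt_cat -(wt_reordering uv1) wt_cat addrA.
apply: Zw (g_skew Fg (wt u, G N u) (wt v1, H N v1) (u := [::]) (v := v2) _).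
  by rewrite /= !wt_cons wE.
by rewrite /=; lia.
Qed.

Definition insert_defect n r F G H N (w : seq (wel M N)) :=
  star r.+1 (star n.+1 F G) H w - star (n + r.+1) F (star r.+1 G H) w.

(** By [star_assoc] the defect is the term with side by side insertions,
    which is symmetric. *)
Lemma pre_lie m n r F G H N (w : seq (wel M N)) : oper m.+1 F ->
  size w = (m + n + r).+1 ->
  Z (wt w) (insert_defect n r F G H w - (-1) ^+ (n * r) *: insert_defect r n F H G w).
Proof.
move=> Fg sw; rewrite /insert_defect.
have s1 : size w = (m + n + r.+1)%N by lia.
have s2 : size w = (m + r + n.+1)%N by lia.
rewrite (star_assoc G H Fg s1) (star_assoc H G Fg s2).
have cancel (a b : lpoly M N) : a + b - a = b by abelian.
by rewrite !cancel; apply: nested_sym Fg sw.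
Qed.

(** The degrees m and n are the numbers of arguments minus one. *)
Definition nrb m n F G : fam M M := fun N w =>
  star n.+1 F G w - (-1) ^+ (m * n) *: star m.+1 G F w.

Lemma star_addl k F F' G N (w : seq (wel M N)) l :
  star k (fun N w => F N w - (-1) ^+ l *: F' N w) G w =
  star k F G w - (-1) ^+ l *: star k F' G w.
Proof.
rewrite /star -ssumZ -[X in _ + X]scaleN1r -ssumZ -ssumD; apply: eq_ssum => u v _.
by case: eqP => // _; rewrite ?scaler0 ?addr0 // scaleN1r.
Qed.

Lemma star_addr m k F G G' N (w : seq (wel M N)) l : oper m.+1 F ->
  size w = (m + k)%N ->
  star k F (fun N w => G N w - (-1) ^+ l *: G' N w) w =
  star k F G w - (-1) ^+ l *: star k F G' w.
Proof.
move=> Fg sw; rewrite /star -ssumZ -[X in _ + X]scaleN1r -ssumZ -ssumD.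
apply: eq_ssum => u v /reordering_size; rewrite size_cat => suv.
case: eqP => [su|_]; last by rewrite !scaler0 addr0.
have uv1 : (size (Nil (wel M N)) + size v).+1 = m.+1 by rewrite /=; lia.
rewrite (g_add Fg (u := [::])) // (g_opp Fg (u := [::])) // (g_sign Fg (u := [::])) //.
by rewrite scaleN1r.
Qed.

(** The commutator of a pre-Lie product is a Lie bracket: the defects of
    associativity cancel by symmetry. *)
Lemma nrb_jacobi m n r F G H : oper m.+1 F -> oper n.+1 G -> oper r.+1 H ->
  eqf (m + n + r).+1 (nrb m (n + r) F (nrb n r G H))
    (fun N w => nrb (m + n) r (nrb m n F G) H w
       + (-1) ^+ (m * n) *: nrb n (m + r) G (nrb m r F H) w).
Proof.
move=> Fg Gg Hg N w sw.
have P1 := pre_lie G H Fg sw.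
have P2 := pre_lie F H Gg (etrans sw (congr1 (fun k => (k + r).+1) (addnC m n))).
have P3 : Z (wt w) (insert_defect m n H F G w - (-1) ^+ (m * n) *: insert_defect n m H G F w).
  by apply: pre_lie Hg _; rewrite sw; lia.
have P := ZB (ZD (ZN P1) (ZZ ((-1) ^+ (m * n)) P2)) (ZZ ((-1) ^+ ((m + n) * r)) P3).
rewrite (_ : _ - _ = - (insert_defect n r F G H w - (-1) ^+ (n * r) *: insert_defect r n F H G w)
  + (-1) ^+ (m * n) *: (insert_defect m r G F H w - (-1) ^+ (m * r) *: insert_defect r m G H F w)
  - (-1) ^+ ((m + n) * r) *: (insert_defect m n H F G w - (-1) ^+ (m * n) *: insert_defect n m H G F w)).
  exact: P.
rewrite /insert_defect /nrb.
rewrite (@star_addr _ _ _ (star r.+1 G H) (star n.+1 H G) _ w _ Fg); last by lia.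
rewrite (@star_addr _ _ _ (star r.+1 F H) (star m.+1 H F) _ w _ Gg); last by lia.
rewrite (@star_addr _ _ _ (star n.+1 F G) (star m.+1 G F) _ w _ Hg); last by lia.
rewrite (@star_addl _ (star r.+1 G H) (star n.+1 H G)) (@star_addl _ (star n.+1 F G) (star m.+1 G F)).
rewrite (@star_addl _ (star r.+1 F H) (star m.+1 H F)).
rewrite !addnS [(r + n)%N]addnC [(r + m)%N]addnC [(n + m)%N]addnC !sgE !(oddM, oddD).
by case: (odd m); case: (odd n); case: (odd r) => /=; abelian.
Qed.

End Star.

(** * Derived brackets *)

Section Congruence.
Context {K : fieldType} {M : lmodType {poly K}}.
Implicit Types (F G H : fam M M) (n k : nat).

Lemma oper_add k F G l : oper k F -> oper k G ->
  oper k (fun n w => F n w + (-1) ^+ l *: G n w).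
Proof.
move=> Fg Gg; split.
- move=> n u v s c x y uv; rewrite (g_lin Fg) // (g_lin Gg) //.
  by rewrite !scalerDr !scalerA [_ * emb c]mulrC addrACA.
- move=> n u v s x uv; apply: ZD; first exact: (g_ses Fg).
  by apply: ZZ; exact: (g_ses Gg).
- move=> n u v p q uv; rewrite addrACA -scalerDr; apply: ZD; first exact: (g_skew Fg).
  by apply: ZZ; exact: (g_skew Gg).
- move=> m n c w sw; rewrite lsubstD lsubstZ (g_nat Fg) // (g_nat Gg) //.
  by rewrite rmorphXn rmorphN1.
Qed.

Lemma oper_ext k F G : (forall n w, F n w = G n w) -> oper k F -> oper k G.
Proof.
move=> FG; have -> // : G = F.
by apply/functional_extensionality_dep => n; apply/funext => w; rewrite FG.
Qed.

Lemma oper_nrb m n F G : oper m.+1 F -> oper n.+1 G -> oper (m + n).+1 (nrb m n F G).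
Proof.
move=> Fg Gg; have g1 := oper_star Fg Gg; have g2 := oper_star Gg Fg.
rewrite addnS in g1; rewrite addnS addnC in g2.
apply: oper_ext (oper_add (m * n).+1 g1 g2) => N w.
by rewrite exprS mulN1r scaleNr.
Qed.

Lemma star_congl m k F F' G : eqf m.+1 F F' -> eqf (m + k) (star k F G) (star k F' G).
Proof.
move=> FF n w sw; rewrite /star -scaleN1r -ssumZ -ssumD; apply: Z_ssum => u v uv.
have := reordering_size uv; rewrite size_cat => suv; case: eqP => [su|_]; last first.
  by rewrite scaler0 addr0; exact: Z0.
rewrite scaleN1r -(wt_reordering uv) wt_cat.
by have := FF n ((wt u, G n u) :: v); rewrite wt_cons; apply => /=; lia.
Qed.

Lemma star_congr m k F G G' : oper m.+1 F -> eqf k G G' ->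
  eqf (m + k) (star k F G) (star k F G').
Proof.
move=> Fg GG n w sw; rewrite /star -scaleN1r -ssumZ -ssumD; apply: Z_ssum => u v uv.
have := reordering_size uv; rewrite size_cat => suv; case: eqP => [su|_]; last first.
  by rewrite scaler0 addr0; exact: Z0.
have uv1 : (size (Nil (wel M n)) + size v).+1 = m.+1 by rewrite /=; lia.
rewrite scaleN1r -(g_opp Fg (u := [::])) // -(g_add Fg (u := [::])) //.
rewrite -(wt_reordering uv) wt_cat.
by have := g_Z (u := [::]) Fg uv1 (GG n u su) erefl; rewrite /= wt_cons.
Qed.

Lemma nrb_congl m n F F' G : oper n.+1 G -> eqf m.+1 F F' ->
  eqf (m + n).+1 (nrb m n F G) (nrb m n F' G).
Proof.
move=> Gg FF N w sw; rewrite /nrb opprD addrACA -opprD -scalerBr.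
apply: ZB; first by apply: (star_congl G FF); rewrite addnS.
by apply: ZZ; apply: (star_congr Gg FF); rewrite addnS addnC.
Qed.

Lemma nrb_sym m n F G N (w : seq (wel M N)) :
  nrb m n F G w = - ((-1) ^+ (m * n) *: nrb n m G F w).
Proof.
rewrite /nrb scalerBr [(n * m)%N]mulnC sgK opprB.
by [].
Qed.

Lemma nrb_congr m n F G G' : oper m.+1 F -> eqf n.+1 G G' ->
  eqf (m + n).+1 (nrb m n F G) (nrb m n F G').
Proof.
move=> Fg GG N w sw; rewrite !(nrb_sym m n) -opprD -scalerBr; apply/ZN/ZZ.
by apply: (nrb_congl Fg GG); rewrite sw addnC.
Qed.

Lemma sgP n l : (-1) ^+ l = ((-1) ^+ l : K)%:P%:MP :> {mpoly {poly K}[n]}.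
Proof. by rewrite !rmorph_sign. Qed.

Lemma star_linl k F F' G c n (w : seq (wel M n)) :
  star k (fun n w => c%:P%:MP *: F n w + F' n w) G w =
  c%:P%:MP *: star k F G w + star k F' G w.
Proof.
rewrite /star -ssum_lin; apply: eq_ssum => u v _.
by case: eqP => // _; rewrite scaler0 addr0.
Qed.

Lemma star_linr m k F G G' c n (w : seq (wel M n)) : oper m.+1 F ->
  size w = (m + k)%N ->
  star k F (fun n w => c%:P%:MP *: G n w + G' n w) w =
  c%:P%:MP *: star k F G w + star k F G' w.
Proof.
move=> Fg sw; rewrite /star -ssum_lin; apply: eq_ssum => u v /reordering_size.
rewrite size_cat => suv; case: eqP => [su|_]; last by rewrite scaler0 addr0.
by rewrite -emb_mpolyC (g_lin Fg (u := [::])) //=; lia.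
Qed.

Lemma nrb_linl m n F F' G c N (w : seq (wel M N)) : oper n.+1 G ->
  size w = (m + n).+1 ->
  nrb m n (fun n w => c%:P%:MP *: F n w + F' n w) G w =
  c%:P%:MP *: nrb m n F G w + nrb m n F' G w.
Proof.
move=> Gg sw; rewrite /nrb star_linl (star_linr _ _ _ Gg); last by rewrite sw addnS addnC.
rewrite !scalerDr !scalerN !scalerA mulrC opprD.
by rewrite -[RHS]addrA -[LHS]addrA; congr (_ + _); rewrite addrCA.
Qed.

Lemma nrb_linr m n F G G' c N (w : seq (wel M N)) : oper m.+1 F ->
  size w = (m + n).+1 ->
  nrb m n F (fun n w => c%:P%:MP *: G n w + G' n w) w =
  c%:P%:MP *: nrb m n F G w + nrb m n F G' w.
Proof.
move=> Fg sw; rewrite !(nrb_sym m n) nrb_linl //; last by rewrite sw addnC.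
by rewrite scalerDr !scalerN !scalerA mulrC opprD.
Qed.

Definition nul : fam M M := fun n w => 0.

Lemma star_0l k G n (w : seq (wel M n)) : star k nul G w = 0.
Proof. by rewrite -[RHS](ssum0 _ w); apply: eq_ssum => u v _; rewrite if_same. Qed.

Lemma oper_nul k : oper k nul.
Proof.
split=> *; rewrite /nul ?scaler0 ?addr0 //; try exact: Z0; exact: lsubst0.
Qed.

Lemma star_0r m k F n (w : seq (wel M n)) : oper m.+1 F -> size w = (m + k)%N ->
  star k F nul w = 0.
Proof.
move=> Fg sw; rewrite -[RHS](ssum0 _ w); apply: eq_ssum => u v /reordering_size.
rewrite size_cat => suv; case: eqP => // su.
by rewrite (g_zero Fg (u := [::])) //=; lia.
Qed.

Lemma nrb_nul_l m n G N (w : seq (wel M N)) : oper n.+1 G -> size w = (m + n).+1 ->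
  nrb m n nul G w = 0.
Proof.
move=> Gg sw; rewrite /nrb star_0l (star_0r Gg) ?scaler0 ?subrr //.
by rewrite sw addnS addnC.
Qed.

Lemma nrb_0l m n G : oper n.+1 G -> eqf (m + n).+1 (nrb m n nul G) nul.
Proof.
by move=> Gg N w sw; rewrite nrb_nul_l // subrr; exact: Z0.
Qed.

Lemma nrb_0r m n F : oper m.+1 F -> eqf (m + n).+1 (nrb m n F nul) nul.
Proof.
move=> Fg N w sw; rewrite /nrb star_0l (star_0r Fg) ?scaler0 ?subrr; first exact: Z0.
by rewrite sw addnS.
Qed.

Lemma famP F F' : (forall n w, F n w = F' n w) -> F = F'.
Proof. by move=> FF; apply/functional_extensionality_dep => n; apply/funext => w. Qed.

Lemma nrb_extl m n F F' G N (w : seq (wel M N)) : (forall n w, F n w = F' n w) ->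
  nrb m n F G w = nrb m n F' G w.
Proof. by move/famP => ->. Qed.

Lemma nrb_signl m n F G l N (w : seq (wel M N)) : oper n.+1 G ->
  size w = (m + n).+1 ->
  nrb m n (fun n w => (-1) ^+ l *: F n w) G w = (-1) ^+ l *: nrb m n F G w.
Proof.
move=> Gg sw; rewrite sgP -[RHS]addr0 -(nrb_nul_l Gg sw) -nrb_linl //.
by apply: nrb_extl => k v; rewrite sgP addr0.
Qed.

Lemma nrb_signr m n F G l N (w : seq (wel M N)) : oper m.+1 F ->
  size w = (m + n).+1 ->
  nrb m n F (fun n w => (-1) ^+ l *: G n w) w = (-1) ^+ l *: nrb m n F G w.
Proof.
move=> Fg sw; rewrite !(nrb_sym m n) nrb_signl //; last by rewrite sw addnC.
by rewrite scalerN !scalerA mulrC.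
Qed.

End Congruence.

Section Derived.
Context {K : fieldType} {M : lmodType {poly K}}.
Hypothesis two_neq0 : 2%:R != 0 :> K.
Implicit Types (F G H : fam M M) (p q r : nat).

Lemma eqf_half k F : eqf k (fun n w => F n w + F n w) nul -> eqf k F nul.
Proof.
move=> FF n w sw; rewrite subr0; have := ZZ (2%:R^-1)%:P%:MP (FF n w sw).
have -> : F n w + F n w = (2%:R : K)%:P%:MP *: F n w.
  by rewrite !rmorph_nat scaler_nat.
by rewrite subr0 scalerA -rmorphM -rmorphM mulVf // scale1r.
Qed.

Section Bracket.
Context {nu : fam M M} (nug : oper 2 nu).

(** The derived bracket [[nu, F], G]. *)
Definition dbr p q F G := nrb p.+1 q (nrb 1 p nu F) G.

(** [nu, [nu, F]] is half of [[nu, nu], F]. *)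
Lemma nrb_sq0 p F : eqf 3 (nrb 1 1 nu nu) nul -> oper p.+1 F ->
  eqf p.+3 (nrb 1 p.+1 nu (nrb 1 p nu F)) nul.
Proof.
move=> nu2 Fg; apply: eqf_half => n w sw.
have J := nrb_jacobi nug nug Fg sw.
have := nrb_congl Fg nu2 sw.
have := nrb_0l (m := 2) Fg sw.
rewrite !subr0 => h0 h1.
have := ZD (ZD J h1) h0; rewrite expr1 scaleN1r -![(1 + _)%N]/(_.+1).
set X := nrb 1 p.+1 nu _ _; set A := nrb 2 p _ _ _; set C := nrb 2 p _ _ _.
by rewrite (_ : _ - _ + _ + _ = X + X) //; abelian.
Qed.

(** The Jacobi identity for nu, F and G, where F and G commute. *)
Lemma dbr_sym p q F G : oper p.+1 F -> oper q.+1 G ->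
  (forall n w, size w = (p + q).+1 -> nrb p q F G w = 0 :> lpoly M n) ->
  eqf (p + q).+2 (dbr p q F G) (fun n w => (-1) ^+ (p * q) *: dbr q p G F w).
Proof.
move=> Fg Gg FG0 n w sw; have sw' : size w = (1 + p + q).+1 by rewrite sw.
have J := nrb_jacobi nug Fg Gg sw'.
have h0 : Z (wt w) (nrb 1 (p + q) nu (nrb p q F G) w).
  have FG : eqf (p + q).+1 (nrb p q F G) nul.
    by move=> N v sv; rewrite FG0 // subrr; exact: Z0.
  have := ZD (nrb_congr nug FG sw) (nrb_0r nug sw).
  by rewrite addrA subrK subr0.
have := ZB h0 J; rewrite /dbr (nrb_sym p (1 + q)) -![(1 + _)%N]/(_.+1).
set X := nrb p.+1 q _ _ _; set Y := nrb q.+1 p _ _ _; set W := nrb 1 _ _ _ _.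
rewrite mul1n mulnS exprD scalerN -!scalerA sgK.
rewrite (_ : _ - _ = X - (-1) ^+ (p * q) *: Y) //; abelian.
Qed.

(** [mu, -] is a derivation of the bracket and anticommutes with [nu, -]. *)
Lemma dbr_der mu p q F G : oper 2 mu -> eqf 3 (nrb 1 1 mu nu) nul ->
  oper p.+1 F -> oper q.+1 G ->
  eqf (p + q).+3 (nrb 1 (p + q).+1 mu (dbr p q F G))
    (fun n w => - dbr p.+1 q (nrb 1 p mu F) G w
                + (-1) ^+ p.+1 *: dbr p q.+1 F (nrb 1 q mu G) w).
Proof.
move=> mug munu Fg Gg n w sw; have nuFg := oper_nrb nug Fg.
have J := nrb_jacobi mug nuFg Gg (w := w) sw.
have J2 : eqf p.+3 (nrb 1 p.+1 mu (nrb 1 p nu F)) (fun n w => - nrb 1 p.+1 nu (nrb 1 p mu F) w).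
  move=> N v sv; have := nrb_jacobi mug nug Fg sv.
  have := nrb_congl Fg munu sv; have := nrb_0l (m := 2) Fg sv.
  rewrite !subr0 opprK => h0 h1 J'; have := ZD (ZD J' h1) h0.
  rewrite expr1 scaleN1r -![(1 + _)%N]/(_.+1).
  set X := nrb 1 p.+1 mu _ _; set A := nrb 2 p _ _ _; set C := nrb 2 p _ _ _; set Y := nrb 1 p.+1 nu _ _.
  by rewrite (_ : _ - _ + _ + _ = X + Y) //; abelian.
have := nrb_congl Gg J2 sw.
have -> : nrb p.+2 q (fun n w => - nrb 1 p.+1 nu (nrb 1 p mu F) w) G w =
    - dbr p.+1 q (nrb 1 p mu F) G w.
  rewrite -scaleN1r -[-1]expr1 -nrb_signl //.
  by apply: nrb_extl => N v; rewrite expr1 scaleN1r.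
move=> h1; have := ZD J h1; rewrite /dbr mul1n -![(1 + _)%N]/(_.+1).
set A := nrb 1 _ mu _ _; set C := nrb p.+2 q _ _ _; set B := nrb p.+2 q _ _ _.
set D := _ *: nrb p.+1 q.+1 _ _ _.
by rewrite (_ : _ - _ + _ = A - (- B + D)) //; abelian.
Qed.

(** As [nu, -] is a derivation of square zero, it sends the derived bracket
    of F and G to the bracket of [nu, F] and [nu, G], up to sign; the
    identity is the Jacobi identity for [nu, F], [nu, G] and H. *)
Lemma dbr_jacobi p q r F G H : eqf 3 (nrb 1 1 nu nu) nul ->
  oper p.+1 F -> oper q.+1 G -> oper r.+1 H ->
  eqf (p + q + r).+3 (dbr p (q + r).+1 F (dbr q r G H))
    (fun n w => (-1) ^+ p.+1 *: dbr (p + q).+1 r (dbr p q F G) H w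
      + (-1) ^+ (p.+1 * q.+1) *: dbr q (p + r).+1 G (dbr p r F H) w).
Proof.
move=> nu2 Fg Gg Hg n w sw; have [nuFg nuGg] := (oper_nrb nug Fg, oper_nrb nug Gg).
have sw' : size w = (p.+1 + q.+1 + r).+1 by rewrite sw addSn addnS.
have J := nrb_jacobi nuFg nuGg Hg sw'.
have E : eqf (p + q).+3 (nrb p.+1 q.+1 (nrb 1 p nu F) (nrb 1 q nu G))
    (fun n w => (-1) ^+ p.+1 *: nrb 1 (p + q).+1 nu (dbr p q F G) w).
  move=> N v sv; have J' := nrb_jacobi nug nuFg Gg sv.
  have := nrb_congl Gg (nrb_sq0 nu2 Fg) sv; have := nrb_0l (m := p.+2) Gg sv.
  rewrite !subr0 => h0 h1; have := ZD (ZD J' h1) h0.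
  rewrite mul1n -![(1 + _)%N]/(_.+1) -/(dbr p q F G).
  set X := nrb p.+1 q.+1 _ _ _; set Y := nrb 1 _ _ _ _.
  set A := nrb p.+2 _ _ _ _; set C := nrb p.+2 _ _ _ _ => h.
  have {}h : Z (wt v) (Y - (-1) ^+ p.+1 *: X).
    by move: h; rewrite (_ : _ - _ + _ + _ = Y - (-1) ^+ p.+1 *: X) //; abelian.
  by have := ZN (ZZ ((-1) ^+ p.+1) h); rewrite scalerBr sgK opprB.
have sw2 : size w = ((p + q).+2 + r).+1 by rewrite sw.
have := nrb_congl Hg E sw2; rewrite nrb_signl // -/(dbr (p + q).+1 r (dbr p q F G) H) => h1.
rewrite [(1 + p + (1 + q))%N]addnS in J.
set X := dbr p _ F _ w; set S := _ *: dbr (p + q).+1 _ _ _ _; set V := _ *: dbr q _ _ _ _.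
pose W := nrb (p + q).+2 r (nrb p.+1 q.+1 (nrb 1 p nu F) (nrb 1 q nu G)) H w.
have h : Z (wt w) (X - (W + V) + (W - S)) := ZD J h1.
by move: h; rewrite (_ : _ + _ = X - (S + V)) //; abelian.
Qed.
End Bracket.
End Derived.

(** * Unshuffles and splittings *)

Section Unshuffles.
Context {R : comNzRingType}.
Implicit Types (V : lmodType R) (bs : seq nat).

(** The iterated coproduct, in the degrees bs. *)
Fixpoint bsum V T bs (w : seq T) (Q : seq (seq T) -> V) : V :=
  if bs is b :: bs' then
    ssum w (fun u v => if size u == b then bsum bs' v (fun vs => Q (u :: vs)) else 0)
  else if nilp w then Q [::] else 0.

(** The sum over the nonempty blocks, as possible places of a new least element z:
   the position of z, the sizes of the blocks without z, and the map adding z. *)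
Fixpoint hsum V T (z : T) bs
    (F : nat -> seq nat -> (seq (seq T) -> seq (seq T)) -> V) : V :=
  if bs is b :: bs' then
    (if b is b'.+1 then
       F 0%N (b' :: bs') (fun vs => (z :: head [::] vs) :: behead vs) else 0)
    + hsum z bs' (fun o cs g =>
        F (b + o)%N (b :: cs) (fun vs => head [::] vs :: g (behead vs)))
  else 0.

Lemma eq_hsum V T (z : T) bs F F' :
  (forall o cs g, (sumn cs).+1 = sumn bs -> (o < sumn bs)%N -> F o cs g = F' o cs g) ->
  hsum z bs F = hsum z bs F' :> V.
Proof.
elim: bs F F' => [|b bs IHbs] F F' FF //=; congr (_ + _).
  by case: b FF => //= b FF; apply: FF.
by apply: IHbs => o cs g scs lt_o; apply: FF => /=; lia.
Qed.

Lemma hsum_sum V T (z : T) bs I (r : seq I) (P : pred I) F :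
  \sum_(i <- r | P i) hsum z bs (F i) =
  hsum z bs (fun o cs g => \sum_(i <- r | P i) F i o cs g) :> V.
Proof.
elim: bs F => [|b bs IHbs] F /=; first by rewrite big1.
by rewrite big_split IHbs; case: b => [|b] //=; rewrite big1.
Qed.

Lemma hsum0 V T (z : T) bs : hsum z bs (fun _ _ _ => 0) = 0 :> V.
Proof. by elim: bs => //= b bs ->; case: b; rewrite addr0. Qed.

Lemma hsum_ssum V T U (z : T) bs (w : seq U) F :
  ssum w (fun u v => hsum z bs (F u v)) =
  hsum z bs (fun o cs g => ssum w (fun u v => F u v o cs g)) :> V.
Proof.
elim: bs F => [|b bs IHbs] F /=; first by rewrite ssum0.
by rewrite ssumD IHbs; case: b => [|b] //=; rewrite ssum0.
Qed.

Lemma hsumZ V T (z : T) bs p F :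
  p *: hsum z bs F = hsum z bs (fun o cs g => p *: F o cs g) :> V.
Proof.
elim: bs F => [|b bs IHbs] F /=; first by rewrite scaler0.
by rewrite scalerDr IHbs; case: b => //=; rewrite scaler0.
Qed.

Lemma bsum_cons V T bs (z : T) w Q :
  bsum bs (z :: w) Q =
  hsum z bs (fun o cs g => (-1) ^+ o *: bsum cs w (fun vs => Q (g vs))) :> V.
Proof.
elim: bs w Q => [|b bs IHbs] w Q //=; congr (_ + _).
  case: b => [|b]; first by rewrite -[RHS](ssum0 V w).
  by rewrite scale1r /=; apply: eq_ssum => u v _; rewrite eqSS.
transitivity (ssum w (fun u v => hsum z bs (fun o cs g => (-1) ^+ (b + o) *:
    if size u == b then bsum cs v (fun vs => Q (u :: g vs)) else 0))).
  apply: eq_ssum => u v _; case: eqP => [->|_]; last first.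
    by rewrite scaler0 -[LHS](hsum0 _ z bs); apply: eq_hsum => *; rewrite scaler0.
  rewrite IHbs hsumZ; apply: eq_hsum => o cs g _ _.
  by rewrite scalerA -exprD.
rewrite hsum_ssum; apply: eq_hsum => o cs g _ _.
by rewrite ssumZ.
Qed.

Lemma bsum_map V T T' (f : T -> T') bs w Q :
  bsum bs (map f w) Q = bsum bs w (fun vs => Q (map (map f) vs)) :> V.
Proof.
elim: bs w Q => [|b bs IHbs] w Q /=; first by case: w.
by rewrite ssum_map; apply: eq_ssum => u v _; rewrite size_map IHbs.
Qed.

Definition ins T i (z : T) w := take i w ++ z :: drop i w.

Lemma take_ins T i b (z : T) w : (i <= b <= size w)%N ->
  take b.+1 (ins i z w) = ins i z (take b w).
Proof.
move=> /andP[le_ib le_bw]; rewrite /ins take_cat size_takel ?(leq_trans le_ib) //.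
rewrite ltnNge leqW //= subSn //= take_takel //; congr (_ ++ _ :: _).
by rewrite take_drop subnK.
Qed.

Lemma drop_ins T i b (z : T) w : (i <= b <= size w)%N ->
  drop b.+1 (ins i z w) = drop b w.
Proof.
move=> /andP[le_ib le_bw]; rewrite /ins drop_cat size_takel ?(leq_trans le_ib) //.
by rewrite ltnNge leqW //= subSn //= drop_drop subnK.
Qed.

Lemma take_insl T i b (z : T) w : (b + i <= size w)%N ->
  take b (ins (b + i) z w) = take b w.
Proof.
by move=> le_w; rewrite /ins takel_cat ?size_takel ?leq_addr // take_takel ?leq_addr.
Qed.

Lemma drop_insl T i b (z : T) w : (b + i <= size w)%N ->
  drop b (ins (b + i) z w) = ins i z (drop b w).
Proof.
move=> le_w; rewrite /ins drop_cat size_takel // take_drop drop_drop [(i + b)%N]addnC.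
case: ltnP => // le_i; have -> : i = 0%N by lia.
by rewrite ?addn0 ?subnn /= [drop b (take b w)]drop_oversize // size_take_min geq_minl.
Qed.

Lemma sorted_ins T (r : rel T) i (z : T) w : (i <= size w)%N ->
  all (r z) w -> all (fun y => ~~ r y z) w ->
  sorted r (ins i z w) = (i == 0%N) && sorted r w.
Proof.
move=> le_iw zw wz; case: i le_iw => [_|i lt_iw] /=.
  by rewrite /ins take0 drop0 /= path_min_sorted.
apply/negbTE/(sortedP z) => /(_ i).
rewrite /ins size_cat /= size_takel // size_drop => /(_ _); rewrite addnS ltnS leq_addr => /(_ isT).
rewrite !nth_cat size_takel // ltnSn ltnn subnn /= nth_take //.
by apply/negP; move/(all_nthP z): wz; apply.
Qed.

(** An insertion of the least element z keeps the blocks increasing only when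
    z is put at the head of a block. *)
Lemma hsum_ins V T (r : rel T) (z : T) bs w (F : nat -> seq (seq T) -> V) :
  (size w).+1 = sumn bs \/ sumn bs = 0%N ->
  all (r z) w -> all (fun y => ~~ r y z) w ->
  \sum_(i < sumn bs) (if all (sorted r) (reshape bs (ins i z w))
                      then F i (reshape bs (ins i z w)) else 0) =
  hsum z bs (fun o cs g => if all (sorted r) (reshape cs w)
                           then F o (g (reshape cs w)) else 0).
Proof.
have all_sub P (s t : seq T) : all P (s ++ t) -> all P s /\ all P t.
  by rewrite all_cat => /andP.
elim: bs w F => [|b bs IHbs] w F /= sw zw wz; first by rewrite big_ord0.
rewrite big_split_ord /=; congr (_ + _).
  case: b sw => [|b] sw; first by rewrite big_ord0.
  have {}sw : size w = (b + sumn bs)%N by lia.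
  have stb : size (take b w) = b by rewrite size_takel // sw leq_addr.
  have zt : all (r z) (take b w).
    by move: zw; rewrite -{1}(cat_take_drop b w) => /all_sub [].
  have wt : all (fun y => ~~ r y z) (take b w).
    by move: wz; rewrite -{1}(cat_take_drop b w) => /all_sub [].
  have E (i : 'I_b.+1) : (i <= b <= size w)%N by rewrite -ltnS ltn_ord sw leq_addr.
  have si (i : 'I_b.+1) : sorted r (ins i z (take b w)) = (i == ord0) && sorted r (take b w).
    by rewrite sorted_ins // stb -ltnS.
  rewrite big_ord_recl big1 ?addr0 => [|i _].
    by rewrite take_ins // drop_ins // si eqxx /= /ins take0 drop0.
  by rewrite take_ins // drop_ins // si.
transitivity (\sum_(i < sumn bs) if sorted r (take b w) && all (sorted r) (reshape bs (ins i z (drop b w)))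
    then F (b + i)%N (take b w :: reshape bs (ins i z (drop b w))) else 0).
  apply: eq_bigr => i _; have lt_i := ltn_ord i.
  have sw' : (b + i <= size w)%N by lia.
  by rewrite take_insl // drop_insl.
have zd : all (r z) (drop b w).
  by move: zw; rewrite -{1}(cat_take_drop b w) => /all_sub [].
have wd : all (fun y => ~~ r y z) (drop b w).
  by move: wz; rewrite -{1}(cat_take_drop b w) => /all_sub [].
have sd : (size (drop b w)).+1 = sumn bs \/ sumn bs = 0%N by rewrite size_drop; lia.
case: (sorted r (take b w)); last by rewrite big1 // -[LHS](hsum0 _ z bs).
by rewrite (IHbs _ (fun i vs => F (b + i)%N (take b w :: vs)) sd zd wd).
Qed.

Lemma lift_perm_reindex V k (i : 'I_k.+1) (F : 'S_k.+1 -> V) :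
  \sum_(s : 'S_k.+1 | s i == ord0) F s = \sum_(s : 'S_k) F (lift_perm i ord0 s).
Proof.
rewrite (reindex (lift_perm i ord0)); last first.
  pose ulsf i (s : 'S_k.+1) l := odflt l (unlift (s i) (s (lift i l))).
  have ulsfK i' (s : 'S_k.+1) l : lift (s i') (ulsf i' s l) = s (lift i' l).
    rewrite /ulsf; have := neq_lift i' l.
    by rewrite -(can_eq (permK s)) => /unlift_some[] ? ? ->.
  have inj_ulsf : injective (ulsf i _).
    move=> s; apply: can_inj (ulsf (s i) s^-1%g) _ => l.
    by rewrite {1}/ulsf ulsfK !permK liftK.
  exists (fun s => perm (inj_ulsf s)) => [s _ | s].
    by apply/permP=> l; rewrite permE /ulsf lift_perm_lift lift_perm_id liftK.
  move/(s _ =P _) => si0; apply/permP=> l.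
  case: (unliftP i l) => [l'|] ->; rewrite ?lift_perm_id //.
  by rewrite lift_perm_lift -si0 permE ulsfK.
by apply: eq_bigl => s; rewrite lift_perm_id eqxx.
Qed.

Definition word k (s : 'S_k) : seq 'I_k := [seq s i | i <- enum 'I_k].

Lemma size_word k (s : 'S_k) : size (word s) = k.
Proof. by rewrite /word size_map size_enum_ord. Qed.

Lemma nth_ins T (x0 z : T) i m w : (i <= size w)%N ->
  nth x0 (ins i z w) (bump i m) = nth x0 w m.
Proof.
move=> le_i; rewrite /ins nth_cat size_takel // /bump; case: (leqP i m) => le_im.
  rewrite add1n ltnNge leqW //= subSn //= nth_drop subnKC //.
by rewrite add0n le_im nth_take.
Qed.

Lemma word_lift_perm k (i : 'I_k.+1) (s : 'S_k) :
  word (lift_perm i ord0 s) = ins i ord0 [seq lift ord0 j | j <- word s].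
Proof.
have sw : size [seq lift ord0 j | j <- word s] = k by rewrite size_map size_word.
have le_i : (i <= k)%N by rewrite -ltnS.
apply: (@eq_from_nth _ ord0) => [|l].
  by rewrite size_word /ins size_cat /= size_takel ?size_drop sw //; lia.
rewrite size_word => lt_l; pose l' := Ordinal lt_l.
rewrite (nth_map ord0) ?size_enum_ord // -[l]/(val l') nth_ord_enum.
case: (unliftP i l') => [m|] ->; last first.
  by rewrite lift_perm_id /ins nth_cat size_takel ?sw // ltnn subnn.
rewrite lift_perm_lift [val _]/= nth_ins ?sw //.
by rewrite /word -map_comp (nth_map (m : 'I_k)) ?size_enum_ord //= nth_ord_enum.
Qed.

Lemma unshuffleE k bs (s : 'S_k) :
  unshuffle bs s = all (sorted (fun i j : 'I_k => (i < j)%N)) (reshape bs (word s)).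
Proof.
rewrite /unshuffle (_ : [seq (s i : nat) | i <- enum 'I_k] = [seq val i | i <- word s]).
  rewrite -map_reshape all_map; apply: eq_all => w /=.
  by rewrite sorted_map.
by rewrite /word -[RHS]map_comp.
Qed.

(** Induction on k: the least index heads a block of an unshuffle, and its
    removal leaves an unshuffle of the other indices; splittings of a list
    obey the same recursion ([bsum_cons]). *)
Lemma sum_unshuffle V k bs (Q : seq (seq 'I_k) -> V) : sumn bs = k ->
  \sum_(s : 'S_k | unshuffle bs s) (-1) ^+ s *: Q (reshape bs (word s)) =
  bsum bs (enum 'I_k) Q.
Proof.
elim: k bs Q => [|k IHk] bs Q sbs.
  have e0 : enum 'I_0 = [::] by apply: size0nil; rewrite size_enum_ord.
  have -> : bsum bs (enum 'I_0) Q = Q (reshape bs [::]).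
    rewrite e0; elim: bs Q sbs => [|b bs IHbs] Q //= /eqP.
    by rewrite addn_eq0 => /andP[/eqP -> /eqP sbs]; rewrite eqxx IHbs.
  rewrite (big_pred1 (1 : 'S_0)%g) => [|s].
    by rewrite odd_perm1 scale1r /word e0.
  rewrite /unshuffle e0 /=; have -> : s = 1%g by apply/permP => -[].
  by rewrite eqxx; elim: (bs) => //= b bs' ->.
rewrite enum_ordSl bsum_cons.
transitivity (\sum_(i < k.+1) \sum_(s : 'S_k)
   if unshuffle bs (lift_perm i ord0 s) then
     (-1) ^+ (i + s) *: Q (reshape bs (word (lift_perm i ord0 s))) else 0).
  rewrite [LHS](partition_big (fun s : 'S_k.+1 => (s^-1)%g ord0) xpredT) //=.
  apply: eq_bigr => i _; rewrite big_mkcondl (eq_bigl (fun s : 'S_k.+1 => s i == ord0)) => [|s].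
    rewrite lift_perm_reindex; apply: eq_bigr => s _; case: ifP => // _; congr (_ *: _).
    by rewrite odd_lift_perm addbF signr_addb signr_odd exprD.
  by rewrite (can2_eq (permKV s) (permK s)) eq_sym.
rewrite exchange_big /=.
transitivity (\sum_(s : 'S_k) hsum ord0 bs (fun o cs g => if unshuffle cs s then
    (-1) ^+ o *: ((-1) ^+ s *: Q (g [seq [seq lift ord0 i | i <- v] | v <- reshape cs (word s)]))
    else 0)).
  apply: eq_bigr => s _; pose r := fun i j : 'I_k.+1 => (i < j)%N.
  pose w := [seq lift ord0 j | j <- word s].
  have := @hsum_ins V _ r ord0 bs w (fun i vs => (-1) ^+ (i + s) *: Q vs).
  rewrite sbs -(big_mkord xpredT (fun i => if all (sorted r) (reshape bs (ins i ord0 w))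
     then (-1) ^+ (i + s) *: Q (reshape bs (ins i ord0 w)) else 0)) big_mkord => h.
  under eq_bigr => i _ do rewrite unshuffleE word_lift_perm -/w -/r.
  rewrite {}h.
  - apply: eq_hsum => o cs g _ _; rewrite /w -map_reshape all_map unshuffleE.
    rewrite (@eq_all _ _ (sorted (fun i j : 'I_k => (i < j)%N))).
      by case: all => //; rewrite scalerA -exprD.
    by move=> v /=; rewrite sorted_map.
  - by left; rewrite /w size_map size_word.
  - by apply/allP => j /mapP[l _ ->].
  - by apply/allP => j /mapP[l _ ->].
rewrite hsum_sum; apply: eq_hsum => o cs g scs _.
rewrite bsum_map -(IHk cs (fun vs => Q (g (map (map (lift ord0)) vs)))); last by lia.
by rewrite scaler_sumr [RHS]big_mkcond.
Qed.

End Unshuffles.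

(** * The bracket of cochains as a bracket of operations *)

Section IndexSums.
Context {R : comNzRingType} {V : lmodType R}.

Lemma ssum_full T (w : seq T) (H : seq T -> V) :
  ssum w (fun u v => if nilp v then H u else 0) = H w.
Proof.
elim: w H => [|x w IHw] H //=; rewrite IHw -[RHS]addr0 -[in RHS](ssum0 V w).
by congr (_ + _); apply: eq_ssum => u v _; rewrite scaler0.
Qed.

Lemma bsum1 T (w : seq T) (Q : seq (seq T) -> V) m : size w = m ->
  bsum [:: m] w Q = Q [:: w].
Proof.
move=> sw; rewrite -[RHS](ssum_full w (fun u => Q [:: u])).
apply: eq_ssum => u v /reordering_size; rewrite size_cat sw => suv /=.
by case: v suv => [|y v] /= suv; rewrite ?if_same // -suv addn0 eqxx.
Qed.

Lemma bsum2 T (w : seq T) (Q : seq (seq T) -> V) m n : size w = (n + m)%N ->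
  bsum [:: n; m] w Q = ssum w (fun u v => if size u == n then Q [:: u; v] else 0).
Proof.
move=> sw; apply: eq_ssum => u v /reordering_size; rewrite size_cat sw => suv.
case: eqP => // su; apply: (@bsum1 _ v (fun vs => Q (u :: vs))); lia.
Qed.

Lemma bsum3 T (w : seq T) (Q : seq (seq T) -> V) m n l : size w = (n + (l + m))%N ->
  bsum [:: n; l; m] w Q = ssum w (fun u v => if size u == n then
    ssum v (fun v1 v2 => if size v1 == l then Q [:: u; v1; v2] else 0) else 0).
Proof.
move=> sw; apply: eq_ssum => u v /reordering_size; rewrite size_cat sw => suv.
case: eqP => // su; apply: (@bsum2 _ v (fun vs => Q (u :: vs))); lia.
Qed.

Lemma ssum_pick1 (T : eqType) (w : seq T) (Q : seq T -> seq T -> V) : uniq w ->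
  ssum w (fun u v => if size u == 1%N then Q u v else 0) =
  \sum_(i <- w) (-1) ^+ index i w *: Q [:: i] [seq k <- w | k != i].
Proof.
elim: w Q => [|x w IHw] Q /=; first by rewrite big_nil.
case/andP=> xNw uw; rewrite big_cons eqxx expr0 scale1r /=; congr (_ + _).
  transitivity (ssum w (fun u v => if size u == 0%N then Q (x :: u) v else 0)) => //.
  rewrite ssum_size0; congr Q; apply/esym/all_filterP/allP => k kw /=.
  by apply: contraNneq xNw => <-.
transitivity (ssum w (fun u v => if size u == 1%N then - Q u (x :: v) else 0)).
  apply: eq_ssum => u v _; case: eqP => [->|]; last by rewrite scaler0.
  by rewrite expr1 scaleN1r.
rewrite (IHw (fun u v => - Q u (x :: v))) //; rewrite [LHS]big_seq [RHS]big_seq.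
apply: eq_bigr => i iw; have xi : x != i by apply: contraNneq xNw => ->.
by rewrite (negPf xi) /= exprS mulN1r scaleNr scalerN.
Qed.

Lemma ssum_pick2 (T : eqType) (w : seq T) (Q : seq T -> seq T -> V) : uniq w ->
  ssum w (fun u v => if size u == 2%N then Q u v else 0) =
  \sum_(i <- w) \sum_(j <- w | (index i w < index j w)%N)
    (-1) ^+ (index i w + index j w).-1 *:
    Q [:: i; j] [seq k <- w | (k != i) && (k != j)].
Proof.
elim: w Q => [|x w IHw] Q /=; first by rewrite big_nil.
case/andP=> xNw uw; rewrite big_cons eqxx /=; congr (_ + _).
  transitivity (ssum w (fun u v => if size u == 1%N then Q (x :: u) v else 0)) => //.
  rewrite (ssum_pick1 (fun u v => Q (x :: u) v)) // big_cons eqxx /= [RHS]big_mkcond.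
  rewrite [LHS]big_seq [RHS]big_seq; apply: eq_bigr => j jw.
  have xj : x != j by apply: contraNneq xNw => ->.
  rewrite (negPf xj) add0n /=; congr (_ *: Q _ _); apply/eq_in_filter => k kw.
  by have -> : k != x by apply: contraNneq xNw => <-.
transitivity (ssum w (fun u v => if size u == 2%N then Q u (x :: v) else 0)).
  apply: eq_ssum => u v _; case: eqP => [->|]; last by rewrite scaler0.
  by rewrite sqrrN expr1n scale1r.
rewrite (IHw (fun u v => Q u (x :: v))) //; rewrite [LHS]big_seq [RHS]big_seq.
apply: eq_bigr => i iw; have xi : x != i by apply: contraNneq xNw => ->.
rewrite (negPf xi) big_cons eqxx ltn0.
rewrite [LHS]big_mkcond [RHS]big_mkcond [LHS]big_seq [RHS]big_seq.
apply: eq_bigr => j jw; have xj : x != j by apply: contraNneq xNw => ->.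
rewrite (negPf xj) /= ltnS; case: ltnP => // lt_ij; congr (_ *: _).
case: (index j w) lt_ij => // l _; rewrite !addnS /= !exprS.
by rewrite mulrA mulrNN !mul1r.
Qed.

Lemma index_enum_ordE n (i : 'I_n) : index i (enum 'I_n) = i.
Proof. by rewrite -[i in index i _](nth_ord_enum i) index_uniq ?enum_uniq ?size_enum_ord. Qed.

End IndexSums.

Section CochainBracket.
Context {K : fieldType}.
Implicit Types (M N : lmodType {poly K}) (k m n : nat).

Lemma ev_cons M N k (f : cochain M N k.+1) n t y (v : seq ({mpoly K[n]} * M)) :
  is_cochain f -> size v = k ->
  ev f ((t, y) :: map (@wconst _ M n) v) =
  capp1 f (emb t :: [seq emb z.1 | z <- v]) y [seq z.2 | z <- v].
Proof.
move=> fc sv; rewrite /ev /capp1 /=; apply: eq_lext => x.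
rewrite /wts -!map_comp.
have -> : [seq (snd \o @wconst _ M n) i | i <- v] = [seq lconst n z | z <- [seq t.2 | t <- v]].
  by rewrite -map_comp.
rewrite mext_const // size_map sv.
exact/mlin_cons/mlin_capp.
Qed.

Definition gn M k (x : 'I_k -> M) (i : 'I_k) : {mpoly K[k]} * M := ('X_i, x i).

Lemma genE M k (x : 'I_k -> M) : gen x = map (@wconst _ M k) (map (gn x) (enum 'I_k)).
Proof. by rewrite -map_comp. Qed.

Lemma gn_emb M k (x : 'I_k -> M) u : [seq emb z.1 | z <- map (gn x) u] = map (@lam K k) u.
Proof. by rewrite -map_comp; apply: eq_map => i /=; exact: embX. Qed.

Lemma gn_snd M k (x : 'I_k -> M) u : [seq z.2 | z <- map (gn x) u] = map x u.
Proof. by rewrite -map_comp. Qed.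

Lemma wt_gn M k (x : 'I_k -> M) u :
  emb (wt (map (@wconst _ M k) (map (gn x) u))) = \sum_(t <- map (@lam K k) u) t.
Proof.
rewrite -sum_wts; congr (\sum_(t <- _) t); rewrite -(gn_emb x) /wts.
by rewrite -!map_comp.
Qed.

(** The entries of the generic list are the indices, and unshuffles are its
    splittings. *)
Lemma nr_starE M m n k (f : cochain M M m.+1) (g : cochain M M n) : k = (m + n)%N ->
  is_cochain f -> is_cochain g ->
  nr_star f g = reify (star n (ev f) (ev g)) :> cochain M M k.
Proof.
move=> ->{k} fc gc; apply/funext => x; rewrite /nr_star /reify; congr ldag.
rewrite genE /star ssum_map ssum_map.
pose Q (vs : seq (seq 'I_(m + n))) := let u := nth [::] vs 0 in let v := nth [::] vs 1 in
  capp1 f (\sum_(t <- map (@lam K _) u) t :: map (@lam K _) v)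
    (capp g (map (@lam K _) u) (map x u)) (map x v).
transitivity (\sum_(s : 'S_(m + n) | unshuffle [:: n; m] s)
    (-1) ^+ s *: Q (reshape [:: n; m] (word s))).
  apply: eq_bigr => s _; congr (_ *: _).
  have -> : reshape [:: n; m] (word s) = [:: take n (word s); drop n (word s)].
    by rewrite /= [take m _]take_oversize // size_drop size_word addnK.
  rewrite /Q /plams /pargs /= !map_take !map_drop -!map_comp.
  by [].
rewrite sum_unshuffle; last by rewrite /= addn0 addnC.
rewrite bsum2; last by rewrite size_enum_ord addnC.
apply: eq_ssum => u v /reordering_size; rewrite size_cat size_enum_ord !size_map => suv.
case: eqP => // su; rewrite /Q /= ev_cons ?size_map //; last first.
  by apply/eqP; rewrite -(eqn_add2l (size u)) suv su addnC.
by rewrite wt_gn !gn_emb !gn_snd ev_const ?size_map // gn_emb gn_snd.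
Qed.

Lemma nr_bracketE M m n (f : cochain M M m.+1) (g : cochain M M n.+1) :
  is_cochain f -> is_cochain g ->
  nr_bracket f g = reify (nrb m n (ev f) (ev g)) :> cochain M M (m.+1 + n.+1).-1.
Proof.
move=> fc gc; rewrite /nr_bracket (nr_starE _ fc gc) //.
rewrite (@nr_starE _ _ _ (m.+1 + n.+1).-1 _ _ _ gc fc); last by lia.
apply/funext => x; rewrite /reify /nrb /ldag lsubstD -[in RHS]scaleN1r !lsubstZ.
rewrite rmorphN1 rmorphXn rmorphN1 scaleN1r; congr (_ - _).
by rewrite -[LHS]/(((-1) ^+ (m * n) : K)%:P%:MP *: _) -sgP.
Qed.

Lemma ev_lin M N k (f g : cochain M N k) c n (w : seq (wel M n)) :
  ev (c *: f + g) w = c%:P%:MP *: ev f w + ev g w.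
Proof.
rewrite /ev -mext_lin; apply: mext_eq => xs _; rewrite /capp.
set z := fun j : 'I_k => _; have -> : (c *: f + g : cochain M N k) z = c%:P%:MP *: f z + g z by [].
by rewrite lsubstD lsubstZ msubC.
Qed.

Lemma is_cochain0 M N k : is_cochain (0 : cochain M N k).
Proof.
split=> //.
- by move=> i c y y' x; rewrite scaler0 addr0.
- by move=> i x; rewrite scaler0.
- by move=> s x; rewrite lsubst0 scaler0.
Qed.

Lemma is_cochain_lin M N k c (f g : cochain M N k) :
  is_cochain f -> is_cochain g -> is_cochain (c *: f + g).
Proof.
have E x : (c *: f + g : cochain M N k) x = c%:P%:MP *: f x + g x by [].
move=> fc gc; split.
- by move=> k0; rewrite (cochain_pos fc k0) (cochain_pos gc k0) scaler0 addr0.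
- move=> i d y y' x; rewrite !E (cochain_lin fc) (cochain_lin gc).
  by rewrite !scalerDr !scalerA [_ * d%:P%:MP]mulrC addrACA.
- move=> i x; rewrite !E (cochain_sesq fc) (cochain_sesq gc).
  by rewrite scalerDr !scalerA mulrC.
- move=> s x; rewrite !E [in LHS](cochain_skew fc s) [in LHS](cochain_skew gc s).
  by rewrite lsubstD lsubstZ msubC scalerDr !scalerA mulrC.
Qed.

End CochainBracket.

(** * Lie conformal brackets as cochains of square zero *)

Section LieCochain.
Context {K : fieldType} {M : lmodType {poly K}}.
Variable br : M -> M -> lpoly M 1.
Hypothesis lie : lie_conformal br.

Definition mu : cochain M M 2 := fun z => br (z ord0) (z ord_max).

Lemma klin_brl y : klin (br^~ y).
Proof. by move=> c x x'; exact: lie_linl lie _ _ _ _. Qed.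

Lemma klin_brr x : klin (br x).
Proof. by move=> c y y'; exact: lie_linr lie _ _ _ _. Qed.

Lemma ord2P (i : 'I_2) : (i = ord0) + (i = ord_max).
Proof. by case: (unliftP ord0 i) => [j|] ->; [right; apply/val_inj; rewrite /= ord1 | left]. Qed.

Lemma lamdag2_max : @lamdag K 2 ord_max = - lam ord0 - partial 1.
Proof. by rewrite lamdag_max // big_ord1. Qed.

Lemma mu_cochain : is_cochain mu.
Proof.
split=> //.
- move=> i c y y' x; rewrite /mu; case: (ord2P i) => -> /=.
    exact: klin_brl.
  exact: klin_brr.
- move=> i x; rewrite /mu; case: (ord2P i) => -> /=.
    by rewrite (lie_sesql lie) (@lamdag_lt _ 2 _ ord0).
  by rewrite (lie_sesqr lie) lamdag2_max opprB opprK.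
- move=> s x; rewrite /mu /=.
  case: (ord2P (s ord0)) => s0.
    have s1 : s = 1%g.
      apply/permP => i; rewrite perm1; case: (ord2P i) => -> //.
      by case: (ord2P (s ord_max)) => // e; have := perm_inj (etrans s0 (esym e)).
    rewrite s1 odd_perm1 scale1r !perm1 -[LHS]lsubst_lam; apply: eq_lsubst => j.
    by rewrite perm1 ord1 (@lamdag_lt _ 2 _ ord0).
  have s1 : s = tperm ord0 ord_max.
    apply/permP => i; case: (ord2P i) => ->; first by rewrite tpermL.
    rewrite tpermR; case: (ord2P (s ord_max)) => // e.
    by have := perm_inj (etrans s0 (esym e)).
  rewrite s1 odd_tperm /= expr1 scaleN1r tpermL tpermR (lie_skew lie); congr (- _).
  apply: eq_lsubst => j.
  by rewrite (_ : widen_ord _ j = ord0) ?tpermL ?lamdag2_max //; apply/val_inj; rewrite /= ord1.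
Qed.

Lemma ev_mu n s t (x y : lpoly M n) :
  ev mu [:: (s, x); (t, y)] = lbr br (emb s) x y.
Proof.
rewrite /ev /=; apply: eq_lext => x0; apply: eq_lext => y0.
by rewrite /capp; apply: eq_lsubst => j; rewrite ord1.
Qed.

#[local] Opaque ev.

(** The value of mu does not depend on the weight of the last argument, so
    that the weight of z, or of an inner value in that place, can be set to
    zero; the identity is then the image of the Jacobi identity in two
    variables by the substitution of s and t. *)
Lemma ev_mu_jacobi n (s t r : {mpoly K[n]}) x y z :
  let X := (s, lconst n x) in let Y := (t, lconst n y) in let W := (r, lconst n z) in
  ev mu [:: X; (t + r, ev mu [:: Y; W])] =
    ev mu [:: (s + t, ev mu [:: X; Y]); W] + ev mu [:: Y; (s + r, ev mu [:: X; W])].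
Proof.
move=> X Y W; have mug := oper_ev mu_cochain.
pose c (i : 'I_2) := if i == ord0 then s else t.
pose X2 := ('X_ord0 : {mpoly K[2]}, lconst 2 x).
pose Y2 := ('X_ord_max : {mpoly K[2]}, lconst 2 y).
pose W2 := (0 : {mpoly K[2]}, lconst 2 z).
have evc p u q v : ev mu [:: (p, lconst 2 u); (q, lconst 2 v)] = lsubst (fun=> emb p) (br u v).
  have := @ev_const _ _ _ _ _ 2 [:: (p, u); (q, v)] mu_cochain erefl.
  rewrite /= /wconst /= => ->; rewrite /capp; apply: eq_lsubst => i.
  by rewrite ord1.
have J2 : ev mu [:: X2; (0, ev mu [:: Y2; W2])] =
    ev mu [:: ('X_ord0 + 'X_ord_max, ev mu [:: X2; Y2]); W2] +
    ev mu [:: Y2; (0, ev mu [:: X2; W2])].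
  rewrite !evc !ev_mu. rewrite [emb (_ + _)]rmorphD /= !embX. exact: (lie_jacobi lie x y z).
have := congr1 (lsubst (emb \o c)) J2.
rewrite lsubstD !(g_nat mug) //= /tsub /= !(g_nat mug) //= /tsub /=.
rewrite [wsub _ (_ + _)]rmorphD [wsub _ 0]rmorph0 /= !wsubX /c /= !lsubst_const => J.
have wtE p q q' u v : ev mu [:: (p, u); (q, v)] = ev mu [:: (p, u); (q', v)] :> lpoly M n.
  exact (etrans (ev_mu p q u v) (esym (ev_mu p q' u v))).
have inner p q u p' u' q' v' : ev mu [:: (p, u); (q, ev mu [:: (p', u'); (q', v')])] =
    ev mu [:: (p, u); (0, ev mu [:: (p', u'); (0, v')])] :> lpoly M n.
  exact (etrans (congr1 (fun z => ev mu [:: (p, u); (q, z)]) (wtE p' q' 0 u' v'))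
    (wtE p q 0 u (ev mu [:: (p', u'); (0, v')]))).
exact (etrans (inner s (t + r) (lconst n x) t (lconst n y) r (lconst n z))
  (etrans J (esym (f_equal2 +%R
    (wtE (s + t) r 0 (ev mu [:: X; Y]) (lconst n z))
    (inner t (s + r) (lconst n y) s (lconst n x) r (lconst n z)))))).
Qed.

(** The three splittings give the three terms of the Jacobi identity, up to
    the symmetry of mu. *)
Lemma star_mu n w : size w = 3%N -> Z (wt w) (star 2 (ev mu) (ev mu) w : lpoly M n).
Proof.
have mug := oper_ev mu_cochain.
have g3 : oper 3 (star 2 (ev mu) (ev mu)) by exact: (oper_star (m := 1) mug mug).
suff /(_ n w) h : eqf 3 (star 2 (ev mu) (ev mu)) nul by move=> /h; rewrite subr0.
apply: eqf_const => // [|{}n {}w sw]; first exact: oper_nul.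
case: w sw => [|[s x] [|[t y] [|[r z] []]]] // _; rewrite subr0 /wconst /=.
set X := (s, _); set Y := (t, _); set W := (r, _).
have -> : star 2 (ev mu) (ev mu) [:: X; Y; W] =
  ev mu [:: (wt [:: X; Y], ev mu [:: X; Y]); W] - ev mu [:: (wt [:: X; W], ev mu [:: X; W]); Y]
  + ev mu [:: (wt [:: Y; W], ev mu [:: Y; W]); X].
  by rewrite /star /= !scaler0 !addr0 add0r expr0 expr1 !scale1r scaleN1r -signr_odd expr0 scale1r.
have wXY (A B : wel M n) : wt [:: A; B] = A.1 + B.1 by rewrite !wt_cons /wt big_nil addr0.
rewrite !wXY /=.
have h1 := g_skew mug Y (s + r, ev mu [:: X; W]) (u := [::]) (v := [::]) erefl.
have h2 := g_skew mug X (t + r, ev mu [:: Y; W]) (u := [::]) (v := [::]) erefl.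
have J := ev_mu_jacobi s t r x y z; rewrite /= -/X -/Y -/W in J.
rewrite /= J in h2; have e : wt [:: X; Y; W] = s + (t + r) by rewrite !wt_cons /wt big_nil addr0.
have w1 : wt [:: Y; (s + r, ev mu [:: X; W])] = wt [:: X; Y; W].
  by rewrite wXY e /= addrCA.
have w2 : wt [:: X; (t + r, ev mu [:: Y; W])] = wt [:: X; Y; W].
  by rewrite wXY e.
have := ZB (Zw w2 h2) (Zw w1 h1).
set A := ev mu [:: (s + t, _); _]; set B := ev mu [:: Y; _]; set C := ev mu [:: (t + r, _); _].
set D := ev mu [:: (s + r, _); _].
by rewrite (_ : _ - _ = A - D + C) //=; rewrite -/B -/D; abelian.
Qed.

End LieCochain.

(** * The two components of the bracket of a twilled algebra *)

Section Projections.
Context {K : fieldType} {a b : lmodType {poly K}}.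
Notation E := (a * b)%type.

Fact pra_linear : linear (@pra K a b). Proof. by []. Qed.
HB.instance Definition _ := GRing.isLinear.Build {poly K} E a _ (@pra K a b) pra_linear.
Fact prb_linear : linear (@prb K a b). Proof. by []. Qed.
HB.instance Definition _ := GRing.isLinear.Build {poly K} E b _ (@prb K a b) prb_linear.
Fact inja_linear : linear (@inja K a b).
Proof. by move=> c x y; congr pair; rewrite /= scaler0 addr0. Qed.
HB.instance Definition _ := GRing.isLinear.Build {poly K} a E _ (@inja K a b) inja_linear.
Fact injb_linear : linear (@injb K a b).
Proof. by move=> c x y; congr pair; rewrite /= scaler0 addr0. Qed.
HB.instance Definition _ := GRing.isLinear.Build {poly K} b E _ (@injb K a b) injb_linear.

Definition Pa : {linear E -> E} := @inja K a b \o @pra K a b.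
Definition Pb : {linear E -> E} := @injb K a b \o @prb K a b.

Definition dil (t : K) (z : E) : E := (t%:P *: z.1, z.2).
Fact dil_linear t : linear (dil t).
Proof. by move=> c x y; congr pair; rewrite /= scalerDr !scalerA mulrC. Qed.
HB.instance Definition _ t := GRing.isLinear.Build {poly K} E E _ (dil t) (dil_linear t).

End Projections.

Section TwilledTheory.
Context {K : fieldType} {a b : lmodType {poly K}}.
Variable br : (a * b)%type -> (a * b)%type -> lpoly (a * b)%type 1.
Hypothesis tw : twilled br.
Notation E := (a * b)%type.

Let lie := twilled_lie tw.

(** nu1 as a combination of mu with the projections, from which it is clear
    that it is a cochain. *)
Definition n1 : cochain E E 2 :=
  (-1) *: lconj (@Pb K a b) (@Pb K a b) (mu br) +
  (1 *: lconj (@Pa K a b) (@Pa K a b) (mu br) + lconj idfun (@Pb K a b) (mu br)).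
Definition n2 : cochain E E 2 := (-1) *: n1 + mu br.

Lemma n1_cochain : is_cochain n1.
Proof.
apply: is_cochain_lin; first exact/lconj_cochain/mu_cochain.
by apply: is_cochain_lin; exact/lconj_cochain/mu_cochain.
Qed.

Lemma n2_cochain : is_cochain n2.
Proof. by apply: is_cochain_lin; [exact: n1_cochain | exact: mu_cochain]. Qed.

Lemma br_aa (x y : E) m : (br (Pa x) (Pa y) m).2 = 0.
Proof. exact: (liesub_br (twilled_subl tw)). Qed.

Lemma br_bb (x y : E) m : (br (Pb x) (Pb y) m).1 = 0.
Proof. exact: (liesub_br (twilled_subr tw)). Qed.

Lemma br_split (z w : E) :
  br z w = br (Pa z) (Pa w) + br (Pa z) (Pb w) + (br (Pb z) (Pa w) + br (Pb z) (Pb w)).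
Proof.
have e (x : E) : x = Pa x + Pb x.
  by case: x => x u; congr pair; rewrite /= ?addr0 ?add0r.
by rewrite {1}(e z) {1}(e w) (klinD (klin_brl lie _)) !(klinD (klin_brr lie _)).
Qed.

Lemma theta0 x y : theta br x y = 0.
Proof.
apply: lpolyP => m; rewrite lmapE; last exact: raddfD.
exact: (br_aa (x, 0) (y, 0) m).
Qed.

Lemma br_swap x y : lswap (br x y) = - br y x.
Proof. by rewrite (lie_skew lie y x) opprK. Qed.

Lemma nu1E z m : nu1 br z m =
  ((br (Pa (z ord0)) (Pa (z ord_max)) m).1,
   (br (Pa (z ord0)) (Pb (z ord_max)) m).2 + (br (Pb (z ord0)) (Pa (z ord_max)) m).2).
Proof.
rewrite /nu1 /lpair /bra /rhoa; case: (z ord0) => x u; case: (z ord_max) => y v.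
rewrite lswap_lmap br_swap lcoefD !lmapE; try exact: raddfD.
rewrite lcoefD lcoefN !lmapE ?lcoefN; try exact: raddfD.
by congr pair; rewrite /= ?addr0 // add0r opprK.
Qed.

Lemma nu2E z m : nu2 br z m =
  ((br (Pb (z ord0)) (Pa (z ord_max)) m).1 + (br (Pa (z ord0)) (Pb (z ord_max)) m).1,
   (br (Pb (z ord0)) (Pb (z ord_max)) m).2).
Proof.
rewrite /nu2 /lpair /brb /rhob; case: (z ord0) => x u; case: (z ord_max) => y v.
rewrite lswap_lmap br_swap lcoefD !lmapE; try exact: raddfD.
rewrite lcoefD lcoefN !lmapE ?lcoefN; try exact: raddfD.
by congr pair; rewrite /= ?addr0 ?add0r // opprK.
Qed.

Lemma n1E : n1 = nu1 br.
Proof.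
apply/funext => z; apply: lpolyP => m; rewrite nu1E.
have -> : n1 z m = (-1)%:P *: lmap (@Pb K a b) (br (Pb (z ord0)) (Pb (z ord_max))) m
   + (1%:P *: lmap (@Pa K a b) (br (Pa (z ord0)) (Pa (z ord_max))) m
      + lmap (@Pb K a b) (br (z ord0) (z ord_max)) m).
  by rewrite -!lcoefC.
rewrite !lmapE; try exact: raddfD.
rewrite (br_split (z ord0)) !lcoefD polyCN polyC1 scaleN1r scale1r.
have := br_aa (z ord0) (z ord_max) m; have := br_bb (z ord0) (z ord_max) m.
move: (br (Pa _) (Pa _) m) (br (Pa _) (Pb _) m) (br (Pb _) (Pa _) m) (br (Pb _) (Pb _) m).
move=> [aa1 aa2] [ab1 ab2] [ba1 ba2] [bb1 bb2] /= b0 a0; rewrite ?b0 ?a0.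
by congr pair; rewrite /=; abelian.
Qed.

Lemma n2E : n2 = nu2 br.
Proof.
rewrite /n2 n1E; apply/funext => z; apply: lpolyP => m; rewrite nu2E.
have -> : ((-1) *: nu1 br + mu br : cochain E E 2) z m =
   (-1)%:P *: nu1 br z m + br (z ord0) (z ord_max) m by rewrite -lcoefC.
rewrite nu1E (br_split (z ord0)) !lcoefD polyCN polyC1 scaleN1r.
have := br_aa (z ord0) (z ord_max) m; have := br_bb (z ord0) (z ord_max) m.
move: (br (Pa _) (Pa _) m) (br (Pa _) (Pb _) m) (br (Pb _) (Pa _) m) (br (Pb _) (Pb _) m).
move=> [aa1 aa2] [ab1 ab2] [ba1 ba2] [bb1 bb2] /= b0 a0; rewrite ?b0 ?a0.
by congr pair; rewrite /=; abelian.
Qed.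

Lemma nu1_cochain : is_cochain (nu1 br).
Proof. by rewrite -n1E; exact: n1_cochain. Qed.

Lemma nu2_cochain : is_cochain (nu2 br).
Proof. by rewrite -n2E; exact: n2_cochain. Qed.

(** The components of the bracket gathered in nu1 have one more argument than
    value in a, those in nu2 as many. *)
Lemma dil_mu t : t != 0 ->
  lconj (dil t) (dil t^-1) (mu br) = t *: nu1 br + nu2 br :> cochain E E 2.
Proof.
move=> t0; apply/funext => z; apply: lpolyP => m.
have -> : (t *: nu1 br + nu2 br : cochain E E 2) z m = t%:P *: nu1 br z m + nu2 br z m.
  by rewrite -lcoefC.
rewrite /lconj lmapE; last exact: raddfD.
rewrite nu1E nu2E /mu /= (br_split (dil t _)).
have Pad (x : E) : Pa (dil t x) = t%:P *: Pa x :> E.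
  by congr pair; rewrite /= scaler0.
have Pbd (x : E) : Pb (dil t x) = Pb x by [].
rewrite !Pad !Pbd !(klinZ (klin_brl lie _)) !(klinZ (klin_brr lie _)) !lcoefD !lcoefC.
have tt : t^-1%:P * t%:P = 1 :> {poly K} by rewrite -polyCM mulVf.
have := br_aa (z ord0) (z ord_max) m; have := br_bb (z ord0) (z ord_max) m.
move: (br (Pa _) (Pa _) m) (br (Pa _) (Pb _) m) (br (Pb _) (Pa _) m) (br (Pb _) (Pb _) m).
move=> [aa1 aa2] [ab1 ab2] [ba1 ba2] [bb1 bb2] /= b0 a0; rewrite ?b0 ?a0.
congr pair; rewrite /= ?(scaler0, scalerDr, scalerA) ?mulrA ?tt ?mul1r ?scale1r.
  by rewrite addr0 -addrA; congr (_ + _); exact: addrC.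
by rewrite add0r addrA.
Qed.

Hypotheses (two_neq0 : 2%:R != 0 :> K) (three_neq0 : 3%:R != 0 :> K).

Let N1 := @ev K E E 2 (nu1 br).
Let N2 := @ev K E E 2 (nu2 br).

Lemma oper_N1 : oper 2 N1. Proof. exact/oper_ev/nu1_cochain. Qed.
Lemma oper_N2 : oper 2 N2. Proof. exact/oper_ev/nu2_cochain. Qed.

(** The dilated bracket is isomorphic to the given one. *)
Lemma star_dil t n (w : seq (wel E n)) : t != 0 -> size w = 3%N ->
  Z (wt w) (t%:P%:MP *: (t%:P%:MP *: star 2 N1 N1 w + star 2 N1 N2 w)
            + (t%:P%:MP *: star 2 N2 N1 w + star 2 N2 N2 w)).
Proof.
move=> t0 sw; have muc := mu_cochain lie.
have dilc : is_cochain (t *: nu1 br + nu2 br).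
  by rewrite -(dil_mu t0); exact: lconj_cochain.
have e : ev (t *: nu1 br + nu2 br) =
    (fun n v => t%:P%:MP *: N1 v + N2 v : lpoly E n) :> fam E E.
  by apply: famP => n' v; exact: ev_lin.
have := Z_lmap (dil t^-1) (star_mu lie (w := map (tmap (dil t)) w) _).
rewrite size_map sw wt_tmap => /(_ erefl).
rewrite (_ : lmap _ _ = star 2 (ev (t *: nu1 br + nu2 br)) (ev (t *: nu1 br + nu2 br)) w).
  rewrite e star_linl (star_linr (m := 1) _ _ _ oper_N1) //.
  by rewrite (star_linr (m := 1) _ _ _ oper_N2).
rewrite -(dil_mu t0) /star ssum_map ssum_morph; last exact/lmapD/raddfD.
apply: eq_ssum => u v /reordering_size; rewrite size_cat size_map sw => suv.
case: eqP => su; last exact: (lextf0 (fun z : E => lconst n (dil t^-1 z))).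
have sv : size v = 1%N by lia.
rewrite !ev_lconj //=; last by rewrite sv.
rewrite wt_tmap; congr (lmap _ (ev _ ((_, _) :: _))); apply: lpolyP => m.
rewrite lmap_comp lmapE /=; last by move=> x y /=; rewrite !raddfD.
by rewrite /dil /= scalerA -polyCM mulfV // scale1r; case: (ev _ _ m).
Qed.

Lemma nrb11 F G n (w : seq (wel E n)) : nrb 1 1 F G w = star 2 F G w + star 2 G F w.
Proof. by rewrite /nrb expr1 scaleN1r opprK. Qed.

(** The three components of the Jacobi identity are separated by the values of
   the dilation parameter. *)
Lemma nu_sq : [/\ eqf 3 (nrb 1 1 N1 N1) nul, eqf 3 (nrb 1 1 N2 N1) nul
  & eqf 3 (nrb 1 1 N2 N2) nul].
Proof.
have sep n (w : seq (wel E n)) : size w = 3%N ->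
    [/\ Z (wt w) (star 2 N1 N1 w), Z (wt w) (star 2 N2 N1 w + star 2 N1 N2 w)
      & Z (wt w) (star 2 N2 N2 w)].
  move=> sw; set A := star 2 N1 N1 w; set C := star 2 N2 N2 w.
  set B1 := star 2 N2 N1 w; set B2 := star 2 N1 N2 w; set B := B1 + B2.
  have h t : t != 0 -> Z (wt w) ((t ^+ 2)%:P%:MP *: A + (t%:P%:MP *: B + C)).
    move=> t0; have := star_dil t0 sw; rewrite -/A -/B1 -/B2 -/C.
    rewrite (_ : _ *: _ + _ = (t ^+ 2)%:P%:MP *: A + (t%:P%:MP *: B + C)) //.
    rewrite expr2 !rmorphM /= -scalerA /B !scalerDr; abelian.
  have divZ k (X : lpoly E n) : k%:R != 0 :> K -> Z (wt w) (X *+ k) -> Z (wt w) X.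
    move=> k0 /(ZZ (k%:R^-1)%:P%:MP); rewrite -scaler_nat scalerA.
    have -> : k%:R = (k%:R : K)%:P%:MP :> {mpoly {poly K}[n]} by rewrite !rmorph_nat.
    by rewrite -!rmorphM mulVf // !rmorph1 scale1r.
  (* t = 1, - 1, 2 *)
  have h1 : Z (wt w) (A + (B + C)).
    by have := h 1 (oner_neq0 _); rewrite expr1n !rmorph1 !scale1r.
  have h2 : Z (wt w) (A - B + C).
    have := h (-1); rewrite oppr_eq0 oner_neq0 sqrrN expr1n !rmorphN !rmorph1 scaleN1r scale1r.
    by rewrite addrA; apply.
  have h3 : Z (wt w) (A *+ 4 + (B *+ 2 + C)).
    by have := h 2%:R two_neq0; rewrite -natrX !rmorph_nat !scaler_nat.
  have ZB2 : Z (wt w) B.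
    apply: (divZ 2) => //; have := ZB h1 h2.
    by rewrite (_ : _ - _ = B *+ 2) // mulr2n; abelian.
  have ZA3 : Z (wt w) A.
    apply: (divZ 3) => //; have := ZB (ZB h3 h1) ZB2.
    by rewrite (_ : _ - _ - _ = A *+ 3) // !(mulrS _ 3, mulrS _ 2, mulrS _ 1, mulr1n); abelian.
  split=> //; have := ZB (ZB h1 ZB2) ZA3.
  by rewrite (_ : _ - _ - _ = C) //; abelian.
by split=> n w /sep [h1 h2 h3]; rewrite nrb11 subr0 //; exact: ZD.
Qed.

End TwilledTheory.

(** * Cochains on b with values in a *)

Section TwoArguments.
Context {K : fieldType}.
Implicit Types (L M N U V W : lmodType {poly K}) (n : nat).

Definition duo T (x y : T) : 'I_2 -> T := fun i => if i == ord0 then x else y.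

Lemma ev_duo M N (f : cochain M N 2) n s t (x y : lpoly M n) :
  ev f [:: (s, x); (t, y)] = lbr (fun x0 y0 => f (duo x0 y0)) (emb s) x y.
Proof.
rewrite /ev /=; apply: eq_lext => x0; apply: eq_lext => y0.
rewrite /capp (eq_lsubst (c' := fun=> emb s)) => [|j]; last by rewrite ord1.
congr (lsubst _ (f _)); apply/funext => i; rewrite /duo.
by case: (ord2P i) => ->.
Qed.

Lemma lmap_lbr U V W W' n (g : {linear W -> W'}) (br : U -> V -> lpoly W 1) s
    (x : lpoly U n) (y : lpoly V n) :
  lmap g (lbr br s x y) = lbr (fun u v => lmap g (br u v)) s x y.
Proof.
rewrite /lbr lmap_lext; apply: eq_lext => x0; rewrite lmap_lext; apply: eq_lext => y0.
exact: lmap_lsubst.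
Qed.

Lemma eq_lbr U V W n (br br' : U -> V -> lpoly W 1) (s : {mpoly {poly K}[n]}) x y :
  (forall u v, br u v = br' u v) -> lbr br s x y = lbr br' s x y.
Proof. by move=> e; apply: eq_lext => x0; apply: eq_lext => y0; rewrite e. Qed.

Lemma lbr_lmapl U U' V W n (f : {linear U' -> U}) (br : U -> V -> lpoly W 1) s
    (x : lpoly U' n) (y : lpoly V n) : (forall v, klin (br^~ v)) ->
  lbr br s (lmap f x) y = lbr (fun u v => br (f u) v) s x y.
Proof.
move=> bl; rewrite /lbr lext_lmap //; first exact: raddfD.
apply: klinD; apply: klin_lext => v; exact: (klin_lsubst (fun=> s) (bl v)).
Qed.

Lemma lbr_lmapr U V V' W n (f : {linear V' -> V}) (br : U -> V -> lpoly W 1) s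
    (x : lpoly U n) (y : lpoly V' n) : (forall u, klin (br u)) ->
  lbr br s x (lmap f y) = lbr (fun u v => br u (f v)) s x y.
Proof.
move=> bl; apply: eq_lext => x0; rewrite lext_lmap //; first exact: raddfD.
exact: (klinD (klin_lsubst (fun=> s) (bl x0))).
Qed.

Lemma klin_duol M N (f : cochain M N 2) y : is_cochain f -> klin (fun x => f (duo x y)).
Proof.
move=> fc c x x'.
have := cochain_lin fc ord0 c x x' (duo 0 y).
have E' z : [eta duo 0 y with ord0 |-> z] = duo z y :> ('I_2 -> M).
  by apply/funext => i /=; rewrite /duo; case: eqP.
by rewrite !E'.
Qed.

Lemma klin_duor M N (f : cochain M N 2) x : is_cochain f -> klin (fun y => f (duo x y)).
Proof.
move=> fc c y y'; have := cochain_lin fc ord_max c y y' (duo x 0).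
have E z : [eta duo x 0 with ord_max |-> z] = duo x z :> ('I_2 -> M).
  by apply/funext => i /=; rewrite /duo; case: (ord2P i) => ->.
by rewrite !E.
Qed.

End TwoArguments.

Section HatTheory.
Context {K : fieldType} {a b : lmodType {poly K}}.
Variable br : (a * b)%type -> (a * b)%type -> lpoly (a * b)%type 1.
Hypothesis tw : twilled br.
Notation E := (a * b)%type.
Notation prE := (lmap (@prb K a b)).
Notation inE' := (lmap (@inja K a b)).

Let lie := twilled_lie tw.
Let N1 := @ev K E E 2 (nu1 br).
Let N2 := @ev K E E 2 (nu2 br).

Lemma hatE k (f : cochain b a k) :
  hat f = lconj (@prb K a b) (@inja K a b) f.
Proof. by []. Qed.

Lemma hat_cochain k (f : cochain b a k) : is_cochain f -> is_cochain (hat f).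
Proof. by move=> fc; rewrite hatE; exact: lconj_cochain. Qed.

Lemma unhatE k (f : cochain b a k) : f = lconj (@injb K a b) (@pra K a b) (hat f).
Proof.
by apply/funext => x; rewrite /lconj /hat lmap_comp; exact: esym (lmap_id (f x)).
Qed.

Lemma hat_inj k (f g : cochain b a k) : hat f = hat g -> f = g.
Proof. by move=> fg; rewrite (unhatE f) (unhatE g) fg. Qed.

Lemma unhat_cochain k (f : cochain b a k) : is_cochain (hat f) -> is_cochain f.
Proof. by move=> fc; rewrite (unhatE f); exact: lconj_cochain. Qed.

Lemma ev_hat k (f : cochain b a k) n (w : seq (wel E n)) : is_cochain f -> size w = k ->
  ev (hat f) w = inE' (ev f (map (tmap (@prb K a b)) w)).
Proof. by move=> fc sw; rewrite hatE ev_lconj. Qed.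

Lemma prb_inja n (x : lpoly a n) : prE (inE' x) = 0.
Proof. by rewrite lmap_comp; apply: lpolyP => m; rewrite lmapE // => u v /=; rewrite addr0. Qed.

(** Such a cochain only sees the components in b of its arguments. *)
Lemma ev_hat_inja k (f : cochain b a k) n (u v : seq (wel E n)) s x :
  is_cochain f -> (size u + size v).+1 = k ->
  ev (hat f) (u ++ (s, inE' x) :: v) = 0.
Proof.
move=> fc uv; rewrite ev_hat //; last by rewrite size_cat /= addnS.
rewrite map_cat /= /tmap /= prb_inja (g_zero (oper_ev fc)) ?size_map //.
exact: (lextf0 (fun z : a => lconst n (inja z))).
Qed.

Lemma br0l z : br 0 z = 0. Proof. exact: klin0 (klin_brl lie z). Qed.
Lemma br0r z : br z 0 = 0. Proof. exact: klin0 (klin_brr lie z). Qed.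

Lemma nu1_aa x y : nu1 br (duo (@inja K a b x) (inja y)) = inE' (bra br x y).
Proof.
apply: lpolyP => m; rewrite (nu1E tw) !lmapE; try exact: raddfD.
rewrite /duo /= -![injb (prb (inja _))]/(0 : E) br0l br0r.
by congr pair; rewrite /= addr0.
Qed.

Lemma nu1_prb x z : prE (nu1 br (duo (@inja K a b x) z)) = rhoa br x (prb z).
Proof.
apply: lpolyP => m; rewrite /rhoa !lmapE; try exact: raddfD.
rewrite (nu1E tw) /duo /= -![injb (prb (inja _))]/(0 : E) br0l.
by rewrite addr0.
Qed.

Lemma nu2_ba z x : nu2 br (duo z (@inja K a b x)) = inE' (rhob br (prb z) x).
Proof.
apply: lpolyP => m; rewrite (nu2E tw) !lmapE; try exact: raddfD.
rewrite /duo /= -![injb (prb (inja _))]/(0 : E) !br0r.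
by congr pair; rewrite /= addr0.
Qed.

Lemma nu2_prb z w : prE (nu2 br (duo z w)) = brb br (prb z) (prb w).
Proof.
apply: lpolyP => m; rewrite /brb !lmapE; try exact: raddfD.
by rewrite (nu2E tw).
Qed.

Lemma ev_nu1_aa n s t (x y : lpoly a n) :
  N1 [:: (s, inE' x); (t, inE' y)] =
  inE' (lbr (bra br) (emb s) x y).
Proof.
have c := nu1_cochain tw.
rewrite /N1 ev_duo lbr_lmapl; last by move=> v; exact: klin_duol.
rewrite lbr_lmapr; last by move=> u; exact: klin_duor.
by rewrite lmap_lbr; apply: eq_lbr => u v; exact: nu1_aa.
Qed.

Lemma klin_bra_l x : klin ((bra br)^~ x).
Proof.
move=> c u w; rewrite /bra linearP (klin_brl lie) lmapD ?lmapZ //; exact: raddfD.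
Qed.

Lemma klin_bra_r x : klin (bra br x).
Proof.
move=> c u w; rewrite /bra linearP (klin_brr lie) lmapD ?lmapZ //; exact: raddfD.
Qed.

Lemma klin_rhoa_l v : klin ((rhoa br)^~ v).
Proof.
move=> c u w; rewrite /rhoa linearP (klin_brl lie) lmapD ?lmapZ //; exact: raddfD.
Qed.

Lemma klin_rhoa x : klin (rhoa br x).
Proof.
move=> c u v; rewrite /rhoa linearP (klin_brr lie) lmapD ?lmapZ //; exact: raddfD.
Qed.

Lemma klin_rhob_r u : klin (rhob br u).
Proof.
move=> c x y; rewrite /rhob linearP (klin_brr lie) lmapD ?lmapZ //; exact: raddfD.
Qed.

Lemma klin_rhob_l x : klin ((rhob br)^~ x).
Proof.
move=> c u v; rewrite /rhob linearP (klin_brl lie) lmapD ?lmapZ //; exact: raddfD.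
Qed.

Lemma klin_brb_l v : klin ((brb br)^~ v).
Proof.
move=> c u w; rewrite /brb linearP (klin_brl lie) lmapD ?lmapZ //; exact: raddfD.
Qed.

Lemma klin_brb_r v : klin (brb br v).
Proof.
move=> c u w; rewrite /brb linearP (klin_brr lie) lmapD ?lmapZ //; exact: raddfD.
Qed.

Lemma ev_nu1_prb n s t (x : lpoly a n) (z : lpoly E n) :
  prE (N1 [:: (s, inE' x); (t, z)]) =
  lbr (rhoa br) (emb s) x (prE z).
Proof.
have c := nu1_cochain tw.
rewrite /N1 ev_duo lbr_lmapl; last by move=> v; exact: klin_duol.
rewrite lbr_lmapr; last exact: klin_rhoa.
by rewrite lmap_lbr; apply: eq_lbr => u v; exact: nu1_prb.
Qed.

Lemma ev_nu2_ba n s t (x : lpoly a n) (z : lpoly E n) :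
  N2 [:: (s, z); (t, inE' x)] =
  inE' (lbr (rhob br) (emb s) (prE z) x).
Proof.
have c := nu2_cochain tw.
rewrite /N2 ev_duo lbr_lmapr; last by move=> v; exact: klin_duor.
rewrite lbr_lmapl; last exact: klin_rhob_l.
by rewrite lmap_lbr; apply: eq_lbr => u v; exact: nu2_ba.
Qed.

Lemma ev_nu2_prb n s t (z w : lpoly E n) :
  prE (N2 [:: (s, z); (t, w)]) =
  lbr (brb br) (emb s) (prE z) (prE w).
Proof.
have c := nu2_cochain tw.
rewrite /N2 ev_duo lbr_lmapl; last exact: klin_brb_l.
rewrite lbr_lmapr; last by move=> u; exact: klin_brb_r.
by rewrite lmap_lbr; apply: eq_lbr => u v; exact: nu2_prb.
Qed.

End HatTheory.

(** * The explicit formulas as signed sums *)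

Section GenericValues.
Context {K : fieldType} {a b : lmodType {poly K}}.
Variable br : (a * b)%type -> (a * b)%type -> lpoly (a * b)%type 1.
Hypothesis tw : twilled br.
Notation E := (a * b)%type.
Notation prE := (lmap (@prb K a b)).
Notation inE' := (lmap (@inja K a b)).

Let N1 := @ev K E E 2 (nu1 br).
Let N1g := oper_N1 tw.

Context {k : nat} (z : 'I_k -> E).
Let y i := prb (z i).
Notation lams := (map (@lam K k)).
Definition ge (i : 'I_k) : wel E k := ('X_i, lconst k (z i)).

Lemma ge_prb u : map (tmap (@prb K a b)) (map ge u) = map (@wconst _ b k) (map (gn y) u).
Proof.
rewrite -!map_comp; apply: eq_map => i /=; rewrite /tmap /wconst /=.
by rewrite lmap_const.
Qed.

Lemma wt_ge u : emb (wt (map ge u)) = \sum_(t <- lams u) t.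
Proof. by rewrite -(wt_gn z) -map_comp. Qed.

Lemma hat_ge p (f : cochain b a p) u : is_cochain f -> size u = p ->
  ev (hat f) (map ge u) = inE' (capp f (lams u) (map y u)).
Proof.
move=> fc su; rewrite ev_hat ?size_map // ge_prb ev_const ?size_map //.
by rewrite gn_emb gn_snd.
Qed.

Lemma hat_cons_ge p (f : cochain b a p.+1) t x u : is_cochain f -> size u = p ->
  ev (hat f) ((t, x) :: map ge u) = inE' (capp1 f (emb t :: lams u) (prE x) (map y u)).
Proof.
move=> fc su; rewrite ev_hat /= ?size_map ?su // ge_prb ev_cons ?size_map //.
by rewrite gn_emb gn_snd.
Qed.

Lemma genE_ge : gen z = map ge (enum 'I_k).
Proof. by []. Qed.

Lemma inE0 n : inE' (0 : lpoly a n) = 0.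
Proof. exact: (lextf0 (fun z : a => lconst n (inja z))). Qed.

Lemma inED n : {morph @lmap K a E n (@inja K a b) : x y / x + y}.
Proof. exact/lmapD/raddfD. Qed.

Lemma comp_sumE p q (f1 : cochain b a p.+1) (f2 : cochain b a q) : k = (p.+1 + q)%N ->
  comp_sum br f1 f2 y = ssum (enum 'I_k) (fun t v => ssum t (fun u v1 =>
    if (size u == q) && (size v1 == 1%N) then
      capp1 f1 (\sum_(s <- lams t) s :: lams v)
        (lbr (rhoa br) (\sum_(s <- lams u) s) (capp f2 (lams u) (map y u))
           (lconst k (head 0 (map y v1)))) (map y v)
    else 0)).
Proof.
move=> ek; pose Q (vs : seq (seq 'I_k)) :=
  let u := nth [::] vs 0 in let v1 := nth [::] vs 1 in let v := nth [::] vs 2 in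
  capp1 f1 (\sum_(s <- lams (u ++ v1)) s :: lams v)
        (lbr (rhoa br) (\sum_(s <- lams u) s) (capp f2 (lams u) (map y u))
           (lconst k (head 0 (map y v1)))) (map y v).
have -> : comp_sum br f1 f2 y =
    \sum_(s : 'S_k | unshuffle [:: q; 1%N; p] s) (-1) ^+ s *: Q (reshape [:: q; 1%N; p] (word s)).
  apply: eq_bigr => s _; congr (_ *: _).
  have -> : reshape [:: q; 1%N; p] (word s) =
      [:: take q (word s); take 1 (drop q (word s)); drop q.+1 (word s)].
    rewrite /= drop_drop add1n [take p _]take_oversize // size_drop size_word ek; lia.
  rewrite /Q /= -takeD addn1 /plams /pargs !map_take !map_drop -!map_comp.
  rewrite -nth0 nth_take // nth_drop addn0.
  by [].
rewrite sum_unshuffle; last by rewrite /= ek; lia.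
rewrite bsum3; last by rewrite size_enum_ord ek; lia.
transitivity (ssum (enum 'I_k) (fun t v => ssum t (fun u v1 =>
    if (size u == q) && (size v1 == 1%N) then Q [:: u; v1; v] else 0))).
  rewrite -[RHS]ssum_coassoc; apply: eq_ssum => u v _.
  by case: eqP => //= _; rewrite ssum0.
apply: eq_ssum => t v _; apply: eq_ssum => u v1 uv1.
case: ifP => // _; rewrite /Q /=; congr (capp1 _ (_ :: _) _ _).
by rewrite !big_map; exact: uv1.
Qed.

(** Of the value of nu1 inserted in hat f1 only the component in b matters,
    which is rho_a. *)
Lemma star_comp p q (f1 : cochain b a p.+1) (f2 : cochain b a q) : k = (p.+1 + q)%N ->
  is_cochain f1 -> is_cochain f2 ->
  star q.+1 (ev (hat f1)) (star q N1 (ev (hat f2))) (gen z) = inE' (comp_sum br f1 f2 y).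
Proof.
move=> ek f1c f2c; have F1g := oper_ev (hat_cochain f1c).
rewrite comp_sumE // (ssum_morph _ _ (@inED _)) genE_ge /star ssum_map.
apply: eq_ssum => t v tv; have := reordering_size tv.
rewrite size_cat size_enum_ord size_map => stv.
rewrite (ssum_morph _ _ (@inED _)) ssum_map.
case: eqP => [st|st]; last first.
  rewrite -[LHS](ssum0 _ t); apply: eq_ssum => u v1 /reordering_size; rewrite size_cat => suv.
  rewrite (_ : _ && _ = false) ?inE0 //.
  by apply/negP => /andP[/eqP su /eqP sv1]; case: st; rewrite -suv su sv1 addn1.
have sv : size v = p by move: stv; rewrite st; lia.
rewrite (@ssum_morph _ _ _ _ _ (fun X => ev (hat f1) ((wt (map ge t), X) :: map ge v))); last first.
  by move=> X Y; apply: (g_add F1g (u := [::])); rewrite /= size_map sv.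
apply: eq_ssum => u v1 uv1; have := reordering_size uv1; rewrite size_cat st size_map => suv.
case: eqP => su /=; last first.
  by rewrite inE0 (g_zero F1g (u := [::])) //= size_map sv.
have sv1 : size v1 = 1%N by move: suv; rewrite su; lia.
rewrite sv1 eqxx hat_cons_ge // wt_ge; congr (lmap _ (capp1 _ _ _ _)).
case: v1 sv1 {uv1 suv} => [|i []] //= _.
by rewrite hat_ge // ev_nu1_prb // wt_ge lmap_const.
Qed.

Lemma cup_sumE p q (f1 : cochain b a p) (f2 : cochain b a q) : k = (p + q)%N ->
  cup_sum br f1 f2 y = ssum (enum 'I_k) (fun u v => if size u == p then
    lbr (bra br) (\sum_(s <- lams u) s) (capp f1 (lams u) (map y u))
      (capp f2 (lams v) (map y v)) else 0).
Proof.
move=> ek; pose Q (vs : seq (seq 'I_k)) := let u := nth [::] vs 0 in let v := nth [::] vs 1 in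
  lbr (bra br) (\sum_(s <- lams u) s) (capp f1 (lams u) (map y u)) (capp f2 (lams v) (map y v)).
have -> : cup_sum br f1 f2 y =
    \sum_(s : 'S_k | unshuffle [:: p; q] s) (-1) ^+ s *: Q (reshape [:: p; q] (word s)).
  apply: eq_bigr => s _; congr (_ *: _).
  have -> : reshape [:: p; q] (word s) = [:: take p (word s); drop p (word s)].
    by rewrite /= [take q _]take_oversize // size_drop size_word ek; lia.
  rewrite /Q /= /plams /pargs !map_take !map_drop -!map_comp.
  by [].
rewrite sum_unshuffle; last by rewrite /= ek; lia.
rewrite bsum2; last by rewrite size_enum_ord ek; lia.
by [].
Qed.

(** The two values inserted in nu1 lie in a, where nu1 is the bracket of a. *)
Lemma nested_cup p q (f1 : cochain b a p) (f2 : cochain b a q) : k = (p + q)%N ->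
  is_cochain f1 -> is_cochain f2 ->
  nested p q N1 (ev (hat f1)) (ev (hat f2)) (gen z) =
  (-1) ^+ (p + p * q) *: inE' (cup_sum br f1 f2 y).
Proof.
move=> ek f1c f2c.
rewrite cup_sumE //.
rewrite (ssum_morph _ _ (@inED _)) -ssumZ /nested genE_ge ssum_map ssum_cocomm.
apply: eq_ssum => v u uv; have := reordering_size uv.
rewrite size_cat size_enum_ord !size_map => suv.
case: eqP => su; last first.
  by rewrite scaler0; case: eqP => sv; rewrite ?inE0 ?scaler0 //; case: su;
    apply/eqP; rewrite -(eqn_add2l (size v)) suv sv; apply/eqP.
have sv : size v = p by move: suv; rewrite su; lia.
rewrite sv eqxx ssum_map.
transitivity ((-1) ^+ (p * q) *: ssum v (fun v1 v2 => if nilp v2 then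
   (-1) ^+ p *: N1 [:: (wt (map ge v1), ev (hat f1) (map ge v1));
     (wt (map ge u), ev (hat f2) (map ge u))] else 0)).
  rewrite su; congr (_ *: _); apply: eq_ssum => v1 v2 /reordering_size.
  rewrite size_cat !size_map sv; case: v2 => [|i v2] /= sv12.
    by rewrite addn0 in sv12; rewrite sv12 eqxx.
  by case: eqP => // e; move: sv12; rewrite e; lia.
rewrite ssum_full !hat_ge // /N1 ev_nu1_aa // wt_ge /= scalerA -exprD.
by congr (_ *: _); congr (_ ^+ _); lia.
Qed.

End GenericValues.

Section Differential.
Context {K : fieldType} {a b : lmodType {poly K}}.
Variable br : (a * b)%type -> (a * b)%type -> lpoly (a * b)%type 1.
Hypothesis tw : twilled br.
Notation E := (a * b)%type.
Notation inE' := (lmap (@inja K a b)).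

Let N1 : fam E E := @ev K E E 2 (nu1 br).
Notation dbr1 := (@dbr K E N1).
Let N2 := @ev K E E 2 (nu2 br).
Let N1g := oper_N1 tw.
Let N2g := oper_N2 tw.

Definition dsum p (f : cochain b a p) (u : 'I_p.+1 -> b) : lpoly a p.+1 :=
  \sum_(i < p.+1) (-1) ^+ (p + i.+1) *:
      lbr (rhob br) (lam i) (lconst _ (u i))
        (capp f [seq lam k | k <- enum 'I_p.+1 & k != i]
                [seq u k | k <- enum 'I_p.+1 & k != i])
    + \sum_(i < p.+1) \sum_(j < p.+1 | (i < j)%N) (-1) ^+ (p + i.+1 + j.+1).-1 *:
      capp1 f
        (lam i + lam j
           :: [seq lam k | k <- enum 'I_p.+1 & (k != i) && (k != j)])
        (lbr (brb br) (lam i) (lconst _ (u i)) (lconst _ (u j)))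
        [seq u k | k <- enum 'I_p.+1 & (k != i) && (k != j)].

Lemma cochain_dE p (f : cochain b a p) u : cochain_d br f u = ldag (dsum f u).
Proof. by []. Qed.

(** The splitting that singles out i has sign (-1)^i, and the one that
    singles out i < j has sign (-1)^(i + j - 1), positions being counted from
    0. *)
Lemma dsumE p (f : cochain b a p) u : dsum f u =
  (-1) ^+ p.+1 *: ssum (enum 'I_p.+1) (fun s v => if size s == 1%N then
      lbr (rhob br) (\sum_(t <- map (@lam K _) s) t) (lconst _ (head 0 (map u s)))
        (capp f (map (@lam K _) v) (map u v)) else 0)
  + (-1) ^+ p *: ssum (enum 'I_p.+1) (fun s v => if size s == 2%N then
      capp1 f (\sum_(t <- map (@lam K _) s) t :: map (@lam K _) v)
        (lbr (brb br) (nth 0 (map (@lam K _) s) 0) (lconst _ (nth 0 (map u s) 0))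
           (lconst _ (nth 0 (map u s) 1)))
        (map u v) else 0).
Proof.
rewrite ssum_pick1 ?ssum_pick2 ?enum_uniq // !scaler_sumr big_enum; congr (_ + _).
  apply: eq_bigr => i _; rewrite index_enum_ordE scalerA -exprD addnS addSn.
  by rewrite /= big_seq1.
rewrite big_enum; apply: eq_bigr => i _; rewrite scaler_sumr big_enum_cond /=.
apply: eq_big => [j|j lt_ij]; first by rewrite !index_enum_ordE.
rewrite !index_enum_ordE scalerA -exprD !big_cons big_nil addr0.
rewrite (_ : (p + i.+1 + j.+1).-1 = (p + (i + j).-1).+2); last by lia.
by rewrite !exprS mulrA mulrNN !mul1r.
Qed.

Lemma wt_map_reordering T (M : lmodType {poly K}) n (g : T -> wel M n) u v :
  reordering u v -> wt (map g u) = wt (map g v).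
Proof. by move=> uv; rewrite /wt !big_map; exact: uv. Qed.

(** The value of f lies in a, so that inserting it in nu2 gives rho_b; the
    value of nu2 matters for f by its component in b only, the bracket of b. *)
Lemma nrb_d p (f : cochain b a p.+1) (z : 'I_p.+2 -> E) : is_cochain f ->
  Z (\sum_i 'X_i) (nrb 1 p N2 (ev (hat f)) (gen z) - inE' (dsum f (fun i => prb (z i)))).
Proof.
move=> fc; set y := fun i => prb (z i).
have F1g := oper_ev (hat_cochain fc).
rewrite dsumE inED !lmapZ !(ssum_morph _ _ (@inED _ _ _ _)) /nrb mul1n opprD addrACA.
rewrite -(wt_gen z); apply: ZD.
  rewrite /star genE_ge ssum_map ssum_cocomm -ssumZ -[X in _ + X]scaleN1r -ssumZ -ssumD.
  apply: Z_ssum => u v uv; have := reordering_size uv; rewrite size_cat size_enum_ord => suv.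
  rewrite size_map; case: eqP => sv; last first.
    case: eqP => su; first by move: suv; rewrite su; lia.
    by rewrite inE0 !scaler0 addr0; exact: Z0.
  have su : size u = 1%N by move: suv; rewrite sv; lia.
  case: u su uv suv => [|i []] //= _ uv suv.
  rewrite mul1n sv scaleN1r [(-1) ^+ p.+2]exprS mulN1r scaleNr opprK -scalerDr; apply: ZZ.
  rewrite hat_ge //.
  have h := g_skew N2g (wt (map (ge z) v), inE' (capp f (map (@lam K _) v) (map y v)))
    (ge z i) (u := [::]) (v := [::]) erefl.
  rewrite /= in h; rewrite big_seq1.
  have e : N2 [:: ge z i; (wt (map (ge z) v), inE' (capp f (map (@lam K _) v) (map y v)))] =
     inE' (lbr (rhob br) (lam i) (lconst p.+2 (y i)) (capp f (map (@lam K _) v) (map y v))).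
    by rewrite /N2 /ge ev_nu2_ba // embX lmap_const.
  rewrite -e; apply: Zw h; rewrite -(wt_map_reordering (ge z) uv) /= !wt_cons /=.
  by rewrite [wt [::]]big_nil addr0 addrC.
rewrite -opprD; apply: ZN.
rewrite /star genE_ge ssum_map -!ssumZ -ssumD; apply: Z_ssum => u v uv.
have := reordering_size uv; rewrite size_cat size_enum_ord => suv.
rewrite size_map; case: eqP => su; last by rewrite inE0 !scaler0 addr0; exact: Z0.
have sv : size v = p by move: suv; rewrite su; lia.
rewrite hat_cons_ge // wt_ge [(-1) ^+ p.+1]exprS mulN1r scaleNr -scalerBr.
case: u su uv suv => [|i [|j []]] //= _ uv suv.
rewrite /ge ev_nu2_prb // !embX !lmap_const // subrr scaler0.
exact: Z0.
Qed.

(** * The operations as brackets with the components *)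

Lemma capp0 (M N : lmodType {poly K}) k n s x : capp (0 : cochain M N k) s x = 0 :> lpoly N n.
Proof. exact: lsubst0. Qed.

Lemma capp10 (M N : lmodType {poly K}) k n s g x : capp1 (0 : cochain M N k) s g x = 0 :> lpoly N n.
Proof.
by rewrite /capp1 -[RHS](lext0f _ g); apply: eq_lext => v; rewrite capp0.
Qed.

Lemma capp1_0 (M N : lmodType {poly K}) k n (f : cochain M N k) s x : capp1 f s 0 x = 0 :> lpoly N n.
Proof. exact: lextf0. Qed.

Lemma hat0 k : hat (0 : cochain b a k) = 0.
Proof. by apply/funext => z; exact: inE0. Qed.

Lemma nr_star0r (M : lmodType {poly K}) m n k (f : cochain M M m) :
  nr_star f (0 : cochain M M n) = 0 :> cochain M M k.
Proof.
apply/funext => x; rewrite /nr_star big1 ?[ldag _]lsubst0 // => s _.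
by rewrite /= capp0 capp1_0 scaler0.
Qed.

Lemma nr_star0l (M : lmodType {poly K}) m n k (g : cochain M M n) :
  nr_star (0 : cochain M M m) g = 0 :> cochain M M k.
Proof.
apply/funext => x; rewrite /nr_star big1 ?[ldag _]lsubst0 // => s _.
by rewrite /= capp10 scaler0.
Qed.

Lemma nr_bracket0r (M : lmodType {poly K}) m n (f : cochain M M m) :
  nr_bracket f (0 : cochain M M n) = 0.
Proof. by rewrite /nr_bracket nr_star0r nr_star0l scaler0 subrr. Qed.

Lemma nr_bracket0l (M : lmodType {poly K}) m n (f : cochain M M n) :
  nr_bracket (0 : cochain M M m) f = 0.
Proof. by rewrite /nr_bracket nr_star0r nr_star0l scaler0 subrr. Qed.

Lemma cochain_d0 p : cochain_d br (0 : cochain b a p) = 0.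
Proof.
apply/funext => u; rewrite cochain_dE /dsum big1 => [|i _].
  rewrite add0r big1 ?[ldag _]lsubst0 // => i _; rewrite big1 // => j _.
  by rewrite capp10 scaler0.
rewrite capp0 /lbr; set e := lext _ _; have -> : e = 0; last exact: scaler0.
by rewrite -[RHS](lext0f _ (lconst p.+1 (u i))); apply: eq_lext => x; exact: lextf0.
Qed.

Lemma cochain_br0l p q (g : cochain b a q) : cochain_br br (0 : cochain b a p) g = 0.
Proof.
apply/funext => u; rewrite /cochain_br.
have -> : comp_sum br (0 : cochain b a p) g u = 0.
  by apply: big1 => s _; rewrite /= capp10 scaler0.
have -> : comp_sum br g (0 : cochain b a p) u = 0.
  by apply: big1 => s _; rewrite /= capp0 /lbr lextf0 capp1_0 scaler0.
have -> : cup_sum br (0 : cochain b a p) g u = 0.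
  by apply: big1 => s _; rewrite /= capp0 /lbr lextf0 scaler0.
by rewrite !scaler0 oppr0 !addr0 [ldag _]lsubst0.
Qed.

Lemma cochain_br0r p q (f : cochain b a p) : cochain_br br f (0 : cochain b a q) = 0.
Proof.
apply/funext => u; rewrite /cochain_br.
have -> : comp_sum br (0 : cochain b a q) f u = 0.
  by apply: big1 => s _; rewrite /= capp10 scaler0.
have -> : comp_sum br f (0 : cochain b a q) u = 0.
  by apply: big1 => s _; rewrite /= capp0 /lbr lextf0 capp1_0 scaler0.
have -> : cup_sum br f (0 : cochain b a q) u = 0.
  apply: big1 => s _; rewrite /= capp0 /lbr; set e := lext _ _.
  have -> : e = 0; last exact: scaler0.
  by rewrite -[RHS](lext0f _ (capp f (take p (plams s)) (take p (pargs s u))));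
    apply: eq_lext => x; exact: lextf0.
by rewrite !scaler0 oppr0 !addr0 [ldag _]lsubst0.
Qed.

Lemma hat_ldag p (D : ('I_p.+1 -> b) -> lpoly a p.+1) (F : fam E E) (z : 'I_p.+1 -> E) :
  Z (\sum_i 'X_i) (F _ (gen z) - inE' (D (fun i => prb (z i)))) ->
  inE' (ldag (D (fun i => prb (z i)))) = reify F z.
Proof.
move=> h; have /eqP := ldag_Z (ltn0Sn p) h.
rewrite /reify /ldag lsubstD -scaleN1r lsubstZ rmorphN1 scaleN1r subr_eq0 => /eqP ->.
exact: lmap_lsubst.
Qed.

Lemma hat_d p (f : cochain b a p.+1) : is_cochain f ->
  hat (cochain_d br f) = reify (nrb 1 p N2 (ev (hat f))).
Proof.
move=> fc; apply/funext => z; rewrite /hat cochain_dE; apply: hat_ldag.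
exact: nrb_d.
Qed.

Lemma l1_reify p (f : cochain b a p.+1) : is_cochain f ->
  l1 br f = reify (nrb 1 p N2 (ev (hat f))) :> cochain E E p.+2.
Proof. by move=> fc; exact: (nr_bracketE (nu2_cochain tw) (hat_cochain fc)). Qed.

Lemma hat_d_l1 p (f : cochain b a p) : is_cochain f -> hat (cochain_d br f) = l1 br f.
Proof.
(* The zero cochain is the only one in degree zero. *)
case: p f => [|p] f fc; last by rewrite hat_d // l1_reify.
by rewrite (cochain_pos fc erefl) cochain_d0 /l1 !hat0 nr_bracket0r.
Qed.

Lemma d_cochain p (f : cochain b a p) : is_cochain f -> is_cochain (cochain_d br f).
Proof.
case: p f => [|p] f fc.
  by rewrite (cochain_pos fc erefl) cochain_d0; exact: is_cochain0.
apply: unhat_cochain; rewrite hat_d //; apply: oper_reify => //.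
exact: (oper_nrb N2g (oper_ev (hat_cochain fc))).
Qed.

Lemma ev_d p (f : cochain b a p.+1) : is_cochain f ->
  eqf p.+2 (ev (hat (cochain_d br f))) (nrb 1 p N2 (ev (hat f))).
Proof.
move=> fc; rewrite hat_d //; apply: ev_reify => //.
exact: (oper_nrb N2g (oper_ev (hat_cochain fc))).
Qed.

(** The inserted value lies in a, where hat f1 vanishes. *)
Lemma star_hat0 p q (f1 : cochain b a p.+1) (f2 : cochain b a q) n (w : seq (wel E n)) :
  is_cochain f1 -> is_cochain f2 -> size w = (p + q)%N ->
  star q (ev (hat f1)) (ev (hat f2)) w = 0.
Proof.
move=> f1c f2c sw; rewrite -[RHS](ssum0 _ w); apply: eq_ssum => u v /reordering_size.
rewrite size_cat => suv; case: eqP => // su.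
by rewrite (ev_hat f2c su) (ev_hat_inja (u := [::])) //=; lia.
Qed.

Lemma nrb_hat0 p q (f1 : cochain b a p.+1) (f2 : cochain b a q.+1) n (w : seq (wel E n)) :
  is_cochain f1 -> is_cochain f2 -> size w = (p + q).+1 ->
  nrb p q (ev (hat f1)) (ev (hat f2)) w = 0.
Proof.
move=> f1c f2c sw; rewrite /nrb !star_hat0 ?scaler0 ?subrr // sw; lia.
Qed.

(** Of the six insertions given by [star_assoc], the three in which a value
    in a is inserted in hat f1 or hat f2 vanish, and the others are the three
    sums of the formula. *)
Lemma dbr_gen p q (f1 : cochain b a p.+1) (f2 : cochain b a q.+1)
    (z : 'I_(p.+1 + q.+1) -> E) : is_cochain f1 -> is_cochain f2 ->
  (-1) ^+ p *: dbr1 p q (ev (hat f1)) (ev (hat f2)) (gen z) =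
  inE' (- comp_sum br f1 f2 (fun i => prb (z i))
        + (-1) ^+ (p.+1 * q.+1) *: comp_sum br f2 f1 (fun i => prb (z i))
        - (-1) ^+ (p.+1 * q.+1) *: cup_sum br f1 f2 (fun i => prb (z i))).
Proof.
move=> f1c f2c.
have [F1g F2g] := (oper_ev (hat_cochain f1c), oper_ev (hat_cochain f2c)).
rewrite /dbr {1}/nrb.
set y := fun i => prb (z i); have sw := size_gen z; set w := gen z in sw *.
have e1 : star q.+1 (nrb 1 p N1 (ev (hat f1))) (ev (hat f2)) w =
   (-1) ^+ (p.+1 + p.+1 * q.+1) *: inE' (cup_sum br f1 f2 y)
   - (-1) ^+ p *: inE' (comp_sum br f1 f2 y).
  rewrite [LHS](@star_addl _ _ q.+1 (star p.+1 N1 (ev (hat f1))) (star 2 (ev (hat f1)) N1)) mul1n.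
  rewrite (star_assoc (m := 1) (n := p) (r := q.+1) _ _ N1g); last by rewrite sw; lia.
  rewrite (star_assoc (m := p) (n := 1) (r := q.+1) _ _ F1g); last by rewrite sw; lia.
  rewrite (nested_cup tw z) // (star_comp tw z) //.
  have -> : star (p + q.+1) N1 (star q.+1 (ev (hat f1)) (ev (hat f2))) w = 0.
    rewrite -[RHS](ssum0 _ w); apply: eq_ssum => u v /reordering_size.
    rewrite size_cat sw => suv; case: eqP => // su.
    by rewrite star_hat0 //; apply: (g_zero N1g (u := [::])) => /=; lia.
  have -> : nested 2 q.+1 (ev (hat f1)) N1 (ev (hat f2)) w = 0.
    rewrite -[RHS](ssum0 _ w); apply: eq_ssum => u v /reordering_size.
    rewrite size_cat sw => suv; case: eqP => // su.
    rewrite -[RHS](ssum0 _ v); apply: eq_ssum => v1 v2 /reordering_size.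
    rewrite size_cat => sv; case: eqP => // sv1.
    rewrite (ev_hat f2c su) (ev_hat_inja (u := [:: _])) ?scaler0 //=; lia.
  by rewrite add0r addr0.
have e2 : star p.+2 (ev (hat f2)) (nrb 1 p N1 (ev (hat f1))) w =
    inE' (comp_sum br f2 f1 y).
  rewrite [LHS](@star_addr _ _ q p.+2 _ (star p.+1 N1 (ev (hat f1))) (star 2 (ev (hat f1)) N1) _ w _ F2g);
    last by rewrite sw; lia.
  rewrite (star_comp tw z) // 1?addnC //.
  have -> : star p.+2 (ev (hat f2)) (star 2 (ev (hat f1)) N1) w = 0.
    rewrite -[RHS](ssum0 _ w); apply: eq_ssum => u v /reordering_size.
    rewrite size_cat sw => suv; case: eqP => // su.
    have -> : star 2 (ev (hat f1)) N1 u = inE' (ssum u (fun s t => if size s == 2%N then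
        ev f1 (map (tmap (@prb K a b)) ((wt s, @N1 _ s) :: t)) else 0)).
      rewrite (ssum_morph _ _ (@inED _ _ _ _)); apply: eq_ssum => s t /reordering_size.
      rewrite size_cat su => sst; case: eqP => ss; last by rewrite inE0.
      by rewrite ev_hat //=; lia.
    by rewrite (ev_hat_inja (u := [::])) //=; lia.
  by rewrite scaler0 subr0.
rewrite e1 e2 !inED !lmapN !lmapZ !sgE !(oddM, oddD, oddS).
set X := inE' (comp_sum br f2 f1 y); set Y := inE' (cup_sum _ _ _ _); set C := inE' (comp_sum _ _ _ _).
by case: (odd p); case: (odd q) => /=; abelian.
Qed.

Lemma oper_dbr p q (F G : fam E E) : oper p.+1 F -> oper q.+1 G ->
  oper (p + q).+2 (dbr1 p q F G).
Proof. by move=> Fg Gg; exact: (oper_nrb (m := p.+1) (oper_nrb N1g Fg) Gg). Qed.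

Lemma oper_br l p q (F G : fam E E) : oper p.+1 F -> oper q.+1 G ->
  oper (p + q).+2 (fun n w => (-1) ^+ l *: dbr1 p q F G w).
Proof.
move=> Fg Gg; apply: oper_ext (oper_add l (@oper_nul _ _ _) (oper_dbr Fg Gg)) => n w.
exact: add0r.
Qed.

Lemma hat_br p q (f1 : cochain b a p.+1) (f2 : cochain b a q.+1) :
  is_cochain f1 -> is_cochain f2 ->
  hat (cochain_br br f1 f2) = reify (fun n w => (-1) ^+ p *: dbr1 p q (ev (hat f1)) (ev (hat f2)) w).
Proof.
move=> f1c f2c; apply/funext => z.
apply: (@hat_ldag (p + q.+1) (fun u => - comp_sum br f1 f2 u
        + (-1) ^+ (p.+1 * q.+1) *: comp_sum br f2 f1 u
        - (-1) ^+ (p.+1 * q.+1) *: cup_sum br f1 f2 u)).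
set X := (X in Z _ (X - _)); set Y := inE' _; have -> : X = Y by exact: (dbr_gen z f1c f2c).
by rewrite subrr; exact: Z0.
Qed.

Lemma l2_reify p q (f1 : cochain b a p.+1) (f2 : cochain b a q.+1) :
  is_cochain f1 -> is_cochain f2 ->
  l2 br f1 f2 = reify (dbr1 p q (ev (hat f1)) (ev (hat f2))).
Proof.
move=> f1c f2c; have [F1g F2g] := (oper_ev (hat_cochain f1c), oper_ev (hat_cochain f2c)).
have c1 := nu1_cochain tw; have hf1 := hat_cochain f1c; have hf2 := hat_cochain f2c.
have e := nr_bracketE c1 hf1.
have g : oper p.+2 (nrb 1 p N1 (ev (hat f1))) by exact: (oper_nrb N1g F1g).
have c : is_cochain (nr_bracket (nu1 br) (hat f1) : cochain E E p.+2).
  by rewrite [nr_bracket _ _]e; exact: oper_reify.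
rewrite /l2 [LHS](nr_bracketE c hf2); apply: reify_eq => //.
rewrite addSn addnS -addSn.
apply: (nrb_congl (m := p.+1) (n := q) F2g).
by rewrite [nr_bracket _ _]e; exact: ev_reify.
Qed.

Lemma hat_br_l2 p q (f1 : cochain b a p) (f2 : cochain b a q) :
  is_cochain f1 -> is_cochain f2 ->
  hat (cochain_br br f1 f2) = (-1) ^+ p.-1 *: l2 br f1 f2.
Proof.
case: p f1 => [|p] f1 f1c f2c.
  by rewrite (cochain_pos f1c erefl) cochain_br0l /l2 !hat0 nr_bracket0r nr_bracket0l scaler0.
case: q f2 f2c => [|q] f2 f2c.
  by rewrite (cochain_pos f2c erefl) cochain_br0r /l2 !hat0 nr_bracket0r scaler0.
rewrite hat_br // l2_reify //; apply/funext => z.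
rewrite /reify /ldag lsubstZ rmorphXn rmorphN1.
by rewrite -[RHS]/(((-1) ^+ p : K)%:P%:MP *: _) -sgP.
Qed.

(** a is a subalgebra, so that theta vanishes. *)
Lemma l3_0 p q r (f1 : cochain b a p) (f2 : cochain b a q) (f3 : cochain b a r) :
  l3 br f1 f2 f3 = 0.
Proof.
rewrite /l3; have -> : thetahat br = 0.
  by apply/funext => z; rewrite /thetahat theta0 //; exact: (lextf0 (fun u : b => lconst 1 (injb u))).
by rewrite !nr_bracket0l.
Qed.

Lemma br_cochain p q (f1 : cochain b a p) (f2 : cochain b a q) :
  is_cochain f1 -> is_cochain f2 -> is_cochain (cochain_br br f1 f2).
Proof.
case: p f1 => [|p] f1 f1c f2c.
  by rewrite (cochain_pos f1c erefl) cochain_br0l; exact: is_cochain0.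
case: q f2 f2c => [|q] f2 f2c.
  by rewrite (cochain_pos f2c erefl) cochain_br0r; exact: is_cochain0.
apply: unhat_cochain; rewrite hat_br //; apply: oper_reify; first by rewrite addnS.
have F1g := oper_ev (hat_cochain f1c); have F2g := oper_ev (hat_cochain f2c).
rewrite addSn addnS; apply: (oper_br p F1g F2g).
Qed.

Lemma ev_br p q (f1 : cochain b a p.+1) (f2 : cochain b a q.+1) :
  is_cochain f1 -> is_cochain f2 ->
  eqf (p + q).+2 (ev (hat (cochain_br br f1 f2)))
    (fun n w => (-1) ^+ p *: dbr1 p q (ev (hat f1)) (ev (hat f2)) w).
Proof.
move=> f1c f2c; have F1g := oper_ev (hat_cochain f1c); have F2g := oper_ev (hat_cochain f2c).
rewrite hat_br //; have -> : (p + q).+2 = (p.+1 + q.+1)%N by rewrite addSn addnS.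
apply: ev_reify; first by rewrite addnS.
rewrite addSn addnS; apply: (oper_br p F1g F2g).
Qed.

End Differential.

(** * The differential graded Lie algebra *)

Section Structure.
Context {K : fieldType} {a b : lmodType {poly K}}.
Variable br : (a * b)%type -> (a * b)%type -> lpoly (a * b)%type 1.
Hypothesis tw : twilled br.
Hypothesis two_neq0 : 2%:R != 0 :> K.
Hypothesis three_neq0 : 3%:R != 0 :> K.
Notation E := (a * b)%type.

Let N1 : fam E E := @ev K E E 2 (nu1 br).
Notation dbr1 := (@dbr K E N1).
Let N2 : fam E E := @ev K E E 2 (nu2 br).
Let N1g : oper 2 N1 := oper_N1 tw.
Let N2g : oper 2 N2 := oper_N2 tw.
Notation H f := (ev (hat f)).
Notation d := (@cochain_d _ a b br).
Notation "<< f , g >>" := (@cochain_br _ a b br _ _ f g).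

Lemma hat_lin k c (f g : cochain b a k) : hat (c *: f + g) = c *: hat f + hat g.
Proof. by apply/funext => z; exact: etrans (inED _ _) (congr1 (fun x => x + _) (lmapZ _ _ _)). Qed.

Lemma H_lin k c (f g : cochain b a k) n (w : seq (wel E n)) :
  H (c *: f + g) w = c%:P%:MP *: H f w + H g w.
Proof. by rewrite hat_lin ev_lin. Qed.

Lemma H_degcast k l (e : k = l) (f : cochain b a k) n (w : seq (wel E n)) :
  H (degcast (F := fun n => cochain b a n) e f : cochain b a l) w = H f w.
Proof. by case: l / e. Qed.

(** hat is injective, and a cochain is recovered from its operation. *)
Lemma cochain_eqf k (f g : cochain b a k) : (0 < k)%N -> is_cochain f ->
  is_cochain g -> eqf k (H f) (H g) -> f = g.
Proof.
move=> k0 fc gc fg; apply: hat_inj.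
by rewrite -(reify_ev (hat_cochain fc)) -(reify_ev (hat_cochain gc)); apply: reify_eq.
Qed.

(** The operation of f up to a sign; signs are thus collected in one
    exponent. *)
Definition rep k (f : cochain b a k) l (G : fam E E) :=
  eqf k (H f) (fun n w => (-1) ^+ l *: G n w).

Lemma rep_id k (f : cochain b a k) : rep f 0 (H f).
Proof. by move=> n w sw; rewrite scale1r subrr; exact: Z0. Qed.

Lemma nrb_rep k (F G : fam E E) l nu : oper 2 nu -> oper k.+1 G ->
  eqf k.+1 F (fun n w => (-1) ^+ l *: G n w) ->
  eqf k.+2 (nrb 1 k nu F) (fun n w => (-1) ^+ l *: nrb 1 k nu G w).
Proof.
move=> nug Gg FG n w sw.
by have := nrb_congr nug FG sw; rewrite nrb_signr.
Qed.

Lemma rep_d k (f : cochain b a k.+1) l G : is_cochain f -> oper k.+1 G ->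
  rep f l G -> rep (d f) l (nrb 1 k N2 G).
Proof.
by move=> fc Gg fG; apply: eqf_trans (ev_d tw fc) _; apply: nrb_rep.
Qed.

Lemma rep_br p q (f1 : cochain b a p.+1) (f2 : cochain b a q.+1) k l F G :
  is_cochain f1 -> is_cochain f2 -> oper p.+1 F -> oper q.+1 G ->
  rep f1 k F -> rep f2 l G -> rep << f1, f2 >> (p + k + l) (dbr1 p q F G).
Proof.
move=> f1c f2c Fg Gg fF gG n w sw'; have sw : size w = (p + q).+2 by rewrite sw' addSn addnS.
have g2 := oper_ev (hat_cochain f2c); have g3 := oper_nrb N1g Fg.
have h1 := ev_br tw f1c f2c sw.
have := nrb_congl (m := p.+1) g2 (nrb_rep N1g Fg fF) sw.
rewrite (nrb_signl (m := p.+1) _ k g2 sw) => /(ZZB p); rewrite scalerA -exprD => h2.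
have := nrb_congr (m := p.+1) g3 gG sw.
rewrite (nrb_signr (m := p.+1) _ l g3 sw) => /(ZZB (p + k)); rewrite scalerA -exprD => h3.
exact: Z_trans h1 (Z_trans h2 h3).
Qed.

Lemma H_scale k c (f : cochain b a k) n (w : seq (wel E n)) :
  H (c *: f) w = c%:P%:MP *: H f w.
Proof.
have h0 : H (0 : cochain b a k) w = 0.
  by have := H_lin (-1) 0 (0 : cochain b a k) w; rewrite scaler0 addr0 => {1}->;
    rewrite polyCN mpolyCN scaleN1r addNr.
by have := H_lin c f 0 w; rewrite addr0 h0 addr0.
Qed.

Lemma H_add k (f g : cochain b a k) n (w : seq (wel E n)) :
  H (f + g) w = H f w + H g w.
Proof. by have := H_lin 1 f g w; rewrite !scale1r. Qed.

Lemma H_sign k l (f : cochain b a k) n (w : seq (wel E n)) :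
  H ((-1) ^+ l *: f) w = (-1) ^+ l *: H f w.
Proof. by rewrite H_scale sgP. Qed.

Lemma H_opp k (f : cochain b a k) n (w : seq (wel E n)) : H (- f) w = - H f w.
Proof. by rewrite -scaleN1r H_scale polyCN mpolyCN scaleN1r. Qed.

Lemma is_cochainD k (f g : cochain b a k) : is_cochain f -> is_cochain g -> is_cochain (f + g).
Proof. by move=> fc gc; rewrite -[f]scale1r; exact: is_cochain_lin. Qed.

Lemma is_cochainZ k c (f : cochain b a k) : is_cochain f -> is_cochain (c *: f).
Proof.
by move=> fc; rewrite -[_ *: _]addr0; apply: is_cochain_lin => //; exact: is_cochain0.
Qed.

Lemma is_cochainN k (f : cochain b a k) : is_cochain f -> is_cochain (- f).
Proof. by rewrite -scaleN1r; exact: is_cochainZ. Qed.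

Lemma is_cochain_degcast k l (e : k = l) (f : cochain b a k) :
  is_cochain f -> is_cochain (degcast (F := cochain b a) e f : cochain b a l).
Proof. by case: l / e. Qed.

(** The operations of cochains on b commute, so that [dbr_sym] applies. *)
Lemma br_anti p q (x : cochain b a p) (y : cochain b a q) :
  is_cochain x -> is_cochain y ->
  << x, y >> = - ((-1) ^+ (p * q) *: degcast (F := cochain b a) (addnC q p) << y, x >>).
Proof.
case: p x => [|p] x xc yc.
  rewrite (cochain_pos xc erefl) cochain_br0l cochain_br0r.
  by case: _ / (addnC q 0); rewrite /= scaler0 oppr0.
case: q y yc => [|q] y yc.
  rewrite (cochain_pos yc erefl) cochain_br0l cochain_br0r.
  by case: _ / (addnC 0 p.+1); rewrite /= scaler0 oppr0.
have c1 := br_cochain tw xc yc; have c2 := br_cochain tw yc xc.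
apply: cochain_eqf => //; first by apply/is_cochainN/is_cochainZ/is_cochain_degcast.
move=> n w sw; rewrite H_opp H_sign H_degcast.
have sw1 : size w = (p + q).+2 by rewrite sw; lia.
have sw2 : size w = (q.+1 + p.+1)%N by rewrite sw; lia.
have [xg yg] := (oper_ev (hat_cochain xc), oper_ev (hat_cochain yc)).
have h1 := rep_br xc yc xg yg (rep_id x) (rep_id y) sw.
have h2 := (ZZB (p.+1 * q.+1) (rep_br yc xc yg xg (rep_id y) (rep_id x) sw2)).
have h3 := ZZB p (dbr_sym N1g xg yg (fun n w => nrb_hat0 xc yc) sw1).
apply: Z_eq (ZD (ZD h1 h3) h2) _.
rewrite !sgE !(oddM, oddD, oddS) /= !addbF.
by case: (odd p); case: (odd q); rewrite /=; abelian.
Qed.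

Lemma degcast0 k l (e : k = l) :
  degcast (F := cochain b a) e 0 = 0 :> cochain b a l.
Proof. by case: l / e. Qed.

Lemma br_jacobi p q r (x : cochain b a p) (y : cochain b a q) (z : cochain b a r) :
  is_cochain x -> is_cochain y -> is_cochain z ->
  << x, << y, z >> >> =
    degcast (F := cochain b a) (esym (addnA p q r)) << << x, y >>, z >>
    + (-1) ^+ (p * q) *: degcast (F := cochain b a) (addnCA q p r) << y, << x, z >> >>.
Proof.
case: p x => [|p] x xc yc zc.
  rewrite (cochain_pos xc erefl) !cochain_br0l ?[in RHS]cochain_br0l cochain_br0r.
  by rewrite !degcast0 scaler0 addr0.
case: q y yc => [|q] y yc.
  rewrite (cochain_pos yc erefl) !(cochain_br0l, cochain_br0r).
  by rewrite !degcast0 scaler0 addr0.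
case: r z zc => [|r] z zc.
  by rewrite (cochain_pos zc erefl) !cochain_br0r !degcast0 scaler0 addr0.
have cyz := br_cochain tw yc zc; have cxz := br_cochain tw xc zc.
have cxy := br_cochain tw xc yc.
have c1 := br_cochain tw xc cyz; have c2 := br_cochain tw cxy zc.
have c3 := br_cochain tw yc cxz.
apply: cochain_eqf => //.
  by apply: is_cochainD; [|apply: is_cochainZ]; apply: is_cochain_degcast.
move=> n w sw; rewrite H_add H_sign !H_degcast.
have [xg yg zg] := And3 (oper_ev (hat_cochain xc)) (oper_ev (hat_cochain yc)) (oper_ev (hat_cochain zc)).
have [gyz gxz] : oper (q + r.+1).+1 (dbr1 q r (H y) (H z)) /\ 
    oper (p + r.+1).+1 (dbr1 p r (H x) (H z)).
  by split; rewrite addnS; exact: oper_dbr.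
have gxy : oper (p + q.+1).+1 (dbr1 p q (H x) (H y)).
  by rewrite addnS; exact: oper_dbr.
have h1 := rep_br (q := q + r.+1) xc cyz xg gyz (rep_id x) (rep_br yc zc yg zg (rep_id y) (rep_id z)) sw.
have sw2 : size w = (p.+1 + q.+1 + r.+1)%N by rewrite sw; lia.
have h2 := rep_br (p := p + q.+1) cxy zc gxy zg (rep_br xc yc xg yg (rep_id x) (rep_id y)) (rep_id z) sw2.
have sw3 : size w = (q.+1 + (p.+1 + r.+1))%N by rewrite sw; lia.
have h3 := rep_br (q := p + r.+1) yc cxz yg gxz (rep_id y) (rep_br xc zc xg zg (rep_id x) (rep_id z)) sw3.
have [nu11 _ _] := nu_sq tw two_neq0 three_neq0.
have sw4 : size w = (p + q + r).+3 by rewrite sw; lia.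
have h4 := ZZB (p + q) (dbr_jacobi two_neq0 N1g nu11 xg yg zg sw4).
rewrite -!addnS in h4.
apply: Z_eq (ZB (ZB (ZD h1 h4) h2) (ZZB (p.+1 * q.+1) h3)) _.
set X := H << x, _ >> w; set Y := H << <<x, y>>, z >> w; set V := H << y, _ >> w.
rewrite !sgE !(oddM, oddD, oddS) /= !addbF.
by case: (odd p); case: (odd q); rewrite /=; abelian.
Qed.

Lemma d_sq p (x : cochain b a p) : is_cochain x -> d (d x) = 0.
Proof.
case: p x => [|p] x xc; first by rewrite (cochain_pos xc erefl) !cochain_d0.
have xg := oper_ev (hat_cochain xc); have dxc := d_cochain tw xc.
have gx : oper p.+2 (nrb 1 p N2 (H x)) := oper_nrb N2g xg.
apply: cochain_eqf => //; [exact: d_cochain | exact: is_cochain0 |].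
move=> n w sw; have h1 := rep_d (k := p.+1) dxc gx (rep_d xc xg (rep_id x)) sw.
have [_ _ nu22] := nu_sq tw two_neq0 three_neq0.
have h2 := nrb_sq0 two_neq0 N2g nu22 xg sw; rewrite subr0 in h2.
apply: Z_eq (ZD h1 h2) _; rewrite scale1r subrK.
have -> : H (0 : cochain b a p.+3) w = 0; last by rewrite subr0.
by have := H_scale 0 (0 : cochain b a p.+3) w; rewrite scale0r polyC0 mpolyC0 scale0r.
Qed.

Lemma d_leibniz p q (x : cochain b a p) (y : cochain b a q) :
  is_cochain x -> is_cochain y ->
  d << x, y >> = << d x, y >>
    + (-1) ^+ p *: degcast (F := cochain b a) (addnS p q) << x, d y >>.
Proof.
case: p x => [|p] x xc yc.
  rewrite (cochain_pos xc erefl) !(cochain_br0l, cochain_d0).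
  by rewrite degcast0 scaler0 addr0.
case: q y yc => [|q] y yc.
  rewrite (cochain_pos yc erefl) !(cochain_br0r, cochain_d0).
  by rewrite degcast0 scaler0 addr0.
have [dx dy] := (d_cochain tw xc, d_cochain tw yc).
have cxy := br_cochain tw xc yc.
have c1 := br_cochain tw dx yc; have c2 := br_cochain tw xc dy.
apply: cochain_eqf => //; first exact: d_cochain.
  by apply: is_cochainD; [|apply: is_cochainZ; apply: is_cochain_degcast].
move=> n w sw; rewrite H_add H_sign H_degcast.
have [xg yg] := (oper_ev (hat_cochain xc), oper_ev (hat_cochain yc)).
have gxy : oper (p + q.+1).+1 (dbr1 p q (H x) (H y)) by rewrite addnS; exact: oper_dbr.
have [gx gy] : oper p.+2 (nrb 1 p N2 (H x)) /\ oper q.+2 (nrb 1 q N2 (H y)).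
  by split; exact: (oper_nrb N2g).
have h1 := rep_d (k := p + q.+1) cxy gxy (rep_br xc yc xg yg (rep_id x) (rep_id y)) sw.
have h2 := rep_br (p := p.+1) dx yc gx yg (rep_d xc xg (rep_id x)) (rep_id y) sw.
have sw3 : size w = (p.+1 + q.+2)%N by rewrite sw; lia.
have h3 := rep_br (q := q.+1) xc dy xg gy (rep_id x) (rep_d yc yg (rep_id y)) sw3.
have [_ nu21 _] := nu_sq tw two_neq0 three_neq0.
have sw4 : size w = (p + q).+3 by rewrite sw; lia.
have h4 := ZZB p (dbr_der N1g N2g nu21 xg yg sw4).
rewrite -!addnS in h4.
apply: Z_eq (ZB (ZB (ZD h1 h4) h2) (ZZB p.+1 h3)) _.
set X := H (d _) w; set Y := H << d x, y >> w; set V := H << x, d y >> w.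
rewrite !sgE !(oddM, oddD, oddS) /= !addbF.
by case: (odd p); case: (odd q); rewrite /=; abelian.
Qed.

Lemma d_lin p c (x y : cochain b a p) : is_cochain x -> is_cochain y ->
  d (c *: x + y) = c *: d x + d y.
Proof.
case: p x y => [|p] x y xc yc.
  by rewrite (cochain_pos xc erefl) (cochain_pos yc erefl) !(scaler0, cochain_d0, addr0).
have cc := is_cochain_lin c xc yc.
have [dx dy] := (d_cochain tw xc, d_cochain tw yc).
apply: cochain_eqf => //; [exact: d_cochain | exact: is_cochain_lin |].
move=> n w sw; rewrite H_lin.
have := ev_d tw cc sw; have -> : H (c *: x + y) = fun n w => c%:P%:MP *: H x w + H y w.
  by apply: famP => m v; exact: H_lin.
rewrite nrb_linr // => h1.
have h2 := ZZBc c (ev_d tw xc sw); have h3 := ev_d tw yc sw.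
by apply: Z_eq (ZB (ZB h1 h2) h3) _; set X := _ *: H (d x) w; abelian.
Qed.

Lemma H_linE k c (f g : cochain b a k) :
  H (c *: f + g) = fun n w => c%:P%:MP *: H f w + H g w.
Proof. by apply: famP => n w; exact: H_lin. Qed.

Lemma degcast_lin k l (e : k = l) c (f g : cochain b a k) :
  degcast (F := cochain b a) e (c *: f + g) =
  c *: degcast (F := cochain b a) e f + degcast (F := cochain b a) e g :> cochain b a l.
Proof. by case: l / e. Qed.

Lemma cancel_linear (V : zmodType) (v x y d d1 d2 : V) :
  (v - d2) + (d2 - (d + d1)) - (x - d) - (y - d1) = v - (x + y).
Proof. by abelian. Qed.

Lemma br_linl p q c (x x' : cochain b a p) (y : cochain b a q) :
  is_cochain x -> is_cochain x' -> is_cochain y ->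
  << c *: x + x', y >> = c *: << x, y >> + << x', y >>.
Proof.
case: p x x' => [|p] x x' xc xc' yc.
  by rewrite (cochain_pos xc erefl) (cochain_pos xc' erefl) !(scaler0, addr0, cochain_br0l).
case: q y yc => [|q] y yc.
  by rewrite (cochain_pos yc erefl) !(scaler0, addr0, cochain_br0r).
have cc := is_cochain_lin c xc xc'.
have [c1 c2] := (br_cochain tw xc yc, br_cochain tw xc' yc).
have [xg yg] := (oper_ev (hat_cochain xc), oper_ev (hat_cochain yc)).
apply: cochain_eqf => //; [exact: br_cochain | exact: is_cochain_lin |].
move=> n w sw; rewrite H_lin; have sw' : size w = (p + q).+2 by rewrite sw; lia.
have h1 := ev_br tw cc yc sw'.
have h2 := ZZBc c (ev_br tw xc yc sw'); have h3 := ev_br tw xc' yc sw'.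
have gx := oper_ev (hat_cochain cc).
have h4 : Z (wt w) (dbr1 p q (H (c *: x + x')) (H y) w
    - (c%:P%:MP *: dbr1 p q (H x) (H y) w + dbr1 p q (H x') (H y) w)).
  rewrite -[X in _ - X](nrb_linl (m := p.+1) _ _ c yg sw').
  apply: (nrb_congl (m := p.+1) yg _ sw') => m v sv.
  by rewrite H_linE nrb_linr // subrr; exact: Z0.
have {}h4 := ZZB p h4; rewrite [X in _ - X]scalerDr !scalerA [_ * c%:P%:MP]mulrC in h4.
rewrite !scalerA in h2.
exact: Z_eq (ZB (ZB (ZD h1 h4) h2) h3) (cancel_linear _ _ _ _ _ _).
Qed.

Lemma structure_dg_lie : dg_lie (@is_cochain _ b a) (@cochain_d _ a b br) (@cochain_br _ a b br).
Proof.
split.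
- by move=> n; exact: is_cochain0.
- by move=> n c x y; exact: is_cochain_lin.
- by move=> n x; exact: d_cochain.
- by move=> p q x y; exact: br_cochain.
- by move=> n c x y; exact: d_lin.
- by move=> p q c x x' y; exact: br_linl.
- move=> p q c x y y' xc yc yc'; rewrite !(br_anti xc) //; last exact: is_cochain_lin.
  rewrite br_linl //.
  by rewrite degcast_lin scalerDr opprD scalerN !scalerA mulrC.
- by move=> p q x y; exact: br_anti.
- by move=> p q r x y z; exact: br_jacobi.
- by move=> n x; exact: d_sq.
- by move=> p q x y; exact: d_leibniz.
Qed.

End Structure.

(** * Homomorphisms and Maurer-Cartan elements *)

Section HomCochains.
Context {K : fieldType} {M N : lmodType {poly K}}.

Lemma lpoly0_const (x : lpoly N 0) : x = lconst 0 (x 0%MM).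
Proof.
apply: lpolyP => m /=; have -> : m = 0%MM by apply/mnmP => -[].
by rewrite eqxx.
Qed.

Lemma lpoly0_subst n (c : 'I_0 -> {mpoly {poly K}[n]}) (x : lpoly N 0) :
  lsubst c x = lconst n (x 0%MM).
Proof. by rewrite {1}(lpoly0_const x) lsubst_const. Qed.

Lemma poly_scalable (B : M -> N) : {morph B : x y / x + y} ->
  (forall (c : K) x, B (c%:P *: x) = c%:P *: B x) ->
  (forall x, B ('X *: x) = 'X *: B x) -> scalable B.
Proof.
move=> BD BC BX p; elim/poly_ind: p => [|p c IHp] x.
  by rewrite !scale0r; apply: (addrI (B 0)); rewrite -BD !addr0.
by rewrite !scalerDl BD BC -!scalerA IHp BX.
Qed.

Lemma ord1_fun (x : 'I_1 -> M) : x = fun=> x ord0.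
Proof. by apply/funext => i; rewrite (ord1 i). Qed.

Lemma lamdag1 : lamdag (ord0 : 'I_1) = - partial 0 :> {mpoly {poly K}[0]}.
Proof. by rewrite lamdag_max // big_ord0 oppr0 sub0r. Qed.

Lemma hom_is_cochain (B : {linear M -> N}) : is_cochain (hom_cochain B).
Proof.
split=> //.
- move=> i c y y' x; rewrite /hom_cochain (ord1 i) /= linearP lconstD lconstZ //.
- by move=> i x; rewrite (ord1 i) lamdag1 opprK /hom_cochain linearZ lconstZ.
- move=> s x; have -> : s = 1%g by apply/permP => i; rewrite !ord1.
  rewrite odd_perm1 scale1r; have -> : x \o (1%g : 'S_1) = x by apply/funext => i; rewrite /= perm1.
  by rewrite lpoly0_subst -lpoly0_const.
Qed.

(** In degree one sesquilinearity is commutation with d, as no parameter is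
    left. *)
Lemma is_cochain_hom (f : cochain M N 1) : is_cochain f ->
  exists B : {linear M -> N}, f = hom_cochain B.
Proof.
move=> fc; pose B u := f (fun=> u) 0%MM.
have fE x : f x = lconst 0 (B (x ord0)) by rewrite {1}(ord1_fun x) [LHS]lpoly0_const.
have Bl c u v : B (c%:P *: u + v) = c%:P *: B u + B v.
  have := cochain_lin fc ord0 c u v (fun=> 0).
  by rewrite !fE /= -lconstZ -lconstD => /(congr1 (fun g : lpoly N 0 => g 0%MM)) /=; rewrite eqxx.
have BD : {morph B : x y / x + y}.
  by move=> x y; have := Bl 1 x y; rewrite polyC1 !scale1r.
have B0 := morphD0 BD.
have BC (c : K) x : B (c%:P *: x) = c%:P *: B x by have := Bl c x 0; rewrite B0 !addr0.
have BX x : B ('X *: x) = 'X *: B x.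
  have := cochain_sesq fc ord0 (fun=> x); rewrite lamdag1 opprK !fE /= -lconstZ.
  by move=> /(congr1 (fun g : lpoly N 0 => g 0%MM)) /=; rewrite eqxx.
have Blin : linear B by move=> p x y; rewrite BD (poly_scalable BD BC BX).
pose Bm : {linear M -> N} := HB.pack B (GRing.isLinear.Build _ M N _ B Blin).
by exists Bm; apply/funext => x; rewrite fE.
Qed.

End HomCochains.

Section MaurerCartan.
Context {K : fieldType} {a b : lmodType {poly K}}.
Variable br : (a * b)%type -> (a * b)%type -> lpoly (a * b)%type 1.
Hypothesis tw : twilled br.
Hypothesis two_neq0 : 2%:R != 0 :> K.
Let lie := twilled_lie tw.

Variable B : {linear b -> a}.

Lemma capp_hom n s (x : seq b) : capp (hom_cochain B) s x = lconst n (B x`_0).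
Proof. by rewrite /capp /hom_cochain lsubst_const. Qed.

Lemma capp1_hom n s (x : seq b) (g : lpoly b n) :
  capp1 (hom_cochain B) s g x = lmap B g.
Proof. by apply: eq_lext => y; rewrite capp_hom. Qed.

Lemma lbr_const (U V W : lmodType {poly K}) n (f : U -> V -> lpoly W 1) s x y :
  (forall v, klin (f^~ v)) -> (forall u, klin (f u)) ->
  lbr f s (lconst n x) (lconst n y) = lsubst (fun=> s) (f x y).
Proof.
move=> fl fr; have f0 z : lsubst (fun=> s) (f z 0) = 0 by rewrite (klin0 (fr z)) lsubst0.
by rewrite /lbr !lext_const // (klin0 (fl y)) lsubst0.
Qed.

Lemma bra_swap x y : lswap (bra br x y) = - bra br y x.
Proof.
by rewrite /bra lswap_lmap (br_swap tw) lmapN.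
Qed.

Lemma enum_ord2 : enum 'I_2 = [:: ord0; ord_max].
Proof.
apply: (inj_map val_inj); rewrite val_enum_ord //.
Qed.

Lemma ldag0 (V : lmodType {poly K}) (g : lpoly V 1) :
  ldag (lsubst (fun=> lam (ord0 : 'I_2)) g) = g.
Proof.
rewrite /ldag lsubst_comp -[RHS]lsubst_lam; apply: eq_lsubst => i.
by rewrite msub_lam (ord1 i); exact: lamdag_lt.
Qed.

Lemma ldag1 (V : lmodType {poly K}) (g : lpoly V 1) :
  ldag (lsubst (fun=> lam (ord_max : 'I_2)) g) = lswap g.
Proof.
rewrite /ldag lsubst_comp; apply: eq_lsubst => i.
by rewrite msub_lam lamdag_max // big_ord1.
Qed.

Variable x : 'I_2 -> b.
Let u := x ord0.
Let v := x ord_max.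

Lemma d_hom : cochain_d br (hom_cochain B) x =
  rhob br u (B v) - lswap (rhob br v (B u)) - lmap B (brb br u v).
Proof.
rewrite cochain_dE dsumE enum_ord2 /= !capp_hom capp1_hom !big_seq1 /=.
rewrite !lbr_const; try by [exact: klin_rhob_l|exact: klin_rhob_r|exact: klin_brb_l|exact: klin_brb_r].
rewrite sqrrN expr1n !(expr0, expr1, scale1r, scaler0, addr0, add0r, scaleN1r).
by rewrite subr0 !ldagD !ldagN ldag_lmap !ldag0 ldag1.
Qed.

Lemma comp_hom : ldag (comp_sum br (hom_cochain B) (hom_cochain B) x) =
  lmap B (rhoa br (B u) v - lswap (rhoa br (B v) u)).
Proof.
have /= -> := @comp_sumE _ _ _ br 2 (fun i => injb (x i)) 0 1 (hom_cochain B) (hom_cochain B) erefl.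
rewrite enum_ord2 /= !capp_hom !capp1_hom !big_seq1 /=.
rewrite !lbr_const; try by [exact: klin_rhoa_l|exact: klin_rhoa].
rewrite !(expr0, expr1, scale1r, scaler0, addr0, add0r, scaleN1r).
rewrite oppr0 addr0 ldagD ldagN !ldag_lmap ldag0 ldag1 !(lmapD (raddfD B)).
by rewrite lmapN.
Qed.

Lemma cup_hom : ldag (cup_sum br (hom_cochain B) (hom_cochain B) x) =
  bra br (B u) (B v) + bra br (B u) (B v).
Proof.
have /= -> := @cup_sumE _ _ _ br 2 (fun i => injb (x i)) 1 1 (hom_cochain B) (hom_cochain B) erefl.
rewrite enum_ord2 /= !capp_hom !big_seq1 /=.
rewrite !lbr_const; try by [exact: klin_bra_l|exact: klin_bra_r].
rewrite !(expr0, expr1, scale1r, scaler0, addr0, add0r, scaleN1r).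
rewrite ?oppr0 ?addr0 ldagD ldagN ldag0 ldag1.
by rewrite bra_swap opprK.
Qed.

Lemma half_add n (g : lpoly a n) : (2%:R^-1 : K)%:P%:MP *: (g + g) = g.
Proof.
rewrite -mulr2n -scaler_nat scalerA; have -> : 2%:R = (2%:R : K)%:P%:MP :> {mpoly {poly K}[n]}.
  by rewrite !rmorph_nat.
by rewrite -!rmorphM mulVf // !rmorph1 scale1r.
Qed.

(** Both composition sums agree up to sign, and the bracket of B u and B v
    appears with its opposite exchange: the quadratic terms are doubled. *)
Lemma mc_hom : (cochain_d br (hom_cochain B) +
    2%:R^-1 *: cochain_br br (hom_cochain B) (hom_cochain B) : cochain b a 2) x =
  bra br (B u) (B v) + rhob br u (B v) - lswap (rhob br v (B u)) -
    lmap B (brb br u v + rhoa br (B u) v - lswap (rhoa br (B v) u)).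
Proof.
rewrite -[LHS]/(_ x + (2%:R^-1 : K)%:P%:MP *: _ x) d_hom.
have -> : cochain_br br (hom_cochain B) (hom_cochain B) x =
    (bra br (B u) (B v) - lmap B (rhoa br (B u) v - lswap (rhoa br (B v) u))) +
    (bra br (B u) (B v) - lmap B (rhoa br (B u) v - lswap (rhoa br (B v) u))).
  rewrite /cochain_br expr1 !scaleN1r opprK !ldagD !ldagN comp_hom cup_hom; abelian.
rewrite half_add -addrA !(lmapD (raddfD B)); set X := lmap B (brb br u v); abelian.
Qed.

End MaurerCartan.

Section Deformation.
Context {K : fieldType} {a b : lmodType {poly K}}.
Variable br : (a * b)%type -> (a * b)%type -> lpoly (a * b)%type 1.
Hypothesis tw : twilled br.
Hypothesis two_neq0 : 2%:R != 0 :> K.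

Lemma maurer_cartan_hom (B : {linear b -> a}) :
  cochain_d br (hom_cochain B) +
    2%:R^-1 *: cochain_br br (hom_cochain B) (hom_cochain B) = 0 <-> deformation_map br B.
Proof.
split=> [mc u v|defB].
  have := congr1 (fun f : cochain b a 2 => f (duo u v)) mc.
  by rewrite (mc_hom tw two_neq0) => /eqP; rewrite subr_eq0 => /eqP.
by apply/funext => x; rewrite (mc_hom tw two_neq0); apply/eqP; rewrite subr_eq0; apply/eqP/defB.
Qed.

Lemma pra_br_graph (x y : a) (u v : b) :
  lmap (@pra K a b) (br (x, u) (y, v)) = bra br x y + rhob br u y - lswap (rhob br v x).
Proof.
rewrite (br_split tw) !(lmapD (raddfD (@pra K a b))).
have -> : lmap (@pra K a b) (br (Pb (x, u)) (Pb (y, v))) = 0.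
  by apply: lpolyP => m; rewrite lmapE; [exact: (br_bb tw) | exact: raddfD].
rewrite addr0 addrAC; congr (_ + _ + _).
by rewrite /rhob lswap_lmap (br_swap tw) lmapN opprK.
Qed.

Lemma prb_br_graph (x y : a) (u v : b) :
  lmap (@prb K a b) (br (x, u) (y, v)) = brb br u v + rhoa br x v - lswap (rhoa br y u).
Proof.
rewrite (br_split tw) !(lmapD (raddfD (@prb K a b))).
have -> : lmap (@prb K a b) (br (Pa (x, u)) (Pa (y, v))) = 0.
  by apply: lpolyP => m; rewrite lmapE; [exact: (br_aa tw) | exact: raddfD].
rewrite add0r /rhoa lswap_lmap (br_swap tw) lmapN opprK.
by rewrite addrA addrC addrA.
Qed.

(** Both sides of the equation are read off from the bracket of two elements
    of the graph ([pra_br_graph], [prb_br_graph]). *)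
Lemma deformation_graph (B : {linear b -> a}) :
  deformation_map br B <-> left_deformation_map br B.
Proof.
have graphE u v : bra br (B u) (B v) + rhob br u (B v) - lswap (rhob br v (B u)) =
    lmap B (brb br u v + rhoa br (B u) v - lswap (rhoa br (B v) u)) <->
    forall k, (br (B u, u) (B v, v) k).1 = B (br (B u, u) (B v, v) k).2.
  rewrite -pra_br_graph -prb_br_graph; split=> [e k|e].
    have := congr1 (fun g : lpoly a 1 => g k) e.
    by rewrite !lmapE; try exact: raddfD.
  by apply: lpolyP => k; rewrite !lmapE; try exact: raddfD; exact: e.
split=> [defB|[_ _ subB] u v].
  split.
  - by exists 0; rewrite raddf0.
  - by move=> p _ _ [u ->] [v ->]; exists (p *: u + v); rewrite linearP.
  move=> _ _ k [u ->] [v ->]; exists (br (B u, u) (B v, v) k).2.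
  by rewrite -(proj1 (graphE u v) (defB u v) k) -surjective_pairing.
apply/graphE => k; have [|t ->] := subB (B u, u) (B v, v) k _ (ex_intro _ v erefl).
  by exists u.
by [].
Qed.

End Deformation.

Theorem corollary4p22 (R : realType) (a b : lmodType {poly R[i]})
    (br : (a * b)%type -> (a * b)%type -> lpoly (a * b)%type 1)
    (fin_a : finitely_generated a) (fin_b : finitely_generated b)
    (tw : twilled br) :
  [/\ (forall p (f : cochain b a p), is_cochain f -> hat (cochain_d br f) = l1 br f),
      (forall p q (f1 : cochain b a p) (f2 : cochain b a q),
         is_cochain f1 -> is_cochain f2 ->
         hat (cochain_br br f1 f2) = (-1) ^+ p.-1 *: l2 br f1 f2),
      (forall p q r (f1 : cochain b a p) (f2 : cochain b a q)
          (f3 : cochain b a r),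
         is_cochain f1 -> is_cochain f2 -> is_cochain f3 ->
         l3 br f1 f2 f3 = 0),
      dg_lie (@is_cochain _ b a) (@cochain_d _ a b br) (@cochain_br _ a b br)
    & (forall f : cochain b a 1,
         maurer_cartan (@is_cochain _ b a) (@cochain_d _ a b br) (@cochain_br _ a b br) f
         <-> exists2 B : {linear b -> a}, f = hom_cochain B & deformation_map br B)
      /\ (forall B : {linear b -> a},
            deformation_map br B <-> left_deformation_map br B)].
Proof.
have [n2 n3] : (2%:R : R[i]) != 0 /\ (3%:R : R[i]) != 0 by rewrite !Num.Theory.pnatr_eq0.
split.
- by move=> p f; exact: hat_d_l1.
- by move=> p q f1 f2; exact: hat_br_l2.
- by move=> p q r f1 f2 f3 _ _ _; exact: l3_0.
- exact: structure_dg_lie.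
split=> [f|B]; last exact: deformation_graph.
split=> [[/is_cochain_hom[B ->]]|[B -> defB]].
  by move/(maurer_cartan_hom tw n2) => defB; exists B.
by split; [exact: hom_is_cochain | exact/(maurer_cartan_hom tw n2)].
Qed.
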